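(* Let $f$ be a probability density on $\mathbb{R}$ with finite moment sequence. If $f$ has finite logarithmic integral, i.e. $$\int_{\mathbb{R}} -\frac{\ln f(x)}{1+x^2}\,dx<\infty,$$ then $S_{\mathbb{R}}\left(f,\cos(\mathcal{H}\ln f)\right)$ and $S_{\mathbb{R}}\left(f,\sin(\mathcal{H}\ln f)\right)$ are Stieltjes classes, where $$\mathcal{H}u(t)=\frac{1}{\pi}\,P\int_{-\infty}^{\infty}\left(\frac{1}{t-x}+\frac{x}{1+x^2}\right)u(x)\,dx,\quad t\in\mathbb{R}.$$
   Context: A density $f$ on $\mathbb{R}$ is a nonnegative measurable function with $\int_{\mathbb{R}} f=1$. It has finite moment sequence if $\int_{\mathbb{R}} x^n f(x)\,dx$ is finite (absolutely convergent) for all integers $n\ge 1$. For $u:\mathbb{R}\to\mathbb{R}$ with $\int_{-\infty}^{\infty}\frac{|u(t)|}{1+t^2}\,dt<\infty$, the Hilbert transform $\mathcal{H}u$ is the function defined for a.e. $t\in\mathbb{R}$ by the principal value $$\mathcal{H}u(t)=\frac{1}{\pi}\lim_{\varepsilon\to 0^+}\int_{|x-t|>\varepsilon}\left(\frac{1}{t-x}+\frac{x}{1+x^2}\right)u(x)\,dx .$$ (The symbol $P\int$ denotes this principal value.) Stieltjes class: let $I=\mathbb{R}$ and let $f$ be a density on $I$ with finite moment sequence. Let $h$ be a bounded measurable function on $I$ with $\sup_{x\in I}|h(x)|\le 1$ such that $\int_I x^n f(x)h(x)\,dx=0$ for all integers $n\ge 0$ and $fh$ is not identically zero (functions being identified when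 equal almost everywhere). Then $$S_I(f,h)=\left\{f(x)\left[1+\varepsilon h(x)\right]: x\in I,\ \varepsilon\in[-1,1]\right\}$$ is called the Stieltjes class with center $f$ and perturbation $h$. Saying that $S_I(f,h)$ is a Stieltjes class means that $h$ satisfies all these conditions with respect to $f$. *)

(* Defs.v *)
From HB Require Import structures.
From mathcomp Require Import all_boot all_order all_algebra.
From mathcomp Require Import all_classical all_reals all_analysis.

Set Implicit Arguments.
Unset Strict Implicit.
Unset Printing Implicit Defensive.
Import Order.TTheory GRing.Theory Num.Theory.
Import numFieldNormedType.Exports.

Local Open Scope classical_set_scope.
Local Open Scope ring_scope.

Definition is_density (R : realType) (f : R -> R) : Prop :=
  [/\ measurable_fun setT f,
      (forall x, 0 <= f x) &
      (\int[@lebesgue_measure R]_x (f x)%:E)%E = 1%E].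

Definition finite_moments (R : realType) (f : R -> R) : Prop :=
  forall n : nat, (1 <= n)%N ->
    (@lebesgue_measure R).-integrable setT (fun x => (x ^+ n * f x)%:E).

(* [lne] is the extended logarithm, with [lne 0 = -oo]: a density that vanishes
   on a set of positive measure does not have finite logarithmic integral.
   For a density the negative part of the integrand is integrable, because
   ln y <= y, so the integral never has the form +oo - oo. *)
Definition finite_log_integral (R : realType) (f : R -> R) : Prop :=
  (\int[@lebesgue_measure R]_x
     (- lne (f x)%:E * ((1 + x ^+ 2)^-1)%:E) < +oo)%E.

(* Where the principal value does not exist, [lim] is a default value. When
   |u(t)| / (1 + t^2) is integrable this happens only on a null set, and each
   truncated integral converges absolutely. *)
Definition hilbert_transform (R : realType) (u : R -> R) (t : R) : R :=
  pi^-1 * lim ((fun e : R =>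
    \int[@lebesgue_measure R]_(x in [set x : R | e < `|x - t|])
      (((t - x)^-1 + x / (1 + x ^+ 2)) * u x)) @ 0^'+).

(* The class {f (1 + e h) : -1 <= e <= 1} is determined by its center f and its
   perturbation h, so being a Stieltjes class is a condition on (f, h). *)
Definition is_stieltjes_class (R : realType) (f h : R -> R) : Prop :=
  [/\ is_density f /\ finite_moments f,
      measurable_fun setT h,
      (forall x, `|h x| <= 1),
      (forall n : nat,
        (\int[@lebesgue_measure R]_x (x ^+ n * f x * h x)%:E)%E = 0%E) &
      ~ {ae @lebesgue_measure R, forall x, f x * h x = 0}].

(* Main.v *)
Require Import Defs.
From mathcomp Require Import all_boot all_order all_algebra.
From mathcomp Require Import all_classical all_reals all_analysis.
From mathcomp Require Import measurable_realfun.
From mathcomp Require Import complex ring lra.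

Set Implicit Arguments.
Unset Strict Implicit.
Unset Printing Implicit Defensive.
Import Order.TTheory GRing.Theory Num.Theory.
Import numFieldNormedType.Exports.

Local Open Scope classical_set_scope.
Local Open Scope ring_scope.

(** Let [u = ln f] and let [w] be the holomorphic function in the upper half-plane whose
    real and imaginary parts are the Poisson and conjugate Poisson integrals of [u].
    The outer function [exp w] has boundary modulus [f] and boundary argument the
    Hilbert transform [H] of [u], so that its boundary function is
    [f cos H + i f sin H]. It belongs to the Hardy space [H^1], hence the integral of
    its product with a power [z ^ n] over the real line vanishes by Cauchy's theorem;
    the real and imaginary parts of that identity are the moment conditions for
    [f cos H] and [f sin H].

    For the nontriviality, pair [exp w] with [1 / (z + i)] instead of a power. This
    gives two linear relations between the integrals of [f cos H] and [f sin H]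
    against [x / (1 + x ^ 2)] and [1 / (1 + x ^ 2)]. If one of the two functions were
    zero almost everywhere, the integral of the other against [1 / (1 + x ^ 2)] would
    vanish too, and by the Poisson formula [exp w] would have a zero at the point [i].

    The boundary behaviour is obtained for the square root [s = exp (w / 2)], called
    [outer] below.
    - Jensen's inequality bounds [|s| ^ 2] by the Poisson integral of [f]
      ([outer_jensen]), so the mean squares of [s] on horizontal lines are bounded
      ([outer_hardy]).
    - For [d = s / (z + i)], called [damp], a contour shift shows that the inner product
      of two horizontal sections is the squared norm of the section halfway between
      them ([damp_polar]). Consequently the sections form a Cauchy family in the mean
      square, and they converge almost everywhere along a sequence of heights
      ([damp_boundary_seq]).
    - The Poisson representation of bounded holomorphic functions ([poisson_repr])
      passes to the limit ([boundary_poisson]). So [s] and [s ^ 2] are Poisson integrals of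
      their boundary functions, and almost everywhere [s (t + i y)] converges as [y]
      tends to 0 ([poisson_cvg]).
    - The limit is not zero, because [|s|] tends to the square root of [f]. The
      continuous argument of [s] therefore converges ([lift_cvg]). That argument is half
      the conjugate Poisson integral of [u], which at Lebesgue points differs from the
      truncated Hilbert integral by a quantity tending to 0 ([conjp_truncp]). Hence the
      principal value exists and is the argument of the boundary function of [s ^ 2]
      ([hilbert_transform_boundary]).

    The perturbations must be Borel functions on the whole line, including the null set
    where the principal value does not exist ([measurable_hilbert_transform]). *)

(** * Integrable functions on the line and the Poisson kernel *)

Section integrals.
Variable R : realType.
Local Notation mu := (@lebesgue_measure R).
Implicit Types (f g h u v : R -> R) (t x y : R).

Definition L1 g := mu.-integrable setT (EFin \o g).

Lemma L1_measurable g : L1 g -> measurable_fun setT g.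
Proof. by move=> /integrableP[/measurable_EFinP]. Qed.

Lemma L1_le g h : measurable_fun setT g -> (forall x, `|g x| <= h x) -> L1 h -> L1 g.
Proof.
move=> mg gh; apply: le_integrable => //; first exact/measurable_EFinP.
by move=> x _ /=; rewrite lee_fin (le_trans (gh x))// ler_norm.
Qed.

Lemma L1D g h : L1 g -> L1 h -> L1 (fun x => g x + h x).
Proof. by move=> g1 h1; have := integrableD measurableT g1 h1. Qed.

Lemma L1B g h : L1 g -> L1 h -> L1 (fun x => g x - h x).
Proof. by move=> g1 h1; have := integrableB measurableT g1 h1. Qed.

Lemma L1Z c g : L1 g -> L1 (fun x => c * g x).
Proof. by move=> g1; have := integrableZl measurableT c g1. Qed.

Lemma L1_norm g : L1 g -> L1 (fun x => `|g x|).
Proof. exact: integrable_norm. Qed.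

Lemma L1_integral g : L1 g -> (\int[mu]_x (g x)%:E)%E = (\int[mu]_x g x)%:E.
Proof. by move=> g1; rewrite /Rintegral fineK//; exact: integrable_fin_num. Qed.

Lemma L1_ge0 g I : measurable_fun setT g -> (forall x, 0 <= g x) ->
  (\int[mu]_x (g x)%:E)%E = I%:E -> L1 g /\ \int[mu]_x g x = I.
Proof.
move=> mg g0 gI; split; last by rewrite /Rintegral gI.
apply/integrableP; split; first exact/measurable_EFinP.
under eq_integral do rewrite /= ger0_norm//.
by rewrite gI ltry.
Qed.

Lemma ae_mono (P Q : R -> Prop) : (forall x, P x -> Q x) ->
  {ae mu, forall x, P x} -> {ae mu, forall x, Q x}.
Proof.
move=> PQ [N [mN N0 sN]]; exists N; split => // x nQ; apply: sN => /= Px.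
by apply: nQ; exact: PQ.
Qed.

Lemma ae_and (P Q : R -> Prop) : {ae mu, forall x, P x} ->
  {ae mu, forall x, Q x} -> {ae mu, forall x, P x /\ Q x}.
Proof.
move=> [N [mN N0 sN]] [M [mM M0 sM]]; exists (N `|` M); split.
- exact: measurableU.
- by apply: null_set_setU.
- move=> x /= nPQ; have [Px|nPx] := pselect (P x); last by left; exact: sN.
  by right; apply: sM => /= Qx; exact: nPQ.
Qed.

Lemma dominated_cvgR (g_ : nat -> R -> R) g h :
  (forall n, measurable_fun setT (g_ n)) -> measurable_fun setT g ->
  {ae mu, forall x, g_ n x @[n --> \oo] --> g x} -> L1 h ->
  {ae mu, forall x, forall n, `|g_ n x| <= h x} ->
  L1 g /\ (\int[mu]_x g_ n x) @[n --> \oo] --> \int[mu]_x g x.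
Proof.
move=> mg_ mg cg ih gh.
have [] := @dominated_convergence _ _ _ mu setT measurableT
  (fun n x => (g_ n x)%:E) (EFin \o g) (EFin \o h) _ _ _ ih _.
- by move=> n; apply/measurable_EFinP; exact: mg_.
- exact/measurable_EFinP.
- by apply: ae_mono cg => x gx _; apply: cvg_EFin => //; exact: nearW.
- by apply: ae_mono gh => x ghx n _; rewrite /= lee_fin; exact: ghx.
move=> ig _ cvI; split => //.
apply: fine_cvg.
by rewrite /= -/(L1_integral _) fineK//; exact: integrable_fin_num.
Qed.

Lemma lebesgue_measure_reflect (c : R) (A : set R) : measurable A ->
  pushforward mu ((fun x => c - x) : _ -> measurableTypeR R) A = mu A.
Proof.
move=> mA.
have mphi : measurable_fun setT ((fun x => c - x) : _ -> measurableTypeR R).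
  exact: measurable_funB.
apply/esym/lebesgue_measure_unique => //= _ [[a b]] _ <-.
rewrite /pushforward.
have -> : (fun x => c - x) @^-1` [set` `]a, b]] = [set` `[c - b, c - a[].
  by apply/seteqP; split=> x /=; rewrite !in_itv/=; lra.
rewrite !lebesgue_measure_itv/= !lte_fin.
have -> : (c - b < c - a) = (a < b) by apply/idP/idP; lra.
by case: ifP => // _; rewrite -!EFinB; congr EFin; lra.
Qed.

Lemma L1_reflect (c : R) g : L1 g -> L1 (fun x => g (c - x)).
Proof.
move=> ig.
have mg := L1_measurable ig.
have mphi : measurable_fun setT ((fun x => c - x) : _ -> measurableTypeR R).
  exact: measurable_funB.
apply/integrableP; split.
  by apply/measurable_EFinP; apply: (measurableT_comp mg).
have -> : (\int[mu]_x `|(EFin \o (fun x => g (c - x)%R)) x|)%E =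
    (\int[pushforward mu ((fun x => c - x)%R : _ -> measurableTypeR R)]_x `|(g x)%:E|)%E.
  rewrite ge0_integral_pushforward//.
  by apply: measurableT_comp => //; exact/measurable_EFinP.
rewrite (eq_measure_integral mu).
  by move/integrableP : ig => [].
by move=> A mA _; exact: lebesgue_measure_reflect.
Qed.

Lemma integral_reflect (c : R) g : L1 g ->
  \int[mu]_x g (c - x) = \int[mu]_x g x.
Proof.
move=> ig.
have mg := L1_measurable ig.
have mphi : measurable_fun setT ((fun x => c - x) : _ -> measurableTypeR R).
  exact: measurable_funB.
rewrite /Rintegral; congr fine; apply: esym.
rewrite (eq_measure_integral (pushforward mu ((fun x => c - x)%R : _ -> measurableTypeR R))).
  rewrite integral_pushforward//; first exact/measurable_EFinP.
  exact: L1_reflect.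
by move=> A mA _; exact/esym/lebesgue_measure_reflect.
Qed.

Lemma integral_poisson y t : 0 < y ->
  (\int[mu]_x (y / ((t - x) ^+ 2 + y ^+ 2))%:E)%E = pi%:E.
Proof.
move=> y0.
have H0 : (\int[mu]_x ((oneDsqr x)^-1)%:E)%E = (pi : R)%:E.
  rewrite (@ge0_symfun_integralT _ (fun x => (oneDsqr x)^-1)).
  - have -> : [set x : R | 0 <= x] = [set` `[0, +oo[] by rewrite set_itvcy.
    by rewrite integral0y_oneDsqr -EFinM; congr EFin; lra.
  - by move=> x; rewrite invr_ge0 (le_trans _ (oneDsqr_ge1 x)).
  - exact: continuous_oneDsqrV.
  - by move=> x; rewrite /= /oneDsqr sqrrN.
rewrite -H0.
pose F x := y^-1 * (x - t).
have dF x : is_derive x 1 F y^-1.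
  rewrite /F; apply: is_derive_eq.
  by rewrite subr0 /GRing.scale/= mulr1.
have F'E : derive1 F = cst y^-1.
  by apply/funext => x; rewrite derive1E derive_val.
rewrite [RHS](@increasing_ge0_integration_by_substitutionT _ F).
- apply: eq_integral => x _ /=; congr EFin.
  rewrite F'E /oneDsqr /F /=.
  have yn0 : y != 0 by rewrite gt_eqF.
  have dn0 : (t - x) ^+ 2 + y ^+ 2 != 0.
    by rewrite gt_eqF// ltr_wpDl ?sqr_ge0 ?exprn_gt0.
  have dn1 : 1 + (y^-1 * (x - t)) ^+ 2 != 0.
    by rewrite gt_eqF// ltr_pwDl ?sqr_ge0.
  have E : 1 + (y^-1 * (x - t)) ^+ 2 = ((t - x) ^+ 2 + y ^+ 2) / y ^+ 2 by field.
  rewrite -[RHS]/((1 + (y^-1 * (x - t)) ^+ 2)^-1 * y^-1) E.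
  by field; rewrite yn0.
- by move=> a b ab; rewrite /F ltr_pM2l ?invr_gt0// ltrD2r.
- by rewrite F'E => x; exact: cst_continuous.
- by rewrite F'E; apply: is_cvg_cst.
- by rewrite F'E; apply: is_cvg_cst.
- by move=> x; apply: ex_derive.
- apply/cvgrNyPle => A; near=> x; rewrite /F mulrC ler_pdivrMr// lerBlDr.
  by near: x; apply: nbhs_ninfty_le; exact: num_real.
- apply/cvgryPge => A; near=> x; rewrite /F mulrC ler_pdivlMr// lerBrDr.
  by near: x; apply: nbhs_pinfty_ge; exact: num_real.
- exact: continuous_oneDsqrV.
- by move=> x; rewrite invr_ge0 (le_trans _ (oneDsqr_ge1 x)).
Unshelve. all: end_near. Qed.

Definition pois t y x : R := y / ((t - x) ^+ 2 + y ^+ 2).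

Definition wt x : R := (1 + x ^+ 2)^-1.

Lemma den_gt0 t y : 0 < y -> 0 < t ^+ 2 + y ^+ 2.
Proof. by move=> y0; rewrite ltr_wpDl ?sqr_ge0// exprn_gt0. Qed.

Lemma oneDsq_gt0 x : 0 < 1 + x ^+ 2.
Proof. by rewrite ltr_pwDl// sqr_ge0. Qed.

Lemma wt_gt0 x : 0 < wt x. Proof. by rewrite invr_gt0 oneDsq_gt0. Qed.

Lemma pois_gt0 t y x : 0 < y -> 0 < pois t y x.
Proof. by move=> y0; rewrite divr_gt0// den_gt0. Qed.

Lemma wt_ge0 x : 0 <= wt x. Proof. exact/ltW/wt_gt0. Qed.

Lemma pois_ge0 t y x : 0 < y -> 0 <= pois t y x.
Proof. by move=> y0; exact/ltW/pois_gt0. Qed.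

Lemma continuous_pois t y : 0 < y -> continuous (pois t y).
Proof.
move=> y0 x; apply: cvgM; first exact: cvg_cst.
apply: cvgV; first by rewrite gt_eqF// den_gt0.
apply: cvgD; last exact: cvg_cst.
have H : (t - x0) @[x0 --> x] --> t - x.
  by apply: cvgB; [exact: cvg_cst|exact: cvg_id].
by rewrite !expr2; apply: cvgM.
Qed.

Lemma measurable_pois t y : 0 < y -> measurable_fun setT (pois t y).
Proof. by move=> y0; apply: continuous_measurable_fun; exact: continuous_pois. Qed.

Lemma measurable_wt : measurable_fun setT wt.
Proof.
apply: continuous_measurable_fun; exact: continuous_oneDsqrV.
Qed.

Lemma L1_pois t y : 0 < y -> L1 (pois t y).
Proof.
move=> y0; have [] // := @L1_ge0 (pois t y) pi _ _ (integral_poisson t y0).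
  exact: measurable_pois.
by move=> x; exact/ltW/pois_gt0.
Qed.

Lemma int_pois t y : 0 < y -> \int[mu]_x pois t y x = pi.
Proof. by move=> y0; rewrite /Rintegral (integral_poisson t y0). Qed.

Lemma wt_pois x : wt x = pois 0 1 x.
Proof. by rewrite /wt /pois sub0r sqrrN expr1n addrC div1r. Qed.

Lemma L1_wt : L1 wt.
Proof. by rewrite (_ : wt = pois 0 1); [exact: L1_pois|apply/funext => x; exact: wt_pois]. Qed.

(** The constant by which the denominators [(t - x) ^ 2 + y ^ 2], for [|t| <= T] and
    [y >= s], must be multiplied to exceed [1 + x ^ 2] for all [x]. *)
Definition cmp (T s : R) : R := 2 + (1 + 2 * T ^+ 2) / s ^+ 2.

Lemma cmp_gt0 T s : 0 < s -> 0 < cmp T s.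
Proof.
by move=> s0; rewrite /cmp ltr_pwDl// divr_ge0 ?sqr_ge0// addr_ge0// mulr_ge0// sqr_ge0.
Qed.

Lemma den_cmp T s t y x : 0 < s -> s <= y -> `|t| <= T ->
  1 + x ^+ 2 <= cmp T s * ((t - x) ^+ 2 + y ^+ 2).
Proof.
move=> s0 sy tT.
have y0 : 0 < y by exact: lt_le_trans sy.
have tT2 : t ^+ 2 <= T ^+ 2.
  by rewrite -[t ^+ 2]real_normK ?num_real// lerXn2r// nnegrE// (le_trans _ tT).
have sy2 : s ^+ 2 <= y ^+ 2 by rewrite lerXn2r// nnegrE ltW.
have H1 : 1 + 2 * T ^+ 2 <= (1 + 2 * T ^+ 2) / s ^+ 2 * y ^+ 2.
  rewrite -mulrA ler_peMr//; first by rewrite addr_ge0// mulr_ge0// sqr_ge0.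
  by rewrite mulrC ler_pdivlMr ?exprn_gt0// mul1r.
have H2 : 0 <= (1 + 2 * T ^+ 2) / s ^+ 2 * (t - x) ^+ 2.
  by rewrite mulr_ge0 ?sqr_ge0// divr_ge0 ?sqr_ge0// addr_ge0// mulr_ge0// sqr_ge0.
rewrite /cmp mulrDl [X in _ <= _ + X]mulrDr.
have H3 : 0 <= (2 * t - x) ^+ 2 by exact: sqr_ge0.
have H4 : 0 <= y ^+ 2 by exact: sqr_ge0.
nra.
Qed.

Lemma denV_le T s t y x : 0 < s -> s <= y -> `|t| <= T ->
  ((t - x) ^+ 2 + y ^+ 2)^-1 <= cmp T s * wt x.
Proof.
move=> s0 sy tT; have y0 : 0 < y by exact: lt_le_trans sy.
rewrite /wt ler_pdivlMr ?oneDsq_gt0// mulrC ler_pdivrMr ?den_gt0//.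
exact: den_cmp.
Qed.

Lemma pois_le T s t y x : 0 < s -> s <= y -> `|t| <= T ->
  pois t y x <= y * cmp T s * wt x.
Proof.
move=> s0 sy tT; have y0 : 0 < y by exact: lt_le_trans sy.
by rewrite /pois -mulrA ler_pM2l// denV_le.
Qed.

(** The natural domain of the Hilbert transform: Poisson, conjugate Poisson and truncated
    Hilbert kernels are all bounded by a multiple of [wt]. *)
Definition Lw u := measurable_fun setT u /\ L1 (fun x => wt x * u x).

Lemma L1_Lw (k : R -> R) (C : R) u : Lw u -> measurable_fun setT k ->
  (forall x, `|k x| <= C * wt x) -> L1 (fun x => k x * u x).
Proof.
move=> [mu_ u1] mk kC.
apply: (@L1_le _ (fun x => C * `|wt x * u x|)).
- exact: measurable_funM.
- move=> x; rewrite !normrM (gtr0_norm (wt_gt0 x)) mulrA ler_wpM2r//; exact: kC.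
- by apply: L1Z; exact: L1_norm.
Qed.

Lemma L1_pois_Lw t y u : Lw u -> 0 < y -> L1 (fun x => pois t y x * u x).
Proof.
move=> lu y0; apply: (@L1_Lw _ (y * cmp `|t| y)) => //; first exact: measurable_pois.
by move=> x; rewrite gtr0_norm ?pois_gt0//; exact: pois_le.
Qed.

(** * Lebesgue points and Poisson averages *)

Definition bal t r x : R := if `|t - x| < r then 1 else 0.

Lemma balE t r : bal t r = \1_(ball t r).
Proof.
apply/funext => x; rewrite indicE /bal; case: ifPn => h.
  by rewrite mem_set.
by rewrite memNset//; apply/negP.
Qed.

Lemma measurable_bal t r : measurable_fun setT (bal t r).
Proof. by rewrite balE; apply: measurable_indic; exact: measurable_ball. Qed.

Lemma bal_ge0 t r x : 0 <= bal t r x.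
Proof. by rewrite /bal; case: ifP. Qed.

Lemma bal_le t r x : bal t r x <= (r ^+ 2 + 1) * cmp `|t| 1 * wt x.
Proof.
have H : bal t r x <= (r ^+ 2 + 1) * ((t - x) ^+ 2 + 1 ^+ 2)^-1.
  have d0 := @den_gt0 (t - x) 1 ltr01.
  rewrite ler_pdivlMr// /bal; case: ifP => h; last by rewrite mul0r addr_ge0// sqr_ge0.
  rewrite mul1r expr1n lerD2r -[_ ^+ 2]real_normK ?num_real//.
  by rewrite lerXn2r// ?nnegrE// (le_trans _ (ltW h)).
apply: (le_trans H); rewrite -mulrA ler_wpM2l ?addr_ge0 ?sqr_ge0//.
exact: denV_le.
Qed.

Lemma L1_bal t r u : Lw u -> L1 (fun x => bal t r x * u x).
Proof.
move=> lu; apply: (@L1_Lw _ ((r ^+ 2 + 1) * cmp `|t| 1)) => //.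
  exact: measurable_bal.
by move=> x; rewrite ger0_norm ?bal_ge0//; exact: bal_le.
Qed.

Lemma LwB u v : Lw u -> Lw v -> Lw (fun x => u x - v x).
Proof.
move=> [mu_ u1] [mv v1]; split; first exact: measurable_funB.
rewrite (_ : (fun x => _) = (fun x => wt x * u x - wt x * v x)); first exact: L1B.
by apply/funext => x; rewrite mulrBr.
Qed.

Lemma Lw_cst (c : R) : Lw (cst c).
Proof.
split => //.
rewrite (_ : (fun x => _) = (fun x => c * wt x)); first by apply: L1Z; exact: L1_wt.
by apply/funext => x; rewrite mulrC.
Qed.

Lemma Lw_norm u : Lw u -> Lw (fun x => `|u x|).
Proof.
move=> [mu_ u1]; split; first exact: measurableT_comp.
rewrite (_ : (fun x => _) = (fun x => `|wt x * u x|)); first exact: L1_norm.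
by apply/funext => x; rewrite normrM (gtr0_norm (wt_gt0 x)).
Qed.

Lemma Lw_locally_integrable u : Lw u -> locally_integrable setT u.
Proof.
move=> lu; have [mu_ _] := lu; split => //; first exact: openT.
move=> K _ cK.
have [M [Mr MK]] := compact_bounded cK.
pose r := `|M| + 2.
have Kb : forall x, K x -> `|x| < r.
  move=> x Kx; apply: (@le_lt_trans _ _ (`|M| + 1)); last by rewrite /r ltrD2l ltr1n.
  by apply: MK => //; rewrite (le_lt_trans (ler_norm _))// ltrDl.
have I1 := L1_bal 0 r (Lw_norm lu).
apply: (@le_lt_trans _ _ (\int[mu]_x `|(bal 0 r x * `|u x|)%:E|)%E); last first.
  by move/integrableP : I1 => [].
apply: (@le_trans _ _ (\int[mu]_(x in K) `|(bal 0 r x * `|u x|)%:E|)%E).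
  apply: ge0_le_integral => //.
  - exact: compact_measurable.
  - by apply/measurable_EFinP; apply: measurableT_comp => //; exact: measurable_funTS.
  - apply: measurableT_comp => //; apply: measurable_funTS.
    by case/integrableP : I1.
  - move=> x Kx; rewrite lee_fin normrM normr_id ger0_norm ?bal_ge0//.
    by rewrite /bal sub0r normrN Kb// mul1r.
apply: ge0_subset_integral => //; first exact: compact_measurable.
by apply: measurableT_comp => //; case/integrableP : I1.
Qed.

Lemma lebesgue_pt_bal u t : Lw u -> lebesgue_pt u t ->
  forall e, 0 < e -> exists2 d, 0 < d & forall r, 0 < r -> r < d ->
    \int[mu]_x (bal t r x * `|u x - u t|) <= e * r.
Proof.
move=> lu ut e e0.
have e20 : 0 < e / 2 by rewrite divr_gt0.
move/fine_cvgP : (ut) => [fin /cvgrPdist_lt /(_ _ e20)].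
case=> d1 /= d10 H1; case: fin => d2 /= d20 H2.
exists (Num.min d1 d2); first by rewrite lt_min d10.
move=> r r0; rewrite lt_min => /andP[rd1 rd2].
have B1 : ball_ [eta Num.norm] 0 d1 r by rewrite /= sub0r normrN gtr0_norm.
have {H1} := H1 _ B1 r0.
set I := \int[mu]_x _.
have iI : L1 (fun x => bal t r x * `|u x - u t|).
  by apply: L1_bal; apply: Lw_norm; apply: LwB => //; exact: Lw_cst.
have I0 : 0 <= I by apply: Rintegral_ge0 => x _; rewrite mulr_ge0// bal_ge0.
have -> : davg u t r = ((r *+ 2)^-1 * I)%:E.
  rewrite /davg /iavg lebesgue_measure_ball ?ltW// inver mulrn_eq0/= gt_eqF//.
  rewrite EFinM; congr (_ * _)%E; rewrite -(L1_integral iI) [LHS]integral_mkcond.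
  apply: eq_integral => x _; rewrite patchE /bal /=.
  case: ifPn => h.
    by rewrite (_ : `|t - x| < r) ?mul1r//; move/set_mem: h.
  rewrite ifF ?mul0r//; apply/negbTE; move: h; apply: contra => h.
  by rewrite mem_set.
have r20 : 0 < r *+ 2 by rewrite mulrn_wgt0.
rewrite sub0r normrN/= ger0_norm; last by rewrite mulr_ge0// invr_ge0 ltW.
rewrite mulrC ltr_pdivrMr// => /ltW h.
by apply: (le_trans h); rewrite -mulr_natr; lra.
Qed.

Lemma pois_le_inv t y x r : 0 < y -> 0 < r -> r <= `|t - x| -> pois t y x <= y / r ^+ 2.
Proof.
move=> y0 r0 rx; rewrite /pois ler_pM2l// lef_pV2 ?posrE ?den_gt0 ?exprn_gt0//.
rewrite -[(t - x) ^+ 2]real_normK ?num_real// (@le_trans _ _ (`|t - x| ^+ 2))//.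
  by rewrite lerXn2r// nnegrE// ltW.
by rewrite lerDl sqr_ge0.
Qed.

Lemma pois_le_V t y x : 0 < y -> pois t y x <= y^-1.
Proof.
move=> y0; rewrite /pois ler_pdivrMr ?den_gt0// mulrC ler_pdivlMr//.
by rewrite -expr2 lerDr sqr_ge0.
Qed.

Lemma dyadic_scale y d : 0 < y -> y <= d ->
  exists K : nat, 2 ^+ K * y <= d < 2 ^+ K.+1 * y.
Proof.
move=> y0 yd.
have ex : exists n : nat, d < 2 ^+ n * y.
  exists (Num.bound (d / y)); rewrite -ltr_pdivrMr//.
  apply: lt_le_trans (archi_boundP _) _.
    by rewrite divr_ge0// ltW// (lt_le_trans y0).
  by rewrite -natrX ler_nat ltnW// ltn_expl.
case: (ex_minnP ex) => -[|m] hm min.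
  by move: hm; rewrite expr0 mul1r ltNge yd.
exists m; rewrite hm andbT leNgt; apply/negP => h.
by have := min _ h; rewrite ltnn.
Qed.

(** The Poisson kernel at height [y] is at most [y / r ^ 2] outside the ball of radius [r].
    The ball of radius [2 ^ K * y] therefore contributes a geometric series of averages
    over dyadic balls; the bound [5 - 4 / 2 ^ K] is the partial sum [1 + 2 + 1 + 1/2 + ...]. *)
Lemma pois_dyadic (phi : R -> R) t (e d y : R) K : Lw phi -> (forall x, 0 <= phi x) ->
  0 < y -> 0 < e ->
  (forall r : R, 0 < r -> r < d -> \int[mu]_x (bal t r x * phi x) <= e * r) ->
  2 ^+ K * y < d ->
  \int[mu]_x (pois t y x * (bal t (2 ^+ K * y) x * phi x)) <= e * (5 - 4 / 2 ^+ K).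
Proof.
move=> lphi phi0 y0 e0 small.
have lB r : Lw (fun x => bal t r x * phi x).
  split; first by apply: measurable_funM; [exact: measurable_bal|case: lphi].
  apply: (@L1_le _ (fun x => wt x * phi x)).
  - apply: measurable_funM; first exact: measurable_wt.
    by apply: measurable_funM; [exact: measurable_bal|case: lphi].
  - move=> x; rewrite ger0_norm ?mulr_ge0 ?bal_ge0 ?wt_ge0//.
    rewrite ler_wpM2l ?wt_ge0// /bal; case: ifP; rewrite ?mul1r ?mul0r//.
  - by case: lphi.
elim: K => [|K IH].
  rewrite expr0 mul1r divr1 (_ : 5 - 4 = 1); last by ring.
  rewrite mulr1 => yd.
  apply: (@le_trans _ _ (\int[mu]_x (y^-1 * (bal t y x * phi x)))).
    apply: le_Rintegral => //.
    - exact: L1_pois_Lw.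
    - by apply: L1Z; exact: L1_bal.
    - by move=> x _; rewrite ler_wpM2r ?mulr_ge0 ?bal_ge0//; exact: pois_le_V.
  rewrite RintegralZl//; last exact: L1_bal.
  rewrite mulrC ler_pdivrMr//; exact: small.
move=> Kd.
have K0 : 0 < 2 ^+ K :> R by rewrite exprn_gt0.
have Kd' : 2 ^+ K * y < d.
  by apply: le_lt_trans Kd; rewrite ler_pM2r// exprS ler_peMl ?(ltW K0)// ler1n.
pose c : R := y / (2 ^+ K * y) ^+ 2.
apply: (@le_trans _ _ (\int[mu]_x (pois t y x * (bal t (2 ^+ K * y) x * phi x) +
    c * (bal t (2 ^+ K.+1 * y) x * phi x)))).
  apply: le_Rintegral => //.
  - exact: L1_pois_Lw.
  - by apply: L1D; [exact: L1_pois_Lw|apply: L1Z; exact: L1_bal].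
  - move=> x _.
    have c0 : 0 <= c by rewrite /c divr_ge0 ?sqr_ge0// ltW.
    have [h|h] := ltP `|t - x| (2 ^+ K * y).
      rewrite {2}/bal h mul1r.
      apply: (@le_trans _ _ (pois t y x * phi x)).
        rewrite ler_wpM2l ?pois_ge0// /bal.
        by case: ifP; rewrite ?mul1r ?mul0r//.
      by rewrite lerDl mulr_ge0// mulr_ge0// bal_ge0.
    apply: (@le_trans _ _ (c * (bal t (2 ^+ K.+1 * y) x * phi x))).
      rewrite ler_wpM2r ?mulr_ge0 ?bal_ge0//.
      by apply: pois_le_inv => //; rewrite mulr_gt0.
    rewrite lerDr; apply: mulr_ge0; first exact: pois_ge0.
    by rewrite mulr_ge0// bal_ge0.
rewrite RintegralD//; [|exact: L1_pois_Lw|by apply: L1Z; exact: L1_bal].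
rewrite RintegralZl//; last exact: L1_bal.
apply: (@le_trans _ _ (e * (5 - 4 / 2 ^+ K) + c * (e * (2 ^+ K.+1 * y)))).
  apply: lerD; first exact: IH.
  rewrite ler_wpM2l//; first by rewrite /c divr_ge0 ?sqr_ge0// ltW.
  by apply: small => //; rewrite mulr_gt0// exprn_gt0.
rewrite le_eqVlt; apply/orP; left; apply/eqP.
by rewrite /c (exprS 2 K); move: (2 ^+ K) K0 => p p0; field; rewrite !gt_eqF.
Qed.

(** The form in which Lebesgue points are used: the mean oscillation around [t], measured
    with the Poisson kernel, tends to 0. *)
Definition lebpt u t :=
  \int[mu]_x (pois t y x * `|u x - u t|) @[y --> 0^'+] --> 0.

(** At a Lebesgue point the balls of radius less than [d] are treated by [pois_dyadic];
    outside the largest of them the Poisson kernel is bounded by a multiple of [y * wt]. *)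
Lemma lebesgue_poisson u : Lw u -> {ae mu, forall t, lebpt u t}.
Proof.
move=> lu.
apply: ae_mono (lebesgue_differentiation (Lw_locally_integrable lu)) => t ut.
pose phi x := `|u x - u t|.
have lphi : Lw phi by apply: Lw_norm; apply: LwB => //; exact: Lw_cst.
have phi0 x : 0 <= phi x by exact: normr_ge0.
apply/cvgrPdist_lt => e0 e00.
(* The near part is at most 5 e by [pois_dyadic], the far part less than e. *)
pose e := e0 / 10.
have ep : 0 < e by rewrite divr_gt0.
have [d d0 small] := lebesgue_pt_bal lu ut ep.
pose d' := d / 2.
have d'0 : 0 < d' by rewrite divr_gt0.
(* At distance at least [d' / 2] from [t], [pois t y x <= y * (1 + (d' / 2) ^- 2) / ((t - x) ^ 2 + 1)]. *)
pose C := (1 + (d' / 2) ^- 2) * cmp `|t| 1 * \int[mu]_x (wt x * phi x).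
have C0 : 0 <= C.
  apply: mulr_ge0; last by apply: Rintegral_ge0 => x _; rewrite mulr_ge0// ltW// wt_gt0.
  by rewrite mulr_ge0 ?(ltW (cmp_gt0 _ _))// addr_ge0// invr_ge0 sqr_ge0.
near=> y.
have y0 : 0 < y by [].
have yd : y <= d' by near: y; exact: nbhs_right_le.
have yC : y * C < e.
  apply: (@le_lt_trans _ _ (y * (C + 1))); first by rewrite ler_pM2l// lerDl.
  rewrite -ltr_pdivlMr ?ltr_wpDl//.
  by near: y; apply: nbhs_right_lt; rewrite divr_gt0// ltr_wpDl.
have [K /andP[Kd1 Kd2]] := dyadic_scale y0 yd.
have Kd : 2 ^+ K * y < d by rewrite (le_lt_trans Kd1)// /d' ltr_pdivrMr// ltr_pMr// ltr1n.
have H1 := pois_dyadic lphi phi0 y0 ep small Kd.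
have L := L1_pois_Lw.
have I0 : 0 <= \int[mu]_x (pois t y x * phi x).
  by apply: Rintegral_ge0 => x _; rewrite mulr_ge0// ltW// pois_gt0.
rewrite sub0r normrN ger0_norm//.
have lB : L1 (fun x => pois t y x * (bal t (2 ^+ K * y) x * phi x)).
  apply: (@L1_le _ (fun x => pois t y x * phi x)).
  - apply: measurable_funM; first exact: measurable_pois.
    by apply: measurable_funM; [exact: measurable_bal|case: lphi].
  - move=> x; rewrite ger0_norm; last first.
      by apply: mulr_ge0; [exact: pois_ge0|rewrite mulr_ge0 ?bal_ge0].
    rewrite ler_wpM2l ?pois_ge0// /bal; case: ifP; rewrite ?mul1r ?mul0r//.
  - exact: L.
have lW : L1 (fun x => wt x * phi x) by case: lphi.
pose c := y * ((1 + (d' / 2) ^- 2) * cmp `|t| 1).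
have far x : pois t y x * phi x <=
    pois t y x * (bal t (2 ^+ K * y) x * phi x) + c * (wt x * phi x).
  have c0 : 0 <= c.
    by rewrite mulr_ge0 ?ltW// mulr_gt0 ?cmp_gt0// ltr_pwDl// invr_ge0 sqr_ge0.
  rewrite /bal; case: ltP => h.
    by rewrite mul1r lerDl mulr_ge0// mulr_ge0// ltW// wt_gt0.
  rewrite mul0r mulr0 add0r mulrA ler_wpM2r//.
  have h2 : d' / 2 <= `|t - x|.
    apply: le_trans h; rewrite ler_pdivrMr// mulrC mulrA -exprS; exact: ltW.
  have D0 := @den_gt0 (t - x) 1 ltr01.
  have tx : 0 < `|t - x| by apply: lt_le_trans h2; rewrite divr_gt0.
  have tx2 : (t - x) ^+ 2 = `|t - x| ^+ 2 by rewrite real_normK ?num_real.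
  apply: (@le_trans _ _ (y * ((1 + (d' / 2) ^- 2) * ((t - x) ^+ 2 + 1 ^+ 2)^-1))).
    rewrite /pois ler_pM2l// ler_pdivlMr//.
    apply: (@le_trans _ _ (((t - x) ^+ 2)^-1 * ((t - x) ^+ 2 + 1 ^+ 2))).
      rewrite ler_pM2r// lef_pV2 ?posrE ?den_gt0//; last by rewrite tx2 exprn_gt0.
      by rewrite lerDl sqr_ge0.
    rewrite mulrDr mulVf; last by rewrite tx2 gt_eqF// exprn_gt0.
    rewrite expr1n mulr1 lerD2l tx2 lef_pV2 ?posrE ?exprn_gt0 ?divr_gt0//.
    by rewrite lerXn2r// nnegrE ltW// divr_gt0.
  rewrite /c -!mulrA ler_pM2l// ler_pM2l; last by rewrite ltr_pwDl// invr_ge0 sqr_ge0.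
  exact: denV_le.
apply: (@le_lt_trans _ _ (\int[mu]_x (pois t y x * (bal t (2 ^+ K * y) x * phi x) +
    c * (wt x * phi x)))).
  apply: le_Rintegral => //; first exact: L.
  by apply: L1D => //; exact: L1Z.
rewrite RintegralD//; last exact: L1Z.
rewrite RintegralZl//.
have -> : c * (\int[mu]_x (wt x * phi x)) = y * C by rewrite /c /C; ring.
have K0 : 0 <= 4 / 2 ^+ K :> R by rewrite divr_ge0// exprn_ge0.
have H2 : e * (5 - 4 / 2 ^+ K) <= e * 5 by rewrite ler_pM2l// gerBl.
have E : e0 = e * 10 by rewrite /e mulfVK.
by rewrite E; lra.
Unshelve. all: end_near. Qed.

Lemma poisson_cvg u t : Lw u -> lebpt u t ->
  pi^-1 * (\int[mu]_x (pois t y x * u x)) @[y --> 0^'+] --> u t.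
Proof.
move=> lu ut.
have H : pi^-1 * \int[mu]_x (pois t y x * `|u x - u t|) @[y --> 0^'+] --> pi^-1 * 0.
  by apply: cvgMl_tmp; exact: ut.
rewrite mulr0 in H.
apply/cvgrPdist_lt => e e0.
move/cvgrPdist_lt : H => /(_ e e0) H.
near=> y.
have y0 : 0 < y by [].
have pi0 := pi_gt0 R.
apply: le_lt_trans (_ : pi^-1 * \int[mu]_x (pois t y x * `|u x - u t|) < e); last first.
  have : `|0 - pi^-1 * \int[mu]_x (pois t y x * `|u x - u t|)| < e by near: y.
  by rewrite sub0r normrN => /(le_lt_trans (ler_norm _)).
have ld : Lw (fun x => u x - u t) by apply: LwB => //; exact: Lw_cst.
have -> : u t - pi^-1 * (\int[mu]_x (pois t y x * u x)) =
    - (pi^-1 * \int[mu]_x (pois t y x * (u x - u t))).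
  under [in RHS]eq_Rintegral do rewrite mulrBr.
  rewrite RintegralB//; [|exact: L1_pois_Lw|exact: (L1_pois_Lw _ (Lw_cst _))].
  rewrite RintegralZr//; last exact: L1_pois.
  rewrite int_pois// mulrBr mulrA mulVf ?gt_eqF// mul1r opprB.
  by [].
rewrite normrN normrM gtr0_norm ?invr_gt0// ler_pM2l ?invr_gt0//.
apply: le_trans (le_normr_Rintegral _ _) _ => //; first exact: L1_pois_Lw.
rewrite le_eqVlt; apply/orP; left; apply/eqP; apply: eq_Rintegral => x _.
by rewrite normrM gtr0_norm// pois_gt0.
Unshelve. all: end_near. Qed.

(** * Truncated Hilbert integrals and conjugate Poisson integrals *)

Definition far t (e : R) x : R := if e < `|x - t| then 1 else 0.

Definition tker t (e : R) x : R := far t e x * ((t - x)^-1 + x * wt x).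

Definition qker t y x : R := (t - x) / ((t - x) ^+ 2 + y ^+ 2) + x * wt x.

Definition conjp u y t : R := \int[mu]_x (qker t y x * u x).

Definition truncp u (e : R) t : R := \int[mu]_x (tker t e x * u x).

Lemma truncpE u (e : R) t :
  \int[mu]_(x in [set x : R | e < `|x - t|]) (((t - x)^-1 + x / (1 + x ^+ 2)) * u x)
  = truncp u e t.
Proof.
rewrite Rintegral_mkcond; apply: eq_Rintegral => x _.
rewrite patchE /tker /far; case: ifPn => [/set_mem/= ->|].
  by rewrite mul1r.
by rewrite notin_setE/= => /negP/negbTE ->; rewrite !mul0r.
Qed.

(** The inverse is the limit of [x / (x ^ 2 + 1 / n)], also at 0, where it is 0. *)
Lemma measurable_invr : measurable_fun setT (fun x : R => x^-1).
Proof.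
pose g (n : nat) (x : R) : R := x / (x ^+ 2 + n.+1%:R^-1).
apply: (measurable_fun_cvg (h := g)) => [n|x _]; rewrite /g.
  have n0 (x : R) : x ^+ 2 + n.+1%:R^-1 != 0.
    by rewrite gt_eqF// ltr_wpDl ?sqr_ge0// invr_gt0.
  apply: continuous_measurable_fun => x; apply: cvgM; first exact: cvg_id.
  apply: cvgV => //; apply: cvgD; last exact: cvg_cst.
  exact: exprn_continuous.
have [->|x0] := eqVneq x 0.
  by rewrite invr0; under eq_fun do rewrite mul0r; exact: cvg_cst.
rewrite (_ : x^-1 = x / (x ^+ 2 + 0)); last by rewrite addr0; field.
apply: cvgMl_tmp; apply: cvgV; first by rewrite addr0 expf_neq0.
by apply: cvgD; [exact: cvg_cst|exact: cvg_harmonic].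
Qed.

Lemma measurable_far_comp d (T : measurableType d) (a b : T -> R) (e : R) :
  measurable_fun setT a -> measurable_fun setT b ->
  measurable_fun setT (fun z => far (a z) e (b z)).
Proof.
move=> ma mb; apply: measurable_fun_ifT => //.
apply: measurable_fun_ltr => //.
by apply: measurableT_comp => //; exact: measurable_funB.
Qed.

Lemma measurable_tker_comp d (T : measurableType d) (a b : T -> R) (e : R) :
  measurable_fun setT a -> measurable_fun setT b ->
  measurable_fun setT (fun z => tker (a z) e (b z)).
Proof.
move=> ma mb; apply: measurable_funM; first exact: measurable_far_comp.
apply: measurable_funD.
  by apply: (measurableT_comp measurable_invr); exact: measurable_funB.
by apply: measurable_funM => //; apply: (measurableT_comp measurable_wt).
Qed.

Lemma measurable_far t (e : R) : measurable_fun setT (far t e).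
Proof. by apply: (@measurable_far_comp _ _ (cst t) id). Qed.

Lemma measurable_tker t (e : R) : measurable_fun setT (tker t e).
Proof. by apply: (@measurable_tker_comp _ _ (cst t) id). Qed.

Lemma den_neq0 t y x : 0 < y -> (t - x) ^+ 2 + y ^+ 2 != 0.
Proof. by move=> y0; rewrite gt_eqF// den_gt0. Qed.

Lemma measurable_qker t y : 0 < y -> measurable_fun setT (qker t y).
Proof.
move=> y0; rewrite (_ : qker t y = fun x => (t - x) * (y^-1 * pois t y x) + x * wt x).
  apply: measurable_funD; apply: measurable_funM => //.
  - exact: measurable_funB.
  - by apply: measurable_funM => //; exact: measurable_pois.
  - exact: measurable_wt.
apply/funext => x; rewrite /qker /pois mulrA; congr (_ + _).
by field; rewrite den_neq0// gt_eqF.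
Qed.

Lemma tker_le t (e : R) x : 0 < e ->
  `|tker t e x| <= ((1 + t ^+ 2) / e + `|t|) * wt x.
Proof.
move=> e0; rewrite /tker /far; case: ltP => h; last first.
  rewrite mul0r normr0 mulr_ge0 ?wt_ge0// addr_ge0// divr_ge0 ?addr_ge0 ?sqr_ge0//.
  exact: ltW.
rewrite mul1r.
have xt : 0 < `|t - x| by rewrite distrC (lt_trans e0).
have xt0 : t - x != 0 by rewrite -normr_gt0.
have w0 := oneDsq_gt0 x.
have -> : (t - x)^-1 + x * wt x = (1 + x * t) * (t - x)^-1 * wt x.
  by rewrite /wt; field; rewrite xt0 gt_eqF.
rewrite normrM (ger0_norm (wt_ge0 _)) ler_wpM2r ?wt_ge0//.
rewrite normrM normrV ?unitfE// ler_pdivrMr//.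
have h1 : `|1 + x * t| <= 1 + t ^+ 2 + `|t| * `|t - x|.
  rewrite (_ : 1 + x * t = 1 + t ^+ 2 - t * (t - x)); last by ring.
  rewrite (le_trans (ler_normB _ _))// normrM lerD2r ger0_norm// addr_ge0// sqr_ge0//.
apply: (le_trans h1); rewrite mulrDl lerD2r.
rewrite -mulrA ler_peMr//; first by rewrite addr_ge0// sqr_ge0.
by rewrite mulrC ler_pdivlMr// mul1r distrC ltW.
Qed.

Lemma qker_le t y x : 0 < y ->
  `|qker t y x| <= ((1 + t ^+ 2) / y + 2 * `|t| + y) * wt x.
Proof.
move=> y0; have w0 := oneDsq_gt0 x; have d0 := den_gt0 (t - x) y0.
pose r := t - x.
have -> : qker t y x = (r * (1 + x * t) + x * y ^+ 2) / (r ^+ 2 + y ^+ 2) * wt x.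
  by rewrite /qker /wt /r; field; rewrite !gt_eqF.
rewrite normrM (ger0_norm (wt_ge0 _)) ler_wpM2r ?wt_ge0//.
rewrite normrM normrV ?unitfE ?gt_eqF// (gtr0_norm d0) ler_pdivrMr//.
have E : r * (1 + x * t) + x * y ^+ 2 =
    r * (1 + t ^+ 2) - t * r ^+ 2 + t * y ^+ 2 - r * y ^+ 2.
  by rewrite /r; ring.
rewrite E.
have r2 : r ^+ 2 = `|r| ^+ 2 by rewrite real_normK ?num_real.
apply: (@le_trans _ _ (`|r| * (1 + t ^+ 2) + `|t| * r ^+ 2 + `|t| * y ^+ 2 + `|r| * y ^+ 2)).
  apply: (le_trans (ler_normB _ _)); rewrite normrM (ger0_norm (sqr_ge0 y)) lerD2r.
  apply: (le_trans (ler_normD _ _)); rewrite [X in _ + X]normrM (ger0_norm (sqr_ge0 y)) lerD2r.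
  apply: (le_trans (ler_normB _ _)).
  rewrite [X in _ + X]normrM (ger0_norm (sqr_ge0 r)) lerD2r.
  by rewrite normrM (@ger0_norm _ (1 + _))// addr_ge0// sqr_ge0.
have ry : `|r| * y <= r ^+ 2 + y ^+ 2.
  have := sqr_ge0 (`|r| - y); have := sqr_ge0 (`|r|); have := sqr_ge0 y; rewrite r2; nra.
have H1 : `|r| * (1 + t ^+ 2) <= (1 + t ^+ 2) / y * (r ^+ 2 + y ^+ 2).
  rewrite mulrC -mulrA ler_wpM2l ?addr_ge0 ?sqr_ge0//.
  by rewrite mulrC ler_pdivlMr.
have H2 : `|r| * y ^+ 2 <= y * (r ^+ 2 + y ^+ 2).
  by rewrite expr2 mulrA mulrC ler_wpM2l// ltW.
have H3 : 0 <= `|t| by [].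
have H4 := sqr_ge0 r; have H5 := sqr_ge0 y.
rewrite [leRHS]mulrDl [X in _ <= X + _]mulrDl -/r; nra.
Qed.

Lemma L1_tker t (e : R) u : 0 < e -> Lw u -> L1 (fun x => tker t e x * u x).
Proof.
by move=> e0 lu; apply: L1_Lw lu _ _; [exact: measurable_tker|move=> x; exact: tker_le].
Qed.

Lemma L1_qker t y u : 0 < y -> Lw u -> L1 (fun x => qker t y x * u x).
Proof.
by move=> e0 lu; apply: L1_Lw lu _ _; [exact: measurable_qker|move=> x; exact: qker_le].
Qed.

(** The difference between the conjugate Poisson kernel and the Hilbert kernel truncated at
    the same scale, without the compensating terms, which are not odd about [t]. *)
Definition oker t y x : R := (t - x) / ((t - x) ^+ 2 + y ^+ 2) - far t y x * (t - x)^-1.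

Lemma oker_le t y x : 0 < y -> `|oker t y x| <= pois t y x.
Proof.
move=> y0; rewrite /oker /pois /far; case: ltP => h; last first.
  rewrite mul0r subr0 normrM normrV ?unitfE ?den_neq0// (gtr0_norm (den_gt0 _ y0)).
  by rewrite ler_pM2r ?invr_gt0 ?den_gt0// distrC.
rewrite distrC in h; rewrite mul1r.
have xt : 0 < `|t - x| by rewrite (lt_trans y0).
have xt0 : t - x != 0 by rewrite -normr_gt0.
have -> : (t - x) / ((t - x) ^+ 2 + y ^+ 2) - (t - x)^-1 =
    - (y ^+ 2 / (t - x)) / ((t - x) ^+ 2 + y ^+ 2).
  by field; rewrite xt0 den_neq0.
rewrite normrM normrN normrV ?unitfE ?den_neq0// (gtr0_norm (den_gt0 _ y0)).
rewrite ler_pM2r ?invr_gt0 ?den_gt0// normrM normrV ?unitfE//.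
rewrite ler_pdivrMr// (ger0_norm (sqr_ge0 y)) expr2 ler_pM2l//; exact: ltW.
Qed.

Lemma measurable_oker t y : 0 < y -> measurable_fun setT (oker t y).
Proof.
move=> y0.
rewrite (_ : oker t y = fun x => qker t y x - tker t y x - (1 - far t y x) * (x * wt x)).
  apply: measurable_funB; first by apply: measurable_funB; [exact: measurable_qker|exact: measurable_tker].
  apply: measurable_funM; first by apply: measurable_funB => //; exact: measurable_far.
  by apply: measurable_funM => //; exact: measurable_wt.
by apply/funext => x; rewrite /oker /qker /tker; ring.
Qed.

(** The kernel is odd about [t]. *)
Lemma int_oker t y : 0 < y -> \int[mu]_x oker t y x = 0.
Proof.
move=> y0.
have l1 : L1 (oker t y).
  apply: (@L1_le _ (pois t y)); [exact: measurable_oker|by move=> x; exact: oker_le|exact: L1_pois].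
have := integral_reflect (t + t) l1.
rewrite (_ : (fun x => oker t y (t + t - x)) = fun x => (-1) * oker t y x).
  by rewrite RintegralZl//; lra.
apply/funext => x; rewrite /oker /far.
have -> : t - (t + t - x) = - (t - x) by ring.
have -> : (t + t - x) - t = t - x by ring.
by rewrite sqrrN invrN (distrC x t); case: ifP => _; ring.
Qed.

Lemma near_far_le t y x : 0 < y -> `|(1 - far t y x) * (x * wt x)| <= 2 * y * pois t y x.
Proof.
move=> y0; have p0 := pois_ge0 t x y0.
rewrite /far; case: ltP => h; first by rewrite subrr mul0r normr0; apply: mulr_ge0 => //; rewrite mulr_ge0// ltW.
rewrite subr0 mul1r.
have h1 : `|x * wt x| <= 1.
  rewrite normrM (ger0_norm (wt_ge0 _)) /wt ler_pdivrMr ?oneDsq_gt0// mul1r.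
  rewrite -[x ^+ 2]real_normK ?num_real//.
  have := sqr_ge0 (`|x| - 1); have := sqr_ge0 (`|x|); nra.
apply: (le_trans h1); rewrite /pois mulrA ler_pdivlMr ?den_gt0// mul1r.
have : (t - x) ^+ 2 <= y ^+ 2.
  by rewrite -[(t - x) ^+ 2]real_normK ?num_real// lerXn2r ?nnegrE ?(ltW y0)// distrC.
nra.
Qed.

(** The kernel [oker] has integral 0, so [u x] can be replaced by [u x - u t]; and it is
    dominated by the Poisson kernel, against which [|u x - u t|] is small. *)
Lemma conjp_truncp u t : Lw u -> lebpt u t ->
  conjp u y t - truncp u y t @[y --> 0^'+] --> 0.
Proof.
move=> lu ut.
pose E y := \int[mu]_x (pois t y x * `|u x - u t|).
have bd y : 0 < y -> `|conjp u y t - truncp u y t| <=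
    (1 + 2 * y) * E y + 2 * y * (pi * `|u t|).
  move=> y0.
  have ld : Lw (fun x => u x - u t) by apply: LwB => //; exact: Lw_cst.
  have lo : L1 (fun x => oker t y x * (u x - u t)).
    apply: (@L1_le _ (fun x => pois t y x * `|u x - u t|)).
    - by apply: measurable_funM; [exact: measurable_oker|case: ld].
    - by move=> x; rewrite normrM ler_wpM2r//; exact: oker_le.
    - by apply: L1_pois_Lw => //; exact: Lw_norm.
  have lof : L1 (oker t y).
    by apply: (@L1_le _ (pois t y)); [exact: measurable_oker|move=> x; exact: oker_le|exact: L1_pois].
  have lp : L1 (fun x => pois t y x * `|u x|) by apply: L1_pois_Lw => //; exact: Lw_norm.
  have lpd : L1 (fun x => pois t y x * `|u x - u t|) by apply: L1_pois_Lw => //; exact: Lw_norm.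
  have ln : L1 (fun x => ((1 - far t y x) * (x * wt x)) * u x).
    apply: (@L1_le _ (fun x => 2 * y * (pois t y x * `|u x|))).
    - apply: measurable_funM; last by case: lu.
      apply: measurable_funM; first by apply: measurable_funB => //; exact: measurable_far.
      by apply: measurable_funM => //; exact: measurable_wt.
    - by move=> x; rewrite normrM [leRHS]mulrA ler_wpM2r//; exact: near_far_le.
    - exact: L1Z.
  have -> : conjp u y t - truncp u y t =
      \int[mu]_x (oker t y x * (u x - u t)) +
      \int[mu]_x (((1 - far t y x) * (x * wt x)) * u x).
    rewrite /conjp /truncp -RintegralB//; [|exact: L1_qker|exact: L1_tker].
    have -> : \int[mu]_x (oker t y x * (u x - u t)) = \int[mu]_x (oker t y x * u x).
      under eq_Rintegral do rewrite mulrBr.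
      rewrite RintegralB//.
      - by rewrite RintegralZr// int_oker// mul0r subr0.
      - rewrite (_ : (fun x => _) = (fun x => oker t y x * (u x - u t) + u t * oker t y x)).
          by apply: L1D => //; exact: L1Z.
        by apply/funext => x; ring.
      - rewrite (_ : (fun x => _) = (fun x => u t * oker t y x)); first exact: L1Z.
        by apply/funext => x; rewrite mulrC.
    rewrite -RintegralD//.
      by apply: eq_Rintegral => x _; rewrite /qker /tker /oker; ring.
    rewrite (_ : (fun x => _) = (fun x => oker t y x * (u x - u t) + u t * oker t y x)).
      by apply: L1D => //; exact: L1Z.
    by apply/funext => x; ring.
  have H1 : `|\int[mu]_x (oker t y x * (u x - u t))| <= E y.
    apply: le_trans (le_normr_Rintegral _ _) _ => //; apply: le_Rintegral => //.
      exact: L1_norm.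
    by move=> x _; rewrite normrM ler_wpM2r//; exact: oker_le.
  have H2 : `|\int[mu]_x (((1 - far t y x) * (x * wt x)) * u x)| <=
      2 * y * \int[mu]_x (pois t y x * `|u x|).
    rewrite -RintegralZl//.
    apply: le_trans (le_normr_Rintegral _ _) _ => //; apply: le_Rintegral => //.
    - exact: L1_norm.
    - exact: L1Z.
    - by move=> x _; rewrite normrM [leRHS]mulrA ler_wpM2r//; exact: near_far_le.
  have H3 : \int[mu]_x (pois t y x * `|u x|) <= E y + pi * `|u t|.
    rewrite -(int_pois t y0) -RintegralZr//; last exact: L1_pois.
    have lc : L1 (fun x => pois t y x * `|u t|) by exact: (L1_pois_Lw _ (Lw_cst _)).
    rewrite -RintegralD//; apply: le_Rintegral => //; first exact: L1D.
    move=> x _; rewrite -mulrDr; apply: ler_wpM2l; first exact: pois_ge0.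
    by rewrite -{1}(subrK (u t) (u x)) ler_normD.
  apply: (le_trans (ler_normD _ _)).
  have : 2 * y * \int[mu]_x (pois t y x * `|u x|) <= 2 * y * (E y + pi * `|u t|).
    by rewrite ler_wpM2l// mulr_ge0// ltW.
  move: H1 H2; lra.
have cv : (1 + 2 * y) * E y + 2 * y * (pi * `|u t|) @[y --> (0 : R)^'+] --> (0 : R).
  have y1 : y @[y --> (0:R)^'+] --> (0 : R) by apply: cvg_at_right_filter; exact: cvg_id.
  have y2 : 2 * y @[y --> (0:R)^'+] --> (2 * 0 : R) by apply: cvgMl_tmp.
  have c1 : 1 + 2 * y @[y --> (0:R)^'+] --> (1 + 2 * 0 : R) by apply: cvgD => //; exact: cvg_cst.
  rewrite [X in _ --> X](_ : _ = (1 + 2 * 0) * 0 + 2 * 0 * (pi * `|u t|)); last by rewrite !mulr0 mul0r addr0.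
  by apply: cvgD; [apply: cvgM|apply: cvgMr_tmp].
apply/cvgrPdist_lt => e e0.
move/cvgrPdist_lt : cv => /(_ e e0) cv.
near=> y.
rewrite sub0r normrN; apply: le_lt_trans (bd y _) _ => //.
have : `|0 - ((1 + 2 * y) * E y + 2 * y * (pi * `|u t|))| < e by near: y.
by rewrite sub0r normrN => /(le_lt_trans (ler_norm _)).
Unshelve. all: end_near. Qed.

End integrals.

(** * Holomorphic functions of [t + i y] on horizontal strips *)
Section holomorphic.
Variable R : realType.
Local Notation mu := (@lebesgue_measure R).
Local Notation C := R[i].
Local Notation Re := (@complex.Re R).
Local Notation Im := (@complex.Im R).
Implicit Types (z w c : C) (W V : R -> R -> C).

(** The real-valued modulus, whereas the norm of the complex field takes complex values. *)
Definition cn z : R := Normc.normc z.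

Lemma cnE z : cn z = Num.sqrt (Re z ^+ 2 + Im z ^+ 2).
Proof. by case: z. Qed.

Lemma sqr_cn z : cn z ^+ 2 = Re z ^+ 2 + Im z ^+ 2.
Proof. by rewrite cnE sqr_sqrtr// addr_ge0// sqr_ge0. Qed.

Lemma cn_ge0 z : 0 <= cn z. Proof. by rewrite cnE sqrtr_ge0. Qed.

Lemma cnM z w : cn (z * w) = cn z * cn w. Proof. exact: Normc.normcM. Qed.

Lemma cnD z w : cn (z + w) <= cn z + cn w. Proof. exact: (le_normcD z w). Qed.

Lemma cnN z : cn (- z) = cn z. Proof. exact: (normcN z). Qed.

Lemma cnB z w : cn (z - w) <= cn z + cn w.
Proof. by rewrite -(cnN w) cnD. Qed.

Lemma cnV z : cn z^-1 = (cn z)^-1. Proof. exact: Normc.normcV. Qed.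

Lemma cnX z n : cn (z ^+ n) = cn z ^+ n.
Proof. by elim: n => [|n IH]; rewrite ?expr0 ?exprS ?cnM ?IH//; exact: Normc.normc1. Qed.

Lemma cn0_eq0 z : cn z = 0 -> z = 0. Proof. exact: Normc.eq0_normc. Qed.

Lemma cn_gt0 z : z != 0 -> 0 < cn z.
Proof. by move=> z0; rewrite lt_neqAle cn_ge0 andbT eq_sym; apply: contra z0 => /eqP/cn0_eq0 ->. Qed.

Lemma Re_le z : `|Re z| <= cn z.
Proof.
by rewrite cnE -sqrtr_sqr ler_wsqrtr// lerDl sqr_ge0.
Qed.

Lemma Im_le z : `|Im z| <= cn z.
Proof. by rewrite cnE -sqrtr_sqr ler_wsqrtr// lerDr sqr_ge0. Qed.

Lemma cn_le_ReIm z : cn z <= `|Re z| + `|Im z|.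
Proof.
have h : 0 <= `|Re z| + `|Im z| by rewrite addr_ge0.
rewrite -(ler_pXn2r (n := 2)) ?nnegrE ?cn_ge0// sqr_cn sqrrD !real_normK ?num_real//.
have : 0 <= `|Re z| * `|Im z| by rewrite mulr_ge0.
by rewrite -mulr_natr; lra.
Qed.

Lemma cReM z w : Re (z * w) = Re z * Re w - Im z * Im w.
Proof. by case: z; case: w. Qed.
Lemma cImM z w : Im (z * w) = Re z * Im w + Im z * Re w.
Proof. by case: z; case: w. Qed.
Lemma cReD z w : Re (z + w) = Re z + Re w. Proof. by case: z; case: w. Qed.
Lemma cImD z w : Im (z + w) = Im z + Im w. Proof. by case: z; case: w. Qed.
Lemma cReN z : Re (- z) = - Re z. Proof. by case: z. Qed.
Lemma cImN z : Im (- z) = - Im z. Proof. by case: z. Qed.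
Lemma ceqP z w : Re z = Re w -> Im z = Im w -> z = w.
Proof. by case: z; case: w => /= ? ? ? ? -> ->. Qed.

Definition ci : C := Complex 0 1.

Lemma Re_ci z : Re (ci * z) = - Im z. Proof. by rewrite cReM/= mul0r mul1r sub0r. Qed.
Lemma Im_ci z : Im (ci * z) = Re z. Proof. by rewrite cImM/= mul0r mul1r add0r. Qed.
Lemma cn_ci : cn ci = 1. Proof. by rewrite cnE/= expr0n add0r expr1n sqrtr1. Qed.

(** Derivatives and continuity are componentwise, so that only real analysis is needed. *)
Definition cderiv (g : R -> C) (x : R) (c : C) : Prop :=
  is_derive x (1 : R) (fun s => Re (g s)) (Re c) /\
  is_derive x (1 : R) (fun s => Im (g s)) (Im c).

Definition ccont (g : R -> C) : Prop :=
  continuous (fun s => Re (g s)) /\ continuous (fun s => Im (g s)).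

Definition cbounded_on (a b : R) W := forall N y1 y2, a < y1 -> y2 < b ->
  exists K, forall t y, `|t| <= N -> y1 <= y <= y2 -> cn (W t y) <= K.

(** Holomorphy of [t + i y |-> W t y] in the strip [a < y < b], with derivative [W'].
    The Cauchy-Riemann equations say that the vertical derivative is [i] times the
    horizontal one. The bounds on compact sets are what differentiation under the integral
    sign asks for. *)
Record holo (a b : R) W W' : Prop := Holo {
  holo_x : forall t y, a < y < b -> cderiv (W ^~ y) t (W' t y);
  holo_y : forall t y, a < y < b -> cderiv (W t) y (ci * W' t y);
  holo_cont : forall y, a < y < b -> ccont (W' ^~ y);
  holo_bd : cbounded_on a b W;
  holo_bd' : cbounded_on a b W' }.

Lemma is_derive_cont (f : R -> R) x d : is_derive x (1 : R) f d -> {for x, continuous f}.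
Proof.
by move=> H; apply: differentiable_continuous; apply/derivable1_diffP; apply: ex_derive.
Qed.

Lemma is_derive_derivable (f : R -> R) x d : is_derive x (1 : R) f d -> derivable f x 1.
Proof. by move=> H; exact: ex_derive. Qed.

Lemma holo_ccont a b W W' y : holo a b W W' -> a < y < b -> ccont (W ^~ y).
Proof.
move=> h yab; split => t; have [h1 h2] := holo_x h t yab.
- exact: (is_derive_cont h1).
- exact: (is_derive_cont h2).
Qed.

Lemma ccont_meas (g : R -> C) : ccont g ->
  measurable_fun setT (fun s => Re (g s)) /\ measurable_fun setT (fun s => Im (g s)).
Proof. by move=> [h1 h2]; split; exact: continuous_measurable_fun. Qed.

(** The height derivative of the integral over [[-N, N]] is the integral of the horizontal
    derivative of [- Im W], a boundary term; the mean value theorem then plays the role of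
    the integral over the vertical sides. *)
Lemma cauchy_rectangle a b W W' (N s1 s2 : R) : holo a b W W' -> 0 < N ->
  a < s1 -> s1 < s2 -> s2 < b ->
  exists2 c, s1 < c < s2 &
  \int[mu]_(x in `[- N, N]) Re (W x s2) - \int[mu]_(x in `[- N, N]) Re (W x s1) =
  (Im (W (- N) c) - Im (W N c)) * (s2 - s1).
Proof.
move=> h N0 as1 s12 s2b.
pose F s := \int[mu]_(x in `[- N, N]) Re (W x s).
pose u := (a + s1) / 2; pose v := (s2 + b) / 2.
have NN : - N < N by lra.
have [K HK] := holo_bd' h N (y1 := u) (y2 := v) ltac:(rewrite /u; lra) ltac:(rewrite /v; lra).
have K0 : 0 <= `|K| by [].
have intc (r : R) : mu.-integrable `[- N, N] (EFin \o cst r).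
  apply: measurable_bounded_integrable => //.
    by rewrite /= lebesgue_measure_itv/= lte_fin NN -EFinB ltry.
  by exists `|r|; split => // M rM x _ /=; rewrite ltW.
have dF s : s1 <= s <= s2 -> is_derive s (1 : R) F (Im (W (- N) s) - Im (W N s)).
  move=> /andP[s1s ss2].
  have sI : `]u, v[%classic s by rewrite /= in_itv/= /u /v; apply/andP; split; lra.
  have sab : a < s < b by apply/andP; split; lra.
  pose f (s : R) (x : R) := Re (W x s).
  have If x : x \in `]u, v[ -> a < x < b.
    by rewrite in_itv/= /u /v => /andP[? ?]; apply/andP; split; lra.
  have Iuv x : x \in `]u, v[ -> u <= x <= v.
    by rewrite in_itv/= /u /v => /andP[? ?]; apply/andP; split; lra.
  have intf x : `]u, v[%classic x -> mu.-integrable `[- N, N] (EFin \o f x).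
    move=> /If xab; apply: continuous_compact_integrable; first exact: segment_compact.
    by apply: continuous_subspaceT; exact: (holo_ccont h xab).1.
  have df x y : `]u, v[%classic x -> is_derive x (1 : R) (f ^~ y) (- Im (W' y x)).
    by move=> /If xab; rewrite -Re_ci; exact: (holo_y h y xab).1.
  have derf x y : `]u, v[%classic x -> `[- N, N]%classic y -> derivable (f ^~ y) x 1.
    by move=> xI _; exact: is_derive_derivable (df x y xI).
  have d1f x y : `]u, v[%classic x -> partial1of2 f x y = - Im (W' y x).
    by move=> xI; rewrite partial1of2E; have := df x y xI => ?; rewrite derive_val.
  have Gub x y : `]u, v[%classic x -> `[- N, N]%classic y -> `|partial1of2 f x y| <= `|K|.
    move=> xI; rewrite /= in_itv/= => yN; rewrite d1f// normrN.
    apply: (le_trans (Im_le _)); apply: le_trans (ler_norm _).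
    by apply: HK; [rewrite ler_norml|exact: Iuv].
  have D := @derivable_under_integral R _ _ mu f `[- N, N] (measurable_itv _) s u v sI intf derf
     (cst `|K|) (fun=> K0) (intc _) Gub.
  have E := @differentiation_under_integral R _ _ mu f `[- N, N] (measurable_itv _) s u v sI intf derf
     (cst `|K|) (fun=> K0) (intc _) Gub.
  apply: DeriveDef; first exact: D.
  rewrite -derive1E E.
  have ftc : (\int[mu]_(x in `[(- N)%R, N]) (Im (W' x s))%:E = (Im (W N s))%:E - (Im (W (- N) s))%:E)%E.
    apply: (@continuous_FTC2 R (fun x => Im (W' x s)) (fun x => Im (W x s))) => //.
    - by apply: continuous_subspaceT; exact: (holo_cont h sab).2.
    - have dI x : is_derive x (1 : R) (fun x => Im (W x s)) (Im (W' x s)).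
        exact: (holo_x h x sab).2.
      split.
      + by move=> x _; exact: is_derive_derivable (dI x).
      + by apply: cvg_at_right_filter; exact: (is_derive_cont (dI _)).
      + by apply: cvg_at_left_filter; exact: (is_derive_cont (dI _)).
    - move=> x _; rewrite derive1E; have := (holo_x h x sab).2 => ?; by rewrite derive_val.
  rewrite (_ : \int[mu]_(y in _) _ = \int[mu]_(y in `[- N, N]) (-1 * Im (W' y s))).
    rewrite RintegralZl//.
      by rewrite /Rintegral ftc/=; lra.
    apply: continuous_compact_integrable; first exact: segment_compact.
    by apply: continuous_subspaceT; exact: (holo_cont h sab).2.
  by apply: eq_Rintegral => y _; rewrite d1f// mulN1r.
have [c cI E] := @MVT R F (fun s => Im (W (- N) s) - Im (W N s)) s1 s2 s12
  (fun x (xI : x \in `]s1, s2[) => dF x (ltac:(move: xI; rewrite in_itv/= => /andP[? ?]; apply/andP; split; lra)))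
  ltac:(apply: derivable_within_continuous => x xI; exact: is_derive_derivable (dF x ltac:(by move: xI; rewrite in_itv/=))).
by exists c => //; move: cI; rewrite in_itv.
Qed.

(** The decay of [W] makes the vertical sides of the rectangle negligible. *)
Lemma cauchy_line a b W W' (K s1 s2 : R) : holo a b W W' ->
  (forall x y, a < y < b -> cn (W x y) <= K * wt x) ->
  a < s1 -> s1 < s2 -> s2 < b ->
  \int[mu]_x Re (W x s1) = \int[mu]_x Re (W x s2).
Proof.
move=> h bd as1 s12 s2b.
pose g s n := \int[mu]_(x in `[- n.+1%:R, n.+1%:R]) Re (W x s).
have lim s : a < s < b -> g s n @[n --> \oo] --> \int[mu]_x Re (W x s).
  move=> sab.
  pose gn n x := Re (W x s) * \1_`[- n.+1%:R, n.+1%:R]%classic x.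
  have mW : measurable_fun setT (fun x => Re (W x s)).
    by have [] := ccont_meas (holo_ccont h sab).
  have -> : g s = fun n => \int[mu]_x gn n x.
    apply/funext => n; rewrite /g Rintegral_mkcond; apply: eq_Rintegral => x _.
    rewrite patchE /gn indicE.
    by case: ifPn => _; rewrite ?mulr1 ?mulr0.
  have [] := @dominated_cvgR R gn (fun x => Re (W x s)) (fun x => K * wt x) _ mW.
  - move=> n; apply: measurable_funM => //; apply: measurable_indic; exact: measurable_itv.
  - apply: aeW => x; apply: cvg_near_cst.
    near=> n; rewrite /gn indicE mem_set ?mulr1//= in_itv/= -ler_norml.
    apply: (@le_trans _ _ n%:R); last by rewrite ler_nat.
    near: n; exact: nbhs_infty_ger.
  - by apply: L1Z; exact: L1_wt.
  - apply: aeW => x n; rewrite /gn normrM.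
    apply: (@le_trans _ _ (cn (W x s))); last exact: bd.
    rewrite (le_trans _ (Re_le _))// ler_piMr// indicE.
    by case: (x \in _); rewrite ?normr1 ?normr0.
  by [].
have K0 : 0 <= K.
  have := bd 0 s1 ltac:(lra); have := cn_ge0 (W 0 s1) => /le_trans/[apply].
  by rewrite pmulr_lge0 ?wt_gt0.
have d0 : g s2 n - g s1 n @[n --> \oo] --> 0.
  apply: (@squeeze_cvgr _ _ _ _ (fun n => - (2 * K * (s2 - s1) * n.+1%:R^-1))
    (fun n => 2 * K * (s2 - s1) * n.+1%:R^-1)).
  - apply: nearW => n; rewrite -ler_norml.
    have N0 : 0 < n.+1%:R :> R by [].
    have [c /andP[c1 c2] ->] := cauchy_rectangle h N0 as1 s12 s2b.
    rewrite normrM (@gtr0_norm _ (s2 - s1)) ?subr_gt0//.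
    rewrite mulrAC ler_pM2r ?subr_gt0//.
    have w x : x ^+ 2 = n.+1%:R ^+ 2 -> wt x <= n.+1%:R^-1.
      move=> E; rewrite /wt lef_pV2 ?posrE ?oneDsq_gt0// E.
      have : (1 : R) <= n.+1%:R by rewrite ler1n.
      nra.
    apply: (le_trans (ler_normB _ _)).
    have h1 : cn (W (- n.+1%:R) c) <= K * n.+1%:R^-1.
      apply: (le_trans (bd _ _ _)); first by lra.
      by rewrite ler_wpM2l// w// sqrrN.
    have h2 : cn (W n.+1%:R c) <= K * n.+1%:R^-1.
      apply: (le_trans (bd _ _ _)); first by lra.
      by rewrite ler_wpM2l// w.
    rewrite -mulrA mulr_natl mulr2n; apply: lerD.
      exact: le_trans (Im_le _) h1.
    exact: le_trans (Im_le _) h2.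
  - rewrite -oppr0 -(mulr0 (2 * K * (s2 - s1))); apply: cvgN; apply: cvgMl_tmp.
    exact: cvg_harmonic.
  - rewrite -(mulr0 (2 * K * (s2 - s1))); apply: cvgMl_tmp; exact: cvg_harmonic.
have l1 := lim s1 ltac:(lra); have l2 := lim s2 ltac:(lra).
have l3 : g s2 n - g s1 n @[n --> \oo] --> \int[mu]_x Re (W x s2) - \int[mu]_x Re (W x s1).
  exact: cvgB.
apply/esym/eqP; rewrite -subr_eq0; apply/eqP.
have := cvg_unique _ l3 d0; exact.
Unshelve. all: end_near. Qed.

(** ** Closure properties *)

Lemma holo_cst a b (c : C) : holo a b (fun _ _ => c) (fun _ _ => 0).
Proof.
split.
- by move=> t y _; split; apply: is_derive_cst.
- by move=> t y _; rewrite mulr0; split; apply: is_derive_cst.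
- by move=> y _; split => x; exact: cst_continuous.
- by move=> N y1 y2 _ _; exists (cn c).
- by move=> N y1 y2 _ _; exists (cn 0).
Qed.

Lemma holo_id a b : holo a b (fun t y => Complex t y) (fun _ _ => 1).
Proof.
split.
- by move=> t y _; split; [exact: is_derive_id|exact: is_derive_cst].
- move=> t y _; rewrite mulr1; split; [exact: is_derive_cst|exact: is_derive_id].
- by move=> y _; split => x; exact: cst_continuous.
- move=> N y1 y2 _ _; exists (N + (`|y1| + `|y2|)) => t y tN /andP[h1 h2].
  apply: (le_trans (cn_le_ReIm _)); rewrite /= lerD//.
  rewrite ler_norml; have := ler_norm y2; have := ler_normr (- y1) `|y1|.
  have := ler_norm (- y1); rewrite normrN; have := normr_ge0 y1; have := normr_ge0 y2.
  by move=> *; apply/andP; split; lra.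
- by move=> N y1 y2 _ _; exists (cn 1).
Qed.

Lemma ccontD (g h : R -> C) : ccont g -> ccont h -> ccont (fun s => g s + h s).
Proof.
move=> [g1 g2] [h1 h2]; split => x.
- by under eq_fun do rewrite cReD; apply: cvgD; [exact: g1|exact: h1].
- by under eq_fun do rewrite cImD; apply: cvgD; [exact: g2|exact: h2].
Qed.

Lemma cbounded_onD a b W V : cbounded_on a b W -> cbounded_on a b V ->
  cbounded_on a b (fun t y => W t y + V t y).
Proof.
move=> bW bV N y1 y2 h1 h2.
have [K HK] := bW N _ _ h1 h2; have [L HL] := bV N _ _ h1 h2.
by exists (K + L) => t y tN yy; rewrite (le_trans (cnD _ _))// lerD ?HK ?HL.
Qed.

Lemma holo_add a b W W' V V' : holo a b W W' -> holo a b V V' ->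
  holo a b (fun t y => W t y + V t y) (fun t y => W' t y + V' t y).
Proof.
move=> hW hV; split.
- move=> t y yab; have [w1 w2] := holo_x hW t yab; have [v1 v2] := holo_x hV t yab.
  rewrite /cderiv cReD cImD; split.
    by under eq_fun do rewrite cReD; exact: is_deriveD.
  by under eq_fun do rewrite cImD; exact: is_deriveD.
- move=> t y yab; have [w1 w2] := holo_y hW t yab; have [v1 v2] := holo_y hV t yab.
  rewrite mulrDr /cderiv cReD cImD; split.
    by under eq_fun do rewrite cReD; exact: is_deriveD.
  by under eq_fun do rewrite cImD; exact: is_deriveD.
- by move=> y yab; apply: ccontD; [exact: (holo_cont hW)|exact: (holo_cont hV)].
- by apply: cbounded_onD; [exact: (holo_bd hW)|exact: (holo_bd hV)].
- by apply: cbounded_onD; [exact: (holo_bd' hW)|exact: (holo_bd' hV)].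
Qed.

Lemma cderivM (g h : R -> C) x c d : cderiv g x c -> cderiv h x d ->
  cderiv (fun s => g s * h s) x (c * h x + g x * d).
Proof.
move=> [g1 g2] [h1 h2]; split.
- under eq_fun do rewrite cReM.
  apply: is_derive_eq; rewrite cReD !cReM /GRing.scale/=; ring.
- under eq_fun do rewrite cImM.
  apply: is_derive_eq; rewrite cImD !cImM /GRing.scale/=; ring.
Qed.

Lemma ccontM (g h : R -> C) : ccont g -> ccont h -> ccont (fun s => g s * h s).
Proof.
move=> [g1 g2] [h1 h2]; split => x.
- under eq_fun do rewrite cReM.
  by apply: cvgB; apply: cvgM; [exact: g1|exact: h1|exact: g2|exact: h2].
- under eq_fun do rewrite cImM.
  by apply: cvgD; apply: cvgM; [exact: g1|exact: h2|exact: g2|exact: h1].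
Qed.

Lemma cbounded_onM a b W V : cbounded_on a b W -> cbounded_on a b V ->
  cbounded_on a b (fun t y => W t y * V t y).
Proof.
move=> bW bV N y1 y2 h1 h2.
have [K HK] := bW N _ _ h1 h2; have [L HL] := bV N _ _ h1 h2.
exists (`|K| * `|L|) => t y tN yy; rewrite cnM ler_pM ?cn_ge0//.
- exact: le_trans (HK _ _ tN yy) (ler_norm _).
- exact: le_trans (HL _ _ tN yy) (ler_norm _).
Qed.

Lemma holo_mul a b W W' V V' : holo a b W W' -> holo a b V V' ->
  holo a b (fun t y => W t y * V t y) (fun t y => W' t y * V t y + W t y * V' t y).
Proof.
move=> hW hV; split.
- by move=> t y yab; apply: cderivM; [exact: (holo_x hW)|exact: (holo_x hV)].
- move=> t y yab; rewrite mulrDr [X in _ + X]mulrCA mulrA.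
  by apply: cderivM; [exact: (holo_y hW)|exact: (holo_y hV)].
- move=> y yab; apply: ccontD; apply: ccontM.
  + exact: (holo_cont hW).
  + exact: (holo_ccont hV).
  + exact: (holo_ccont hW).
  + exact: (holo_cont hV).
- by apply: cbounded_onM; [exact: (holo_bd hW)|exact: (holo_bd hV)].
- apply: cbounded_onD; apply: cbounded_onM.
  + exact: (holo_bd' hW).
  + exact: (holo_bd hV).
  + exact: (holo_bd hW).
  + exact: (holo_bd' hV).
Qed.

Lemma cReV z : Re z^-1 = Re z / (Re z ^+ 2 + Im z ^+ 2).
Proof. by case: z. Qed.

Lemma cImV z : Im z^-1 = - Im z / (Re z ^+ 2 + Im z ^+ 2).
Proof. by case: z => x y; rewrite mulNr. Qed.

Lemma sqr_cn_gt0 z : z != 0 -> 0 < Re z ^+ 2 + Im z ^+ 2.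
Proof. by move=> z0; rewrite -sqr_cn exprn_gt0// cn_gt0. Qed.

Lemma cderivV (g : R -> C) x c : g x != 0 -> cderiv g x c ->
  cderiv (fun s => (g s)^-1) x (- c / g x ^+ 2).
Proof.
move=> gx0 [g1 g2].
have d0 := sqr_cn_gt0 gx0; have dn0 : Re (g x) ^+ 2 + Im (g x) ^+ 2 != 0 by rewrite gt_eqF.
pose D s := Re (g s) ^+ 2 + Im (g s) ^+ 2.
have dD : is_derive x (1 : R) D (2 * (Re (g x) * Re c + Im (g x) * Im c)).
  by rewrite /D; apply: is_derive_eq; rewrite /GRing.scale/=; ring.
have dV : is_derive x (1 : R) (fun s => (D s)^-1)
    (- (D x) ^- 2 * (2 * (Re (g x) * Re c + Im (g x) * Im c))).
  by have := is_deriveV (f := D) dn0 dD; rewrite /GRing.scale.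
have q : (g x ^+ 2)^-1 = (g x)^-1 * (g x)^-1 by rewrite -exprVn expr2.
split.
- under eq_fun do rewrite cReV.
  apply: is_derive_eq.
  rewrite q cReM cReN cImN cReM cImM cReV cImV /D /GRing.scale/=.
  by field.
- under eq_fun do rewrite cImV.
  apply: is_derive_eq.
  rewrite q cImM cReN cImN cReM cImM cReV cImV /D /GRing.scale/=.
  by field.
Qed.

Lemma ccontV (g : R -> C) : (forall s, g s != 0) -> ccont g -> ccont (fun s => (g s)^-1).
Proof.
move=> g0 [g1 g2].
have cD : continuous (fun s => (Re (g s) ^+ 2 + Im (g s) ^+ 2)^-1).
  move=> x; apply: cvgV; first by rewrite gt_eqF// sqr_cn_gt0.
  by rewrite !expr2; apply: cvgD; apply: cvgM; [exact: g1|exact: g1|exact: g2|exact: g2].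
split => x.
- by under eq_fun do rewrite cReV; apply: cvgM; [exact: g1|exact: cD].
- under eq_fun do rewrite cImV; apply: cvgM; last exact: cD.
  by apply: cvgN; exact: g2.
Qed.

Lemma holo_ext a b W W' V V' : holo a b W W' -> (forall t y, W t y = V t y) ->
  (forall t y, W' t y = V' t y) -> holo a b V V'.
Proof.
move=> h e1 e2.
by have -> : V = W by [apply/funext => t; apply/funext => y];
  have -> : V' = W' by [apply/funext => t; apply/funext => y].
Qed.

(** The pole may lie on the edge of the strip, because bounds are only asked on smaller
    closed strips. *)
Lemma holo_inv a b (p : C) : (Im p <= a) || (b <= Im p) ->
  holo a b (fun t y => (Complex t y - p)^-1) (fun t y => - (Complex t y - p) ^- 2).
Proof.
move=> pab.
have hl : holo a b (fun t y => Complex t y - p) (fun _ _ => 1).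
  apply: (holo_ext (holo_add (holo_id a b) (holo_cst a b (- p)))) => // t y.
  by rewrite addr0.
have im t y : Im (Complex t y - p) = y - Im p by case: p {pab hl}.
have n0 t y : a < y < b -> Complex t y - p != 0.
  move=> yab; apply/eqP => /(congr1 Im); rewrite im/=; move: pab => /orP[]; lra.
have far_pole y1 y2 : a < y1 -> y2 < b -> exists2 m, 0 < m & forall t y, y1 <= y <= y2 ->
    cn (Complex t y - p)^-1 <= m^-1.
  move=> h1 h2.
  have key m : 0 < m -> (forall y, y1 <= y <= y2 -> m <= `|y - Im p|) ->
      forall t y, y1 <= y <= y2 -> cn (Complex t y - p)^-1 <= m^-1.
    move=> m0 H t y /H h; rewrite cnV; have : m <= cn (Complex t y - p).
      by rewrite (le_trans h)// -(im t) Im_le.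
    by move=> h'; rewrite lef_pV2// posrE// (lt_le_trans m0).
  case/orP : pab => hp.
    exists (y1 - Im p); first by lra.
    by apply: key => [|y yy]; [lra|rewrite ger0_norm; lra].
  exists (Im p - y2); first by lra.
  by apply: key => [|y yy]; [lra|rewrite distrC ger0_norm; lra].
split.
- move=> t y yab.
  by have := cderivV (n0 t y yab) (holo_x hl t yab); rewrite mulN1r.
- move=> t y yab; rewrite mulrN -mulNr.
  by have := cderivV (n0 t y yab) (holo_y hl t yab); rewrite mulr1.
- move=> y yab.
  have h1 : ccont (fun t => (Complex t y - p)^-1).
    by apply: ccontV; [move=> s; exact: n0|exact: (holo_ccont hl)].
  have [h2 h3] := ccontM (ccontM h1 h1) (g := fun t => (Complex t y - p)^-1 * (Complex t y - p)^-1)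
     (h := cst (-1)) ltac:(split => x; exact: cst_continuous).
  have E s : - (Complex s y - p) ^- 2 = (Complex s y - p)^-1 * (Complex s y - p)^-1 * cst (-1) s.
    by rewrite /cst mulrN1 -invfM -expr2.
  by split; under eq_fun do rewrite E.
- move=> N y1 y2 h1 h2; have [m m0 Hm] := far_pole y1 y2 h1 h2.
  by exists m^-1 => t y _ /Hm.
- move=> N y1 y2 h1 h2; have [m m0 Hm] := far_pole y1 y2 h1 h2.
  exists (m^-1 * m^-1) => t y _ /Hm hm.
  by rewrite cnN cnV cnX expr2 invfM ler_pM// ?invr_ge0 ?cn_ge0// -cnV.
Qed.

Lemma cderiv_exp (g : R -> C) x c : cderiv g x c ->
  cderiv (fun s => Complex (expR (Re (g s)) * cos (Im (g s))) (expR (Re (g s)) * sin (Im (g s))))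
    x (c * Complex (expR (Re (g x)) * cos (Im (g x))) (expR (Re (g x)) * sin (Im (g x)))).
Proof.
move=> [g1 g2].
have e1 : is_derive x (1 : R) (fun s => expR (Re (g s))) (expR (Re (g x)) * Re c).
  have h := is_derive_expR (Re (g x)).
  have := is_derive1_comp h g1.
  by rewrite /GRing.scale/=; apply.
have e2 : is_derive x (1 : R) (fun s => cos (Im (g s))) (- sin (Im (g x)) * Im c).
  have h := is_derive_cos (Im (g x)).
  have := is_derive1_comp h g2.
  by rewrite /GRing.scale/=; apply.
have e3 : is_derive x (1 : R) (fun s => sin (Im (g s))) (cos (Im (g x)) * Im c).
  have h := is_derive_sin (Im (g x)).
  have := is_derive1_comp h g2.
  by rewrite /GRing.scale/=; apply.
by split; apply: is_derive_eq; rewrite ?cReM ?cImM /GRing.scale/=; ring.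
Qed.

Definition cexp z : C := Complex (expR (Re z) * cos (Im z)) (expR (Re z) * sin (Im z)).

Lemma cn_cexp z : cn (cexp z) = expR (Re z).
Proof.
apply/eqP; rewrite -(eqrXn2 (n := 2)) ?cn_ge0 ?expR_ge0//; apply/eqP.
by rewrite sqr_cn/= !exprMn -mulrDr cos2Dsin2 mulr1.
Qed.

Lemma holo_exp a b W W' : holo a b W W' ->
  holo a b (fun t y => cexp (W t y)) (fun t y => W' t y * cexp (W t y)).
Proof.
move=> hW.
have cE y : a < y < b -> ccont (fun t => cexp (W t y)).
  move=> yab; have [w1 w2] := holo_ccont hW yab; split => x.
  - apply: cvgM; first by apply: continuous_comp; [exact: w1|exact: continuous_expR].
    by apply: continuous_comp; [exact: w2|exact: continuous_cos].
  - apply: cvgM; first by apply: continuous_comp; [exact: w1|exact: continuous_expR].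
    by apply: continuous_comp; [exact: w2|exact: continuous_sin].
have bE : cbounded_on a b (fun t y => cexp (W t y)).
  move=> N y1 y2 h1 h2; have [K HK] := holo_bd hW N h1 h2.
  exists (expR K) => t y tN yy; rewrite cn_cexp ler_expR.
  by rewrite (le_trans (ler_norm _))// (le_trans (Re_le _))// HK.
split.
- by move=> t y yab; apply: cderiv_exp; exact: (holo_x hW).
- by move=> t y yab; rewrite mulrA; apply: cderiv_exp; exact: (holo_y hW).
- by move=> y yab; apply: ccontM; [exact: (holo_cont hW)|exact: cE].
- exact: bE.
- by apply: cbounded_onM; [exact: (holo_bd' hW)|exact: bE].
Qed.

Definition cconj z : C := Complex (Re z) (- Im z).

Lemma cn_conj z : cn (cconj z) = cn z.
Proof. by rewrite !cnE/= sqrrN. Qed.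

Lemma holo_shift a b s W W' : holo a b W W' ->
  holo (a - s) (b - s) (fun t y => W t (y + s)) (fun t y => W' t (y + s)).
Proof.
move=> hW.
have sh (y : R) : a - s < y < b - s -> a < y + s < b by lra.
have dsh (f : R -> R) (y d : R) : is_derive (y + s) (1 : R) f d ->
    is_derive y (1 : R) (fun y => f (y + s)) d.
  move=> h; have hs : is_derive y (1 : R) (fun y => y + s) 1.
    by apply: is_derive_eq; rewrite addr0.
  by have := @is_derive1_comp R f (fun y => y + s) y d 1 h hs; rewrite mulr1.
split.
- by move=> t y /sh yab; exact: (holo_x hW).
- move=> t y /sh yab; have [h1 h2] := holo_y hW t yab.
  by split; [exact: (dsh (fun y => Re (W t y)))|exact: (dsh (fun y => Im (W t y)))].
- by move=> y /sh yab; exact: (holo_cont hW yab).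
- move=> N y1 y2 h1 h2.
  have [K HK] := holo_bd hW N (y1 := y1 + s) (y2 := y2 + s) ltac:(lra) ltac:(lra).
  by exists K => t y tN yy; apply: HK => //; lra.
- move=> N y1 y2 h1 h2.
  have [K HK] := holo_bd' hW N (y1 := y1 + s) (y2 := y2 + s) ltac:(lra) ltac:(lra).
  by exists K => t y tN yy; apply: HK => //; lra.
Qed.

(** Schwarz reflection across the horizontal line of height [s / 2]. *)
Lemma holo_reflect a b s W W' : holo a b W W' ->
  holo (s - b) (s - a) (fun t y => cconj (W t (s - y))) (fun t y => cconj (W' t (s - y))).
Proof.
move=> hW.
have sh (y : R) : s - b < y < s - a -> a < s - y < b by lra.
have dsh (f : R -> R) (y d : R) : is_derive (s - y) (1 : R) f d ->
    is_derive y (1 : R) (fun y => f (s - y)) (- d).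
  move=> h; have hs : is_derive y (1 : R) (fun y => s - y) (-1).
    by have := is_deriveB (is_derive_cst s y (1 : R)) (is_derive_id y (1 : R)); rewrite sub0r.
  by have := @is_derive1_comp R f (fun y => s - y) y d (-1) h hs; rewrite mulrN1.
split.
- move=> t y /sh yab; have [h1 h2] := holo_x hW t yab; split; first exact: h1.
  exact: is_deriveN.
- move=> t y /sh yab; have [h1 h2] := holo_y hW t yab.
  rewrite Re_ci in h1; rewrite Im_ci in h2.
  split; first by rewrite Re_ci; exact: (dsh (fun y => Re (W t y))).
  by rewrite Im_ci/= -[complex.Re _]opprK; apply: is_deriveN; exact: (dsh (fun y => Im (W t y))).
- move=> y /sh yab; have [h1 h2] := holo_cont hW yab; split; first exact: h1.
  by move=> x; apply: cvgN; exact: h2.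
- move=> N y1 y2 h1 h2.
  have [K HK] := holo_bd hW N (y1 := s - y2) (y2 := s - y1) ltac:(lra) ltac:(lra).
  by exists K => t y tN yy; rewrite cn_conj; apply: HK => //; lra.
- move=> N y1 y2 h1 h2.
  have [K HK] := holo_bd' hW N (y1 := s - y2) (y2 := s - y1) ltac:(lra) ltac:(lra).
  by exists K => t y tN yy; rewrite cn_conj; apply: HK => //; lra.
Qed.

Lemma holo_sub a b a' b' W W' : a <= a' -> b' <= b -> holo a b W W' -> holo a' b' W W'.
Proof.
move=> aa bb hW.
have sh (y : R) : a' < y < b' -> a < y < b by lra.
split.
- by move=> t y /sh yab; exact: (holo_x hW).
- by move=> t y /sh yab; exact: (holo_y hW).
- by move=> y /sh yab; exact: (holo_cont hW yab).
- by move=> N y1 y2 h1 h2; exact: (holo_bd hW N (le_lt_trans aa h1) (lt_le_trans h2 bb)).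
- by move=> N y1 y2 h1 h2; exact: (holo_bd' hW N (le_lt_trans aa h1) (lt_le_trans h2 bb)).
Qed.

(** ** Poisson representation of bounded holomorphic functions *)

Lemma lip_segment (f df : R -> R) (L x t : R) :
  (forall s, Num.min x t <= s <= Num.max x t -> is_derive s (1 : R) f (df s)) ->
  (forall s, Num.min x t <= s <= Num.max x t -> `|df s| <= L) ->
  `|f x - f t| <= L * `|x - t|.
Proof.
wlog xt : x t / t <= x.
  move=> H d b; case: (leP t x) => xt; first exact: H.
  by rewrite distrC (distrC x); apply: H => //; [exact: ltW|rewrite minC maxC..].
rewrite minEle maxEle => d b.
move: xt; rewrite le_eqVlt => /predU1P[->|xt]; first by rewrite !subrr normr0 mulr0.
rewrite leNgt xt/= in d b.
have dd s : s \in `]t, x[ -> is_derive s (1 : R) f (df s).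
  by rewrite in_itv/= => /andP[? ?]; apply: d; apply/andP; split; exact: ltW.
have [c cI ->] := MVT xt dd ltac:(apply: derivable_within_continuous => u uI; exact: is_derive_derivable (d u ltac:(by move: uI; rewrite in_itv/=))).
rewrite normrM ler_wpM2r// b//; move: cI; rewrite in_itv/= => /andP[? ?].
by apply/andP; split; exact: ltW.
Qed.

(** A Lipschitz bound along the path made of a horizontal and a vertical segment; each
    segment and each component contributes once. *)
Lemma holo_lip a b W W' N y1 y2 : holo a b W W' -> a < y1 -> y2 < b ->
  exists2 L, 0 <= L & forall x t y s, `|x| <= N -> `|t| <= N ->
    y1 <= y <= y2 -> y1 <= s <= y2 ->
    cn (W x y - W t s) <= 4 * L * cn (Complex x y - Complex t s).
Proof.
move=> h ay1 y2b; have [L HL] := holo_bd' h N ay1 y2b.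
exists `|L| => // x t y s xN tN /andP[y1y yy2] /andP[y1s ss2].
have L0 : 0 <= `|L| by [].
have b1 u : Num.min x t <= u <= Num.max x t -> cn (W' u y) <= `|L|.
  move=> /andP[u1 u2]; apply: le_trans (ler_norm _); apply: HL; last by rewrite y1y.
  move: xN tN u1 u2; rewrite !ler_norml minEle maxEle.
  by case: ifP => _ /andP[? ?] /andP[? ?] ? ?; apply/andP; split; lra.
have b2 u : Num.min y s <= u <= Num.max y s -> cn (W' t u) <= `|L| /\ a < u < b.
  move=> /andP[u1 u2].
  have uu : y1 <= u <= y2.
    move: u1 u2; rewrite minEle maxEle; case: ifP => _ u1 u2; apply/andP; split; lra.
  split; first by apply: le_trans (ler_norm _); apply: HL.
  by move: uu => /andP[? ?]; apply/andP; split; lra.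
have yab : a < y < b by apply/andP; split; lra.
have r1 : `|Re (W x y) - Re (W t y)| <= `|L| * `|x - t|.
  apply: (@lip_segment (fun x => Re (W x y)) (fun x => Re (W' x y))) => u uI.
    exact: (holo_x h u yab).1.
  by rewrite (le_trans (Re_le _))// b1.
have r2 : `|Im (W x y) - Im (W t y)| <= `|L| * `|x - t|.
  apply: (@lip_segment (fun x => Im (W x y)) (fun x => Im (W' x y))) => u uI.
    exact: (holo_x h u yab).2.
  by rewrite (le_trans (Im_le _))// b1.
have r3 : `|Re (W t y) - Re (W t s)| <= `|L| * `|y - s|.
  apply: (@lip_segment (fun y => Re (W t y)) (fun y => Re (ci * W' t y))) => u uI;
    have [h1 h2] := b2 u uI.
    exact: (holo_y h t h2).1.
  by rewrite (le_trans (Re_le _))// cnM cn_ci mul1r.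
have r4 : `|Im (W t y) - Im (W t s)| <= `|L| * `|y - s|.
  apply: (@lip_segment (fun y => Im (W t y)) (fun y => Im (ci * W' t y))) => u uI;
    have [h1 h2] := b2 u uI.
    exact: (holo_y h t h2).2.
  by rewrite (le_trans (Im_le _))// cnM cn_ci mul1r.
have n1 : `|x - t| <= cn (Complex x y - Complex t s) by have := Re_le (Complex x y - Complex t s).
have n2 : `|y - s| <= cn (Complex x y - Complex t s) by have := Im_le (Complex x y - Complex t s).
have -> : W x y - W t s = (W x y - W t y) + (W t y - W t s) by rewrite addrA subrK.
apply: (le_trans (cnD _ _)).
have c1 := cn_le_ReIm (W x y - W t y); have c2 := cn_le_ReIm (W t y - W t s).
rewrite !cReD !cImD !cReN !cImN in c1 c2.
have m1 : `|L| * `|x - t| <= `|L| * cn (Complex x y - Complex t s) by rewrite ler_wpM2l.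
have m2 : `|L| * `|y - s| <= `|L| * cn (Complex x y - Complex t s) by rewrite ler_wpM2l.
lra.
Qed.

Lemma holo_continuous_y a b W W' t y : holo a b W W' -> a < y < b ->
  {for y, continuous (fun s => Re (W t s))} /\ {for y, continuous (fun s => Im (W t s))}.
Proof.
move=> h yab; have [h1 h2] := holo_y h t yab.
by split; [exact: is_derive_cont h1|exact: is_derive_cont h2].
Qed.

(** A function that is holomorphic on both sides of the line of height [Y] and continuous
    across it except at one point: the integrals just below and just above that line have
    the same limit by dominated convergence. This replaces the theorem on removable
    singularities. *)
Lemma cauchy_jump (a b Y t M : R) W W1 W2 : a < Y -> Y < b ->
  holo a Y W W1 -> holo Y b W W2 ->
  (forall x u, a < u < b -> u != Y -> cn (W x u) <= M * wt x) ->
  (forall x, x != t -> {for Y, continuous (fun u => Re (W x u))}) ->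
  forall s v, a < s < Y -> Y < v < b ->
  \int[mu]_x Re (W x s) = \int[mu]_x Re (W x v).
Proof.
move=> aY Yb h1 h2 bd cY s v /andP[as_ sY] /andP[Yv vb].
(* The heights [Y - e n] and [Y + e n] stay between [s] and [v]. *)
pose r := Num.min (Y - s) (v - Y).
have r0 : 0 < r by rewrite lt_min !subr_gt0 sY.
pose e (n : nat) : R := r / 2 * n.+1%:R^-1.
have e0 n : 0 < e n by rewrite mulr_gt0 ?invr_gt0// divr_gt0.
have er n : e n < r.
  apply: (@le_lt_trans _ _ (r / 2)); last by rewrite ltr_pdivrMr// ltr_pMr// ltr1n.
  by rewrite ler_piMr ?divr_ge0 ?(ltW r0)// invf_le1// ler1n.
have es n : s < Y - e n.
  have : e n < Y - s by rewrite (lt_le_trans (er n))// ge_min lexx.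
  by move: (e n) => z; lra.
have ev n : Y + e n < v.
  have : e n < v - Y by rewrite (lt_le_trans (er n))// ge_min lexx orbT.
  by move: (e n) => z; lra.
have ec : e n @[n --> \oo] --> 0.
  by rewrite -(mulr0 (r / 2)); apply: cvgMl_tmp; exact: cvg_harmonic.
have cm : Y - e n @[n --> \oo] --> Y - 0 by apply: cvgB => //; exact: cvg_cst.
have cp : Y + e n @[n --> \oo] --> Y + 0 by apply: cvgD => //; exact: cvg_cst.
rewrite subr0 in cm; rewrite addr0 in cp.
have ltYm n : Y - e n < Y by rewrite ltrBlDr ltrDl.
have ltYp n : Y < Y + e n by rewrite ltrDl.
have am n : a < Y - e n < Y by rewrite ltYm (lt_trans as_).
have ap n : Y < Y + e n < b by rewrite ltYp (lt_trans (ev n)).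
have bm n x : cn (W x (Y - e n)) <= M * wt x.
  by apply: bd; [rewrite (lt_trans as_)//= (lt_trans (ltYm n))|rewrite lt_eqF].
have bp n x : cn (W x (Y + e n)) <= M * wt x.
  by apply: bd; [rewrite (lt_trans aY)//= (lt_trans (ev n))|rewrite gt_eqF].
have mm n : measurable_fun setT (fun x => Re (W x (Y - e n))).
  by have [] := ccont_meas (holo_ccont h1 (am n)).
have mp n : measurable_fun setT (fun x => Re (W x (Y + e n))).
  by have [] := ccont_meas (holo_ccont h2 (ap n)).
have lw : L1 (fun x => M * wt x) by apply: L1Z; exact: L1_wt.
have l1 n : L1 (fun x => Re (W x (Y - e n))).
  by apply: (L1_le (mm n) _ lw) => x; exact: le_trans (Re_le _) (bm n x).
have l2 n : L1 (fun x => Re (W x (Y + e n))).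
  by apply: (L1_le (mp n) _ lw) => x; exact: le_trans (Re_le _) (bp n x).
have [] := @dominated_cvgR R (fun n x => Re (W x (Y - e n)) - Re (W x (Y + e n))) (cst 0)
   (fun x => 2 * (M * wt x)).
- by move=> n; exact: measurable_funB.
- exact: measurable_cst.
- exists [set t]; split => //; first by rewrite lebesgue_measure_set1.
  move=> x /= nc; apply: contrapT => /eqP xt; apply: nc.
  rewrite /cst -(subrr (Re (W x Y))); apply: cvgB.
  + by apply: (@cvg_comp _ _ _ (fun n => Y - e n) (fun u => Re (W x u)) _ _ _ _ (cY x xt)); exact: cm.
  + by apply: (@cvg_comp _ _ _ (fun n => Y + e n) (fun u => Re (W x u)) _ _ _ _ (cY x xt)); exact: cp.
- exact: L1Z.
- apply: aeW => x n; apply: (le_trans (ler_normB _ _)).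
  by rewrite mulr_natl mulr2n; apply: lerD; [exact: le_trans (Re_le _) (bm n x)|exact: le_trans (Re_le _) (bp n x)].
move=> _.
have -> : (fun n => \int[mu]_x (Re (W x (Y - e n)) - Re (W x (Y + e n)))) =
    fun _ => \int[mu]_x Re (W x s) - \int[mu]_x Re (W x v).
  apply/funext => n; rewrite RintegralB; [|by []|exact: l1|exact: l2].
  congr (_ - _).
    apply/esym; apply: (cauchy_line h1 (K := M)) => // x u /andP[u1 u2].
    by apply: bd; [rewrite u1 (lt_trans u2)|rewrite lt_eqF].
  apply: (cauchy_line h2 (K := M)) => // x u /andP[u1 u2].
  by apply: bd; [rewrite u2 (lt_trans aY)|rewrite gt_eqF].
rewrite (_ : \int[mu]_x cst 0 x = 0); last by rewrite Rintegral_cst// mul0r.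
set D := _ - _ => c0.
have cD : D @[_ --> \oo] --> D by exact: cvg_cst.
have D0 : D = 0 := cvg_unique _ cD c0.
by apply/eqP; rewrite -subr_eq0 -/D D0.
Qed.

(** The integrand of the Poisson representation. Its pole at [t + i (s + y)] is removable;
    the other pole is the mirror image of that point in the line of height [s]. On that line
    the product of the two fractions is [pois t y x / y]. *)
Definition ckernel W (t s y : R) (x u : R) : C :=
  (W x u - W t (s + y)) *
  ((Complex x u - Complex t (s + y))^-1 * (Complex x u - Complex t (s - y))^-1).

Lemma ckernel_holo a W W' t s y (c d : R) : holo a d W W' -> a <= c -> s - y <= c ->
  (s + y <= c) || (d <= s + y) -> exists T', holo c d (ckernel W t s y) T'.
Proof.
move=> hW ac sc cd; eexists; apply: holo_mul.
  by apply: holo_add; [exact: holo_sub hW|exact: holo_cst].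
apply: holo_mul; apply: holo_inv => /=; first exact: cd.
by rewrite sc.
Qed.

Lemma cn_ge_dist (x u t s : R) : `|x - t| <= cn (Complex x u - Complex t s) /\
  `|u - s| <= cn (Complex x u - Complex t s).
Proof.
by split; [have := Re_le (Complex x u - Complex t s)|have := Im_le (Complex x u - Complex t s)].
Qed.

(** Above the line of height [s] the mirror point is the farther of the two poles. *)
Lemma ckernel_far a W (K t s y x u : R) : (forall x y, a < y -> cn (W x y) <= K) ->
  a < u -> a < s + y -> 0 < y -> s <= u -> x != t \/ u != s + y ->
  cn (ckernel W t s y x u) <= 2 * K * ((t - x) ^+ 2 + (u - (s + y)) ^+ 2)^-1.
Proof.
move=> bW au aY y0 su ne.
rewrite /ckernel !cnM !cnV.
set P := Complex x u - Complex t (s + y); set Q := Complex x u - Complex t (s - y).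
have e1 : cn P ^+ 2 = (t - x) ^+ 2 + (u - (s + y)) ^+ 2 by rewrite sqr_cn /=; ring.
have e2 : cn P ^+ 2 <= cn Q ^+ 2.
  rewrite !sqr_cn /= lerD2l.
  have -> : (u - (s - y)) ^+ 2 = (u - (s + y)) ^+ 2 + 4 * y * (u - s) by ring.
  by rewrite lerDl mulr_ge0 ?subr_ge0// mulr_ge0// ltW.
have P0 : 0 < cn P.
  have [h1 h2] := cn_ge_dist x u t (s + y).
  case: ne => ne; first by rewrite (lt_le_trans _ h1)// normr_gt0 subr_eq0.
  by rewrite (lt_le_trans _ h2)// normr_gt0 subr_eq0.
have PQ : cn P <= cn Q by rewrite -(ler_pXn2r (n := 2)) ?nnegrE ?cn_ge0.
apply: ler_pM.
- exact: cn_ge0.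
- by rewrite mulr_ge0// invr_ge0 cn_ge0.
- by apply: (le_trans (cnB _ _)); rewrite mulr_natl mulr2n lerD ?bW.
- rewrite -e1 -invfM lef_pV2 ?posrE; last 2 first.
  + by rewrite mulr_gt0// (lt_le_trans P0).
  + by rewrite exprn_gt0.
  by rewrite expr2 ler_pM2l.
Qed.

(** Near the removable singularity the increment of [W] compensates the pole, by
    [holo_lip]; farther than 1 from it horizontally, both fractions decay. *)
Lemma ckernel_le a W W' (K t s y a2 b : R) : (forall b, holo a b W W') ->
  (forall x y, a < y -> cn (W x y) <= K) -> 0 <= K -> a < a2 -> s - y < a2 -> a2 < s + y ->
  exists2 M, 0 <= M & forall x u, a2 < u < b -> u != s + y ->
    cn (ckernel W t s y x u) <= M * wt x.
Proof.
move=> hW bW K0 aa2 sya2 a2Y.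
(* [c1] is used for [|x - t| <= 1], with the Lipschitz bound on the rectangle [|x| <= N];
   [c2] is used elsewhere. *)
pose N := `|t| + 1.
pose b' := Num.max b (s + y + 1).
have bb : b <= b' by rewrite le_max lexx.
have Yb : s + y + 1 <= b' by rewrite le_max lexx orbT.
have Yb' : s + y <= b' by rewrite (le_trans _ Yb)// lerDl.
have b'b : b' < b' + 1 by rewrite ltrDl.
have [L L0 HL] := holo_lip N (hW (b' + 1)) aa2 b'b.
pose m := a2 - (s - y).
have m0 : 0 < m by rewrite /m subr_gt0.
pose c1 := 4 * L / m * (1 + N ^+ 2); pose c2 := 4 * K * cmp `|t| 1.
have L4 : 0 <= 4 * L / m by rewrite divr_ge0 ?mulr_ge0// ltW.
have c10 : 0 <= c1 by rewrite /c1 mulr_ge0// addr_ge0// sqr_ge0.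
have c20 : 0 <= c2 by rewrite /c2 mulr_ge0 ?mulr_ge0// ltW// cmp_gt0.
exists (c1 + c2); first exact: addr_ge0.
move=> x u /andP[a2u ub] uY.
rewrite mulrDl /ckernel !cnM !cnV.
set P := Complex x u - Complex t (s + y); set Q := Complex x u - Complex t (s - y).
have [dP1 dP2] := cn_ge_dist x u t (s + y); have [dQ1 dQ2] := cn_ge_dist x u t (s - y).
have P0 : 0 < cn P by rewrite (lt_le_trans _ dP2)// normr_gt0 subr_eq0.
have Q0 : m <= cn Q.
  by rewrite (le_trans _ dQ2)// (le_trans _ (ler_norm _))// /m lerD2r ltW.
have Q00 : 0 < cn Q by rewrite (lt_le_trans m0).
have [xt|xt] := leP `|x - t| 1.
  apply: ler_wpDr; first by rewrite mulr_ge0 ?wt_ge0.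
  have xN : `|x| <= N.
    by rewrite /N -[x](subrK t) (le_trans (ler_normD _ _))// addrC lerD2l.
  have h1 : cn (W x u - W t (s + y)) <= 4 * L * cn P.
    apply: HL => //; first by rewrite /N lerDl.
    - by rewrite (ltW a2u) (le_trans (ltW ub)).
    - by rewrite (ltW a2Y).
  apply: (@le_trans _ _ (4 * L / m)).
    rewrite mulrA; apply: (@le_trans _ _ (4 * L * (cn Q)^-1)).
      by rewrite ler_wpM2r ?invr_ge0 ?cn_ge0// ler_pdivrMr.
    by rewrite ler_wpM2l ?mulr_ge0// lef_pV2.
  rewrite /c1 -(mulrA (4 * L / m)) ler_peMr//.
  rewrite /wt ler_pdivlMr ?oneDsq_gt0// mul1r lerD2l -[x ^+ 2]real_normK ?num_real//.
  by rewrite lerXn2r// nnegrE// /N addr_ge0.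
apply: ler_wpDl; first by rewrite mulr_ge0 ?wt_ge0.
have xt2 : 0 < `|x - t| by rewrite (lt_trans _ xt).
have h1 : cn (W x u - W t (s + y)) * ((cn P)^-1 / cn Q) <= 2 * K * (`|x - t|^-1 * `|x - t|^-1).
  apply: ler_pM => //.
  - exact: cn_ge0.
  - by rewrite mulr_ge0// invr_ge0 cn_ge0.
  - apply: (le_trans (cnB _ _)); rewrite mulr_natl mulr2n lerD// bW//.
      by rewrite (lt_trans aa2).
    by rewrite (lt_trans aa2).
  - by apply: ler_pM; rewrite ?invr_ge0 ?cn_ge0// lef_pV2// posrE// (lt_le_trans xt2).
apply: (le_trans h1).
have -> : c2 * wt x = 2 * K * (2 * (cmp `|t| 1 * wt x)) by rewrite /c2; ring.
rewrite ler_wpM2l ?mulr_ge0//.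
apply: (@le_trans _ _ (2 * ((t - x) ^+ 2 + 1 ^+ 2)^-1)); last first.
  by rewrite ler_wpM2l//; exact: denV_le.
rewrite -invfM ler_pdivlMr ?den_gt0// mulrC ler_pdivrMr ?mulr_gt0//.
rewrite -[(t - x) ^+ 2]real_normK ?num_real// distrC expr1n.
by clear -xt; move: `|x - t| xt => z z1; nra.
Qed.

(** The integral of [ckernel] over the line of height [s] equals the integral over any
    line above the removable singularity, and the latter tends to 0 as the line moves up. *)
Lemma poisson_repr a W W' (K : R) : (forall b, holo a b W W') ->
  (forall x y, a < y -> cn (W x y) <= K) ->
  forall s y t : R, a < s -> 0 < y ->
  \int[mu]_x (pois t y x * Re (W x s)) = pi * Re (W t (s + y)).
Proof.
move=> hW bW s y t as_ y0.
pose Y := s + y; pose T := ckernel W t s y.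
have K0 : 0 <= K by apply: le_trans (bW 0 s as_); exact: cn_ge0.
pose a1 := Num.max a (s - y).
have a1s : a1 < s by rewrite gt_max as_/= ltrBlDr ltrDl.
have aa1 : a <= a1 by rewrite le_max lexx.
have sa1 : s - y <= a1 by rewrite le_max lexx orbT.
pose a2 := (a1 + s) / 2.
have a12 : a1 < a2 by rewrite /a2; lra.
have a2s : a2 < s by rewrite /a2; lra.
have sY : s < Y by rewrite /Y ltrDl.
have aY : a < Y by rewrite (lt_trans as_).
have a2Y : a2 < Y by rewrite (lt_trans a2s).
have aa2 : a < a2 by exact: le_lt_trans a12.
have sya2 : s - y < a2 by exact: le_lt_trans a12.
have [T1 hT1] : exists T', holo a2 Y T T'.
  by apply: (@ckernel_holo a _ W') => //; [exact: ltW|exact: ltW|rewrite lexx orbT].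
have hT2 b : exists T', holo Y b T T'.
  apply: (@ckernel_holo a _ W') => //; [exact: ltW| |by rewrite lexx].
  by rewrite (le_trans (ltW sya2))// ltW.
have cY x : x != t -> {for Y, continuous (fun u => Re (T x u))}.
  move=> xt.
  have P0 (r : R) : Complex x Y - Complex t r != 0.
    by apply/eqP => /(congr1 Re) /= /eqP; rewrite subr_eq0 (negbTE xt).
  have YI : a < Y < Y + 1 by rewrite aY ltrDl/=.
  have hl p := holo_add (holo_id a (Y + 1)) (holo_cst a (Y + 1) (- p)).
  have d1 := cderivV (P0 Y) (holo_y (hl (Complex t Y)) x YI).
  have d2 := cderivV (P0 (s - y)) (holo_y (hl (Complex t (s - y))) x YI).
  have d3 := holo_y (holo_add (hW (Y + 1)) (holo_cst a (Y + 1) (- W t Y))) x YI.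
  have [d4 _] := cderivM d3 (cderivM d1 d2).
  exact: is_derive_cont d4.
have cross v : Y < v -> \int[mu]_x Re (T x s) = \int[mu]_x Re (T x v).
  move=> Yv; have [T2 hT2'] := hT2 (v + 1).
  have [M M0 HM] := ckernel_le t (v + 1) hW bW K0 aa2 sya2 a2Y.
  have Yv1 : Y < v + 1 by rewrite (lt_trans Yv)// ltrDl.
  apply: (cauchy_jump a2Y Yv1 hT1 hT2' HM cY); first by rewrite a2s.
  by rewrite Yv ltrDl/=.
have zero : \int[mu]_x Re (T x s) = 0.
  have bnd v : 0 < v -> `|\int[mu]_x Re (T x s)| <= 2 * K * pi / v.
    move=> v0; have Yv : Y < Y + v by rewrite ltrDl.
    have av : a < Y + v by rewrite (lt_trans aY).
    rewrite (cross _ Yv).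
    have far x : `|Re (T x (Y + v))| <= 2 * K / v * pois t v x.
      rewrite (le_trans (Re_le _))//.
      have := @ckernel_far a W K t s y x (Y + v) bW av aY y0 _ _.
      have -> : Y + v - (s + y) = v by rewrite /Y; ring.
      move=> h; apply: (le_trans (h _ _)).
      - by rewrite ltW// (lt_trans sY).
      - by right; rewrite gt_eqF.
      - by rewrite /pois [leRHS]mulrA divfK ?gt_eqF.
    have [T2 hT2'] := hT2 (Y + v + 1).
    have mT : measurable_fun setT (fun x => Re (T x (Y + v))).
      by have [] := ccont_meas (holo_ccont hT2' (y := Y + v) ltac:(by rewrite Yv ltrDl/=)).
    have lp : L1 (fun x => 2 * K / v * pois t v x) by apply: L1Z; exact: L1_pois.
    have lT := L1_le mT far lp.
    apply: (le_trans (le_normr_Rintegral _ _)) => //.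
    have -> : 2 * K * pi / v = \int[mu]_x (2 * K / v * pois t v x).
      by rewrite RintegralZl ?int_pois//; [ring|exact: L1_pois].
    apply: le_Rintegral => //; exact: L1_norm.
  apply/eqP; rewrite -normr_eq0 eq_le normr_ge0 andbT.
  rewrite leNgt; apply/negP => Ipp.
  have c0 : 0 <= 2 * K * pi by rewrite !mulr_ge0// pi_ge0.
  have v1 : 0 < 2 * K * pi / `|\int[mu]_x Re (T x s)| + 2 by rewrite ltr_wpDl// divr_ge0.
  have := bnd _ v1; rewrite ler_pdivlMr//.
  rewrite mulrDr mulrC divfK ?gt_eqF// gerDl leNgt.
  by rewrite mulr_gt0.
have yn0 : y != 0 by rewrite gt_eqF.
have TE x : Re (T x s) = y^-1 * (pois t y x * Re (W x s) - Re (W t Y) * pois t y x).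
  have dn0 := den_neq0 t x y0.
  rewrite /T /ckernel -invfM -/Y.
  have -> : (Complex x s - Complex t Y) * (Complex x s - Complex t (s - y)) =
      Complex ((t - x) ^+ 2 + y ^+ 2) 0.
    by apply: ceqP; rewrite ?cReM ?cImM /Y/=; ring.
  rewrite cReM cReV cImV /= !cReD cReN /pois.
  rewrite oppr0 mul0r mulr0 subr0 expr0n addr0.
  by field; rewrite dn0 yn0.
have mWs : measurable_fun setT (fun x => Re (W x s)).
  have sI : a < s < s + 1 by rewrite as_ ltrDl/=.
  by have [] := ccont_meas (holo_ccont (hW (s + 1)) sI).
have lW : L1 (fun x => pois t y x * Re (W x s)).
  apply: (@L1_le _ _ (fun x => K * pois t y x)).
  - by apply: measurable_funM => //; exact: measurable_pois.
  - move=> x; rewrite normrM (ger0_norm (pois_ge0 t x y0)) mulrC.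
    apply: ler_wpM2r; first exact: pois_ge0.
    by rewrite (le_trans (Re_le _))// bW.
  - by apply: L1Z; exact: L1_pois.
have lg : L1 (fun x => Re (W t Y) * pois t y x) by apply: L1Z; exact: L1_pois.
move: zero; under eq_Rintegral do rewrite TE.
rewrite RintegralZl//; last exact: L1B.
rewrite RintegralB// RintegralZl//; last exact: L1_pois.
rewrite int_pois// => /eqP; rewrite mulf_eq0 invr_eq0 (negbTE yn0)/= subr_eq0 => /eqP ->.
by rewrite mulrC.
Qed.

End holomorphic.

(** * The analytic completion of a Poisson integral *)
Section completion.
Variable R : realType.
Local Notation mu := (@lebesgue_measure R).
Local Notation C := R[i].
Local Notation Re := (@complex.Re R).
Local Notation Im := (@complex.Im R).
Implicit Types (u : R -> R) (t y x s : R).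

Lemma derive_Lw u (k dk : R -> R -> R) (a c d K : R) : Lw u -> c < a < d ->
  (forall s, c < s < d -> L1 (fun x => k s x * u x)) ->
  (forall s x, c < s < d -> is_derive s (1 : R) (k ^~ x) (dk s x)) ->
  (forall s x, c < s < d -> `|dk s x| <= K * wt x) ->
  is_derive a (1 : R) (fun s => \int[mu]_x (k s x * u x)) (\int[mu]_x (dk a x * u x)).
Proof.
move=> lu acd intk dkE dkb.
pose f s x := k s x * u x.
have Ia : `]c, d[%classic a by rewrite /= in_itv.
have intf s : `]c, d[%classic s -> mu.-integrable setT (EFin \o f s).
  by rewrite /= in_itv/= => sI; exact: intk.
have df s x : `]c, d[%classic s -> is_derive s (1 : R) (f ^~ x) (dk s x * u x).
  rewrite /= in_itv/= => sI; have h := dkE s x sI.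
  by apply: is_derive_eq; rewrite /GRing.scale/= mulr0 add0r mulrC.
have derf s x : `]c, d[%classic s -> [set: R] x -> derivable (f ^~ x) s 1.
  by move=> sI _; exact: is_derive_derivable (df s x sI).
have d1f s x : `]c, d[%classic s -> partial1of2 f s x = dk s x * u x.
  by move=> sI; rewrite partial1of2E; have := df s x sI => ?; rewrite derive_val.
pose G x := `|K| * `|wt x * u x|.
have G0 x : 0 <= G x by rewrite mulr_ge0.
have iG : mu.-integrable setT (EFin \o G).
  by apply: L1Z; apply: L1_norm; case: lu.
have Gub s x : `]c, d[%classic s -> [set: R] x -> `|partial1of2 f s x| <= G x.
  move=> sI _; rewrite d1f// normrM /G normrM mulrA ler_wpM2r//.
  have h : `|dk s x| <= K * wt x by apply: dkb; move: sI; rewrite /= in_itv.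
  by apply: (le_trans h); rewrite (ger0_norm (wt_ge0 x)) ler_wpM2r ?wt_ge0// ler_norm.
have D := @derivable_under_integral R _ _ mu f setT measurableT a c d Ia intf derf G G0 iG Gub.
have E := @differentiation_under_integral R _ _ mu f setT measurableT a c d Ia intf derf G G0 iG Gub.
apply: DeriveDef; first exact: D.
by rewrite -derive1E E; apply: eq_Rintegral => x _; rewrite d1f.
Qed.

Lemma continuous_Lw u (k : R -> R -> R) (a c d K : R) : Lw u -> c < a < d ->
  (forall s, measurable_fun setT (k s)) ->
  (forall s x, c < s < d -> {for s, continuous (k ^~ x)}) ->
  (forall s x, c < s < d -> `|k s x| <= K * wt x) ->
  {for a, continuous (fun s => \int[mu]_x (k s x * u x))}.
Proof.
move=> lu acd mk ck kb.
have Ia : a \in `]c, d[%classic by rewrite inE/= in_itv.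
apply: (@continuity_under_integral R _ _ mu (fun s x => k s x * u x) setT measurableT c d _ _
  (fun x => `|K| * `|wt x * u x|) _ _ a Ia).
- move=> s; rewrite /= in_itv/= => sI; apply: (L1_Lw lu (mk s) (C := K)) => x; exact: kb.
- apply: aeW => x _ s; rewrite inE/= in_itv/= => sI.
  by apply: cvgMr_tmp; exact: ck.
- by apply: L1Z; apply: L1_norm; case: lu.
- move=> s; rewrite /= in_itv/= => sI; apply: aeW => x _.
  rewrite normrM normrM mulrA ler_wpM2r//.
  rewrite (ger0_norm (wt_ge0 x)) (le_trans (kb s x _))//.
  by rewrite ler_wpM2r ?wt_ge0// ler_norm.
Qed.

Lemma integralZ (c : R) u : L1 u -> \int[mu]_x (c * u x) = c * \int[mu]_x u x.
Proof. by move=> lu; rewrite RintegralZl. Qed.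

Definition d1ker t y x : R := - (2 * (t - x) * y) / ((t - x) ^+ 2 + y ^+ 2) ^+ 2.
Definition d2ker t y x : R := (y ^+ 2 - (t - x) ^+ 2) / ((t - x) ^+ 2 + y ^+ 2) ^+ 2.

Lemma d1ker_le t y x : 0 < y -> `|d1ker t y x| <= ((t - x) ^+ 2 + y ^+ 2)^-1.
Proof.
move=> y0; have d0 := den_gt0 (t - x) y0.
rewrite /d1ker normrM normrV ?unitfE ?expf_neq0 ?gt_eqF// (@ger0_norm _ (_ ^+ 2)) ?sqr_ge0//.
rewrite ler_pdivrMr ?exprn_gt0// expr2 mulrA mulVf ?gt_eqF// mul1r normrN.
have := sqr_ge0 (t - x - y); have := sqr_ge0 (t - x + y).
by rewrite ler_norml => h1 h2; apply/andP; split; lra.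
Qed.

Lemma d2ker_le t y x : 0 < y -> `|d2ker t y x| <= ((t - x) ^+ 2 + y ^+ 2)^-1.
Proof.
move=> y0; have d0 := den_gt0 (t - x) y0.
rewrite /d2ker normrM normrV ?unitfE ?expf_neq0 ?gt_eqF// (@ger0_norm _ (_ ^+ 2)) ?sqr_ge0//.
rewrite ler_pdivrMr ?exprn_gt0// expr2 mulrA mulVf ?gt_eqF// mul1r.
have := sqr_ge0 (t - x); have := sqr_ge0 y.
by rewrite ler_norml => h1 h2; apply/andP; split; lra.
Qed.

(** The Poisson integral of [u], a harmonic extension of [u] to the upper half-plane. *)
Definition pA u t y : R := pi^-1 * \int[mu]_x (pois t y x * u x).
(** The conjugate Poisson integral of [u]. The compensating term of [qker] makes it
    converge and only adds a constant. *)
Definition pB u t y : R := pi^-1 * conjp u y t.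
(** The analytic completion of the Poisson integral of [u]. *)
Definition pw u t y : C := Complex (pA u t y) (pB u t y).
Definition pw' u t y : C := Complex (pi^-1 * \int[mu]_x (d1ker t y x * u x))
                                    (pi^-1 * \int[mu]_x (d2ker t y x * u x)).

Lemma derive_scale (f : R -> R) t (c d : R) : is_derive t (1 : R) f d ->
  is_derive t (1 : R) (fun s => c * f s) (c * d).
Proof. by move=> h; apply: is_derive_eq; rewrite /GRing.scale/=; ring. Qed.

Lemma derive_den_t y x t : is_derive t (1 : R) (fun t => (t - x) ^+ 2 + y ^+ 2) (2 * (t - x)).
Proof. by apply: is_derive_eq; rewrite /GRing.scale/=; ring. Qed.

Lemma derive_den_y t x y : is_derive y (1 : R) (fun y => (t - x) ^+ 2 + y ^+ 2) (2 * y).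
Proof. by apply: is_derive_eq; rewrite /GRing.scale/=; ring. Qed.

Lemma derive_quot (f g : R -> R) t (a b : R) : g t != 0 -> is_derive t (1 : R) f a ->
  is_derive t (1 : R) g b -> is_derive t (1 : R) (fun s => f s / g s) ((a * g t - f t * b) / g t ^+ 2).
Proof.
move=> g0 hf hg.
have hV : is_derive t (1 : R) (fun s => (g s)^-1) (- (g t) ^- 2 * b).
  by have := is_deriveV (f := g) g0 hg; rewrite /GRing.scale.
by apply: is_derive_eq; rewrite /GRing.scale/=; field.
Qed.

Lemma continuous_quot (f g : R -> R) t : g t != 0 -> {for t, continuous f} ->
  {for t, continuous g} -> {for t, continuous (fun s => f s / g s)}.
Proof. by move=> g0 hf hg; apply: cvgM => //; apply: cvgV. Qed.

Lemma measurable_quot (f g : R -> R) : measurable_fun setT f -> measurable_fun setT g ->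
  measurable_fun setT (fun s => f s / g s).
Proof.
by move=> mf mg; apply: measurable_funM => //; apply: (measurableT_comp (@measurable_invr R)).
Qed.

Lemma measurable_sub t : measurable_fun setT (fun x : R => t - x).
Proof. exact: measurable_funB. Qed.

Lemma measurable_den t y : measurable_fun setT (fun x : R => ((t - x) ^+ 2 + y ^+ 2) ^+ 2).
Proof.
apply: measurable_funX; apply: measurable_funD => //; apply: measurable_funX; exact: measurable_sub.
Qed.

Lemma measurable_d1ker t y : measurable_fun setT (d1ker t y).
Proof.
apply: measurable_quot; last exact: measurable_den.
apply: measurableT_comp => //; apply: measurable_funM => //; apply: measurable_funM => //.
exact: measurable_sub.
Qed.

Lemma measurable_d2ker t y : measurable_fun setT (d2ker t y).
Proof.
apply: measurable_quot; last exact: measurable_den.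
by apply: measurable_funB => //; apply: measurable_funX; exact: measurable_sub.
Qed.

Lemma continuous_den_t y x t : {for t, continuous (fun t => ((t - x) ^+ 2 + y ^+ 2) ^+ 2)}.
Proof.
by apply: is_derive_cont; apply: is_derive_eq.
Qed.

Section pw.
Variable u : R -> R.
Hypothesis lu : Lw u.

Lemma near_t t y x s : 0 < y -> t - 1 < s < t + 1 ->
  ((s - x) ^+ 2 + y ^+ 2)^-1 <= cmp (`|t| + 1) y * wt x.
Proof.
move=> y0 /andP[h1 h2]; apply: denV_le => //.
rewrite -[s](subrK t) (le_trans (ler_normD _ _))// addrC lerD2l ler_norml.
by apply/andP; split; lra.
Qed.

Lemma near_y t y x s : 0 < y -> y / 2 < s < y + 1 ->
  ((t - x) ^+ 2 + s ^+ 2)^-1 <= cmp `|t| (y / 2) * wt x.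
Proof. by move=> y0 /andP[h1 h2]; apply: denV_le => //; [rewrite divr_gt0|exact: ltW]. Qed.

Lemma pw_x t y : 0 < y -> cderiv (pw u ^~ y) t (pw' u t y).
Proof.
move=> y0.
have tI : t - 1 < t < t + 1 by apply/andP; split; lra.
split; apply: derive_scale.
- apply: (derive_Lw (k := fun s x => pois s y x) (dk := fun s x => d1ker s y x)
    (K := cmp (`|t| + 1) y) lu tI).
  + by move=> s _; exact: L1_pois_Lw.
  + move=> s x _.
    have h' := @derive_quot (fun=> y) (fun s => (s - x) ^+ 2 + y ^+ 2) s _ _
      (den_neq0 s x y0) (is_derive_cst y s (1 : R)) (derive_den_t y x s).
    apply: (is_derive_eq h'); rewrite /d1ker; congr (_ / _); ring.
  + by move=> s x sI; rewrite (le_trans (d1ker_le _ _ y0))// near_t.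
- apply: (derive_Lw (k := fun s x => qker s y x) (dk := fun s x => d2ker s y x)
    (K := cmp (`|t| + 1) y) lu tI).
  + by move=> s _; exact: L1_qker.
  + move=> s x _.
    have hs : is_derive s (1 : R) (fun s => s - x) 1.
      by apply: is_derive_eq; rewrite subr0.
    have h' := @derive_quot (fun s => s - x) (fun s => (s - x) ^+ 2 + y ^+ 2) s _ _
      (den_neq0 s x y0) hs (derive_den_t y x s).
    have h2 := is_deriveD h' (is_derive_cst (x * wt x) s (1 : R)).
    rewrite addr0 in h2.
    apply: (is_derive_eq h2); rewrite /d2ker; congr (_ / _); ring.
  + by move=> s x sI; rewrite (le_trans (d2ker_le _ _ y0))// near_t.
Qed.

Lemma pw_y t y : 0 < y -> cderiv (pw u t) y (ci R * pw' u t y).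
Proof.
move=> y0.
have yI : y / 2 < y < y + 1 by apply/andP; split; lra.
have pos s : y / 2 < s < y + 1 -> 0 < s by move=> /andP[? ?]; lra.
split; rewrite ?Re_ci ?Im_ci /=.
- rewrite -mulrN; apply: derive_scale.
  have -> : - (\int[mu]_x (d2ker t y x * u x)) = \int[mu]_x (- d2ker t y x * u x).
    under [RHS]eq_Rintegral do rewrite mulNr -mulN1r.
    rewrite RintegralZl ?mulN1r//.
    apply: (L1_Lw lu (measurable_d2ker t y) (C := cmp `|t| (y / 2))) => x.
    by rewrite (le_trans (d2ker_le _ _ y0))// near_y.
  apply: (derive_Lw (k := pois t) (dk := fun s x => - d2ker t s x) (K := cmp `|t| (y / 2)) lu yI).
  + by move=> s /pos s0; exact: L1_pois_Lw.
  + move=> s x /pos s0.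
    have h' := @derive_quot (fun s => s) (fun s => (t - x) ^+ 2 + s ^+ 2) s _ _
      (den_neq0 t x s0) (is_derive_id s (1 : R)) (derive_den_y t x s).
    apply: (is_derive_eq h'); rewrite /d2ker -[RHS]mulNr; congr (_ / _); ring.
  + by move=> s x sI; rewrite normrN (le_trans (d2ker_le _ _ (pos s sI)))// near_y.
- apply: derive_scale.
  apply: (derive_Lw (k := qker t) (dk := d1ker t) (K := cmp `|t| (y / 2)) lu yI).
  + by move=> s /pos s0; exact: L1_qker.
  + move=> s x /pos s0.
    have h' := @derive_quot (fun=> t - x) (fun s => (t - x) ^+ 2 + s ^+ 2) s _ _
      (den_neq0 t x s0) (is_derive_cst (t - x) s (1 : R)) (derive_den_y t x s).
    have h2 := is_deriveD h' (is_derive_cst (x * wt x) s (1 : R)).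
    rewrite addr0 in h2.
    apply: (is_derive_eq h2); rewrite /d1ker; congr (_ / _); ring.
  + by move=> s x sI; rewrite (le_trans (d1ker_le _ _ (pos s sI)))// near_y.
Qed.

Lemma pw_cont y : 0 < y -> ccont (pw' u ^~ y).
Proof.
move=> y0; have tI t : t - 1 < t < t + 1 by apply/andP; split; lra.
have cs x t : {for t, continuous (fun t => t - x)}.
  by apply: cvgB; [exact: cvg_id|exact: cvg_cst].
have dn s x : ((s - x) ^+ 2 + y ^+ 2) ^+ 2 != 0 by rewrite expf_neq0 ?den_neq0.
split => t; apply: cvgMl_tmp; apply: (continuous_Lw (K := cmp (`|t| + 1) y) lu (tI t)).
- by move=> s; exact: measurable_d1ker.
- move=> s x _; apply: (@continuous_quot (fun s => - (2 * (s - x) * y)) (fun s => ((s - x) ^+ 2 + y ^+ 2) ^+ 2)) => //.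
    by apply: cvgN; apply: cvgMr_tmp; apply: cvgMl_tmp; exact: cs.
  exact: continuous_den_t.
- by move=> s x sI; rewrite (le_trans (d1ker_le _ _ y0))// near_t.
- by move=> s; exact: measurable_d2ker.
- move=> s x _; apply: (@continuous_quot (fun s => y ^+ 2 - (s - x) ^+ 2) (fun s => ((s - x) ^+ 2 + y ^+ 2) ^+ 2)) => //.
    by apply: cvgB; [exact: cvg_cst|rewrite !expr2; apply: cvgM; exact: cs].
  exact: continuous_den_t.
- by move=> s x sI; rewrite (le_trans (d2ker_le _ _ y0))// near_t.
Qed.

Lemma kernel_integral_le (k : R -> R) (K : R) : measurable_fun setT k -> 0 <= K ->
  (forall x, `|k x| <= K * wt x) ->
  `|pi^-1 * \int[mu]_x (k x * u x)| <= pi^-1 * (K * \int[mu]_x (wt x * `|u x|)).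
Proof.
move=> mk K0 kK; have pi0 := pi_gt0 R.
have lk := L1_Lw lu mk kK.
have lw : L1 (fun x => wt x * `|u x|) by case: (Lw_norm lu).
rewrite normrM gtr0_norm ?invr_gt0// ler_pM2l ?invr_gt0//.
apply: (le_trans (le_normr_Rintegral _ _)) => //.
rewrite -RintegralZl//; apply: le_Rintegral => //; [exact: L1_norm|exact: L1Z|].
by move=> x _; rewrite normrM mulrA ler_wpM2r.
Qed.

Lemma pw_holo b : holo 0 b (pw u) (pw' u).
Proof.
split.
- by move=> t y /andP[y0 _]; exact: pw_x.
- by move=> t y /andP[y0 _]; exact: pw_y.
- by move=> y /andP[y0 _]; exact: pw_cont.
- move=> N y1 y2 y10 _.
  pose I := \int[mu]_x (wt x * `|u x|).
  have I0 : 0 <= I by apply: Rintegral_ge0 => x _; rewrite mulr_ge0 ?wt_ge0.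
  pose K1 := `|y2| * cmp `|N| y1; pose K2 := (1 + N ^+ 2) / y1 + 2 * `|N| + `|y2|.
  have pi0 : 0 <= (pi : R)^-1 by rewrite invr_ge0 pi_ge0.
  have c0 := cmp_gt0 `|N| y10.
  exists (pi^-1 * (K1 * I) + pi^-1 * (K2 * I)) => t y tN /andP[yy1 yy2].
  have y0 : 0 < y by exact: lt_le_trans yy1.
  have yy : y <= `|y2| by rewrite (le_trans yy2)// ler_norm.
  have tN' : `|t| <= `|N| by rewrite (le_trans tN)// ler_norm.
  apply: (le_trans (cn_le_ReIm _)); apply: lerD.
  + apply: kernel_integral_le; first exact: measurable_pois.
      by rewrite mulr_ge0// ltW.
    move=> x; rewrite ger0_norm ?pois_ge0// (le_trans (pois_le _ y10 yy1 tN'))//.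
    by rewrite ler_wpM2r ?wt_ge0// ler_wpM2r// ltW.
  + apply: kernel_integral_le; first exact: measurable_qker.
      by rewrite !addr_ge0 ?mulr_ge0 ?invr_ge0 ?addr_ge0 ?sqr_ge0// ltW.
    move=> x; rewrite (le_trans (qker_le _ _ y0))// ler_wpM2r ?wt_ge0//.
    apply: lerD => //; apply: lerD; last by rewrite ler_wpM2l.
    apply: ler_pM; rewrite ?invr_ge0 ?addr_ge0 ?sqr_ge0// ?(ltW y0)//.
      by rewrite lerD2l -[t ^+ 2]real_normK ?num_real// -[N ^+ 2]real_normK ?num_real// lerXn2r.
    by rewrite lef_pV2.
- move=> N y1 y2 y10 _.
  pose I := \int[mu]_x (wt x * `|u x|).
  have c0 := cmp_gt0 `|N| y10.
  exists (pi^-1 * (cmp `|N| y1 * I) + pi^-1 * (cmp `|N| y1 * I)) => t y tN /andP[yy1 yy2].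
  have y0 : 0 < y by exact: lt_le_trans yy1.
  have tN' : `|t| <= `|N| by rewrite (le_trans tN)// ler_norm.
  apply: (le_trans (cn_le_ReIm _)); apply: lerD; apply: kernel_integral_le.
  + exact: measurable_d1ker.
  + exact: ltW.
  + by move=> x; rewrite (le_trans (d1ker_le _ _ y0))// denV_le.
  + exact: measurable_d2ker.
  + exact: ltW.
  + by move=> x; rewrite (le_trans (d2ker_le _ _ y0))// denV_le.
Qed.

End pw.
(** ** Fast Cauchy sequences in the mean square *)

(** Cauchy-Schwarz for the telescoping sum, in the form [(a + b) ^ 2 <= 2 a ^ 2 + 2 b ^ 2]
    applied at each step. *)
Lemma sq_chain (g : nat -> R) n i :
  (g (i + n)%N - g i) ^+ 2 <= \sum_(j < n) 2 ^+ j.+1 * (g (i + j).+1 - g (i + j)%N) ^+ 2.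
Proof.
elim: n i => [|n IH] i; first by rewrite big_ord0 addn0 subrr expr0n.
rewrite big_ord_recl/= addn0 expr1.
have -> : \sum_(j < n) 2 ^+ (bump 0 j).+1 * (g (i + bump 0 j).+1 - g (i + bump 0 j)%N) ^+ 2
    = 2 * \sum_(j < n) 2 ^+ j.+1 * (g (i.+1 + j).+1 - g (i.+1 + j)%N) ^+ 2.
  rewrite big_distrr/=; apply: eq_bigr => j _.
  by rewrite /bump/= add1n exprS mulrA addnS addSn.
have := IH i.+1; rewrite addSn -addnS.
set S := \sum_(j < n) _; set x := g (i + n.+1)%N; set y := g i.+1; set z := g i => h.
by have := sqr_ge0 ((x - y) - (y - z)); nra.
Qed.

(** The squared increments, weighted by [2 ^ (n + 1)], still have a summable series of
    integrals. The pointwise sum of that series is almost everywhere finite; by [sq_chain]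
    it dominates all [(g n - g 0) ^ 2], and it forces convergence. *)
Lemma L2_fast_cauchy (g : nat -> R -> R) (c : R) :
  (forall n, measurable_fun setT (g n)) -> L1 (fun x => g 0%N x ^+ 2) ->
  (forall n, L1 (fun x => (g n.+1 x - g n x) ^+ 2)) ->
  (forall n, \int[mu]_x ((g n.+1 x - g n x) ^+ 2) <= c * 8^-1 ^+ n) ->
  exists (D l : R -> R), [/\ L1 D, measurable_fun setT l,
    {ae mu, forall x, forall n, g n x ^+ 2 <= D x} &
    {ae mu, forall x, g n x @[n --> \oo] --> l x}].
Proof.
move=> mg l0 ld bd.
pose a n x : R := 2 ^+ n.+1 * (g n.+1 x - g n x) ^+ 2.
have a0 n x : 0 <= a n x by rewrite mulr_ge0 ?sqr_ge0// exprn_ge0.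
have ma n : measurable_fun setT (a n).
  by apply: measurable_funM => //; apply: measurable_funX; apply: measurable_funB.
have la n : L1 (a n) by exact: L1Z.
pose E x : \bar R := (\sum_(0 <= n <oo) (a n x)%:E)%E.
have mE : measurable_fun setT E.
  apply: (@ge0_emeasurable_sum _ _ _ _ (fun n x => (a n x)%:E)) => //.
  - by move=> n x _ _; rewrite lee_fin.
  - by move=> n _; apply/measurable_EFinP; exact: ma.
have E0 x : (0 <= E x)%E by apply: nneseries_ge0 => n _ _; rewrite lee_fin.
have c0 : 0 <= c.
  have := bd 0%N; rewrite expr0 mulr1; apply: le_trans.
  by apply: Rintegral_ge0 => x _; exact: sqr_ge0.
have iE : (\int[mu]_x E x < +oo)%E.
  rewrite integral_nneseries//; last 2 first.
  - by move=> n; apply/measurable_EFinP; exact: ma.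
  - by move=> n x _; rewrite lee_fin.
  apply: (@le_lt_trans _ _ (2 * c / (1 - 4^-1))%:E); last exact: ltry.
  apply: lime_le.
    by apply: is_cvg_nneseries => n _ _; apply: integral_ge0 => x _; rewrite lee_fin.
  apply: nearW => n.
  apply: (@le_trans _ _ (series (geometric (2 * c) 4^-1) n)%:E); last first.
    rewrite lee_fin; apply: geometric_le_lim => //; first exact: mulr_ge0.
    by rewrite ger0_norm ?invf_lt1 ?ltr1n.
  rewrite /series/= -sumEFin; apply: lee_sum => k _.
  rewrite (L1_integral (la k)) lee_fin integralZ// /geometric/=.
  apply: (@le_trans _ _ (2 ^+ k.+1 * (c * 8^-1 ^+ k))).
    by rewrite ler_wpM2l// exprn_ge0.
  rewrite le_eqVlt; apply/orP; left; apply/eqP.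
  have -> : (4^-1 : R) = 2 * 8^-1 by field.
  by rewrite exprMn exprS; ring.
have lE : mu.-integrable setT E.
  apply/integrableP; split => //.
  by under eq_integral do rewrite gee0_abs//.
have finE := integrable_ae measurableT lE.
(* From [g n = g 0 + (g n - g 0)] and [(a + b) ^ 2 <= 2 a ^ 2 + 2 b ^ 2]. *)
pose D x := 2 * g 0%N x ^+ 2 + 2 * fine (E x).
have lfE : L1 (fun x => fine (E x)).
  apply/integrableP; split.
    by apply/measurable_EFinP; apply: measurableT_comp => //; exact: fine_measurable.
  apply: le_lt_trans iE; apply: ge0_le_integral => //.
  - apply: measurableT_comp => //; apply/measurable_EFinP.
    by apply: measurableT_comp => //; exact: fine_measurable.
  - move=> x _; rewrite /= ger0_norm ?fine_ge0//.
    by case: (E x) (E0 x).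
(* The upper limit is a measurable function that agrees with the limit where it exists. *)
exists D, (fun x => fine (limn_esup (fun n => (g n x)%:E))); split.
- by apply: L1D; exact: L1Z.
- apply: measurableT_comp; first exact: fine_measurable.
  by apply: measurable_fun_limn_esup => n; apply/measurable_EFinP; exact: mg.
- apply: ae_mono finE => x /(_ I) fx n.
  have part : \sum_(j < n) a j x <= fine (E x).
    rewrite -lee_fin fineK// -sumEFin -(big_mkord xpredT (fun j => (a j x)%:E)).
    by apply: nneseries_lim_ge => k _ _; rewrite lee_fin.
  have := sq_chain (fun n => g n x) n 0; rewrite add0n => ch.
  have {}ch : (g n x - g 0%N x) ^+ 2 <= fine (E x).
    apply: (le_trans ch); apply: le_trans part.
    by apply: ler_sum => k _; rewrite add0n.
  rewrite /D; have := sqr_ge0 (g n x - 2 * g 0%N x).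
  by move: ch; set A := g n x; set B := g 0%N x; set e := fine _; nra.
- apply: ae_mono finE => x /(_ I) fx.
  have cg : cvgn (fun n => g n x).
    have -> : (fun n => g n x) = (fun n => g 0%N x + series (telescope (fun n => g n x)) n).
      by apply/funext => n; rewrite -(eq_sum_telescope (fun n => g n x)).
    apply: is_cvgD; first exact: is_cvg_cst.
    apply: normed_cvg.
    apply: (@series_le_cvg _ _ (fun n => geometric 1 2^-1 n + a n x)).
    + by move=> n /=.
    + by move=> n; rewrite addr_ge0// /geometric/= mul1r exprn_ge0.
    + move=> n; rewrite /telescope /geometric /a /= mul1r exprVn exprS.
      set b := g n.+1 x - g n x.
      have p0 : 0 < 2 ^+ n :> R by rewrite exprn_gt0.
      have -> : b ^+ 2 = `|b| ^+ 2 by rewrite real_normK ?num_real.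
      move: (2 ^+ n) p0 (normr_ge0 b) => p p0 b0.
      (* Completing the square: [|b| <= 2 ^ - n + 2 ^ (n + 1) * b ^ 2]. *)
      rewrite -subr_ge0 (_ : _ - _ = p^-1 * ((1 - p * `|b| / 2) ^+ 2 + 7 / 4 * (p * `|b|) ^+ 2)).
        by rewrite mulr_ge0 ?invr_ge0 ?(ltW p0)// addr_ge0 ?sqr_ge0// mulr_ge0 ?sqr_ge0// divr_ge0.
      by field; rewrite gt_eqF.
    + rewrite (_ : series _ = series (geometric 1 2^-1) \+ series (a ^~ x)); last first.
        by apply/funext => n; rewrite /series/= big_split.
      apply: is_cvgD.
        by apply: is_cvg_geometric_series; rewrite ger0_norm ?invf_lt1 ?ltr1n// invr_ge0.
      apply: nondecreasing_is_cvgn.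
        by apply/nondecreasing_series => k _ _.
      exists (fine (E x)) => _ [n _ <-]; rewrite -lee_fin fineK// /series/= -sumEFin.
      by apply: nneseries_lim_ge => k _ _; rewrite lee_fin.
  have := cg => /cvg_ex[l gl].
  have gl' : (g n x)%:E @[n --> \oo] --> l%:E by apply: cvg_EFin => //; exact: nearW.
  by rewrite (cvg_limn_einf_sup gl').2.
Qed.

(** ** The square root of the outer function *)
Section sqrt_outer.
Variable h : R -> R.
Hypothesis lh : Lw h.
Let F x := expR (2 * h x).
Hypothesis lF : L1 F.
Let I0 := \int[mu]_x F x.

(** The outer function with boundary modulus [expR h]; it has no zeros. *)
Definition outer t y : C := cexp (pw h t y).

Let outer' t y : C := pw' h t y * outer t y.

Lemma outer_holo b : holo 0 b outer outer'.
Proof. exact: holo_exp (pw_holo lh b). Qed.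

Lemma sqr_cn_outer t y : cn (outer t y) ^+ 2 = expR (2 * pA h t y).
Proof. by rewrite cn_cexp expRM_natl. Qed.

Let F_ge0 x : 0 <= F x. Proof. exact: expR_ge0. Qed.

Let mF : measurable_fun setT F. Proof. exact: L1_measurable. Qed.

Lemma LwF : Lw F.
Proof.
split => //; apply: (@L1_le _ _ F) => //.
- by apply: measurable_funM => //; exact: measurable_wt.
- move=> x; rewrite ger0_norm ?mulr_ge0 ?wt_ge0// ler_piMl//.
  by rewrite /wt invf_le1 ?oneDsq_gt0// lerDl sqr_ge0.
Qed.

(** Jensen's inequality for the probability density [pois t y x / pi], proved by
    integrating the tangent line of the exponential at the mean value of [2 * h]. *)
Lemma outer_jensen t y : 0 < y ->
  cn (outer t y) ^+ 2 <= pi^-1 * \int[mu]_x (pois t y x * F x).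
Proof.
move=> y0; rewrite sqr_cn_outer; set m := 2 * pA h t y.
have pi0 := pi_gt0 R.
have lp := L1_pois t y0; have lph := L1_pois_Lw t lh y0.
have lpF := L1_pois_Lw t LwF y0.
rewrite mulrC ler_pdivlMr//.
(* The right-hand integrand is the tangent line [expR m * (1 + (2 h - m))] times the kernel. *)
have -> : expR m * pi = \int[mu]_x (expR m * (1 - m) * pois t y x + 2 * expR m * (pois t y x * h x)).
  rewrite RintegralD//; [|exact: L1Z|exact: L1Z].
  rewrite (integralZ _ lp) (integralZ _ lph) int_pois//.
  have -> : \int[mu]_x (pois t y x * h x) = pi * pA h t y by rewrite /pA mulrA mulfV ?mul1r ?gt_eqF.
  by rewrite /m; ring.
apply: le_Rintegral => //; first by apply: L1D; exact: L1Z.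
move=> x _.
have -> : expR m * (1 - m) * pois t y x + 2 * expR m * (pois t y x * h x) =
    pois t y x * (expR m * (1 + (2 * h x - m))) by ring.
apply: ler_wpM2l; first exact: pois_ge0.
have -> : F x = expR m * expR (2 * h x - m) by rewrite -expRD addrC subrK.
by rewrite ler_wpM2l ?expR_ge0// expR_ge1Dx.
Qed.

Lemma sqr_cn_outer_le (s t y : R) : 0 < s -> s <= y -> cn (outer t y) ^+ 2 <= I0 / (pi * s).
Proof.
move=> s0 sy; have y0 : 0 < y by exact: lt_le_trans sy.
apply: (le_trans (outer_jensen t y0)).
rewrite invfM mulrCA ler_pM2l ?invr_gt0 ?pi_gt0//.
rewrite mulrC -RintegralZl//; apply: le_Rintegral => //; first exact: L1_pois_Lw LwF y0.
  exact: L1Z.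
move=> x _; apply: ler_wpM2r; first exact: F_ge0.
by rewrite (le_trans (pois_le_V _ _ y0))// lef_pV2.
Qed.

Lemma cn_outer_le (s t y : R) : 0 < s -> s <= y -> cn (outer t y) <= Num.sqrt (I0 / (pi * s)).
Proof.
move=> s0 sy; rewrite -[cn _]ger0_norm ?cn_ge0// -sqrtr_sqr.
by apply: ler_wsqrtr; exact: sqr_cn_outer_le.
Qed.

(** Integrate [outer_jensen] over [t] and exchange the integrals: the Poisson kernel is
    symmetric in its two abscissas. *)
Lemma outer_hardy y : 0 < y -> (\int[mu]_t (cn (outer t y) ^+ 2)%:E <= I0%:E)%E.
Proof.
move=> y0.
have mo : measurable_fun setT (fun t => cn (outer t y) ^+ 2).
  under eq_fun do rewrite sqr_cn.
  have [h1 h2] := ccont_meas (holo_ccont (outer_holo (y + 1)) (y := y) ltac:(apply/andP; split; lra)).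
  by apply: measurable_funD; apply: measurable_funX.
pose k (p : R * R) : \bar R := (pi^-1 * (pois p.1 y p.2 * F p.2))%:E.
have mk : measurable_fun setT k.
  apply/measurable_EFinP; apply: measurable_funM => //; apply: measurable_funM.
    rewrite /pois; apply: measurable_funM => //.
    apply: (measurableT_comp (@measurable_invr R)); apply: measurable_funD => //.
    by apply: measurable_funX; apply: measurable_funB.
  exact: (measurableT_comp mF).
have k0 p : (0 <= k p)%E.
  by rewrite lee_fin mulr_ge0 ?invr_ge0 ?pi_ge0//; apply: mulr_ge0; [exact: pois_ge0|exact: F_ge0].
apply: (@le_trans _ _ (\int[mu]_t \int[mu]_x k (t, x))%E).
  apply: ge0_le_integral => //.
  - by move=> t _; rewrite lee_fin sqr_ge0.
  - exact/measurable_EFinP.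
  - exact: (measurable_fun_fubini_tonelli_F (m2 := mu) k mk k0).
  - move=> t _; rewrite /k/=.
    have lk : L1 (fun x => pi^-1 * (pois t y x * F x)) by apply: L1Z; exact: L1_pois_Lw LwF y0.
    rewrite (L1_integral lk) lee_fin RintegralZl//; last exact: L1_pois_Lw LwF y0.
    exact: outer_jensen.
have -> := fubini_tonelli (m1 := mu) (m2 := mu) k mk k0.
rewrite -(L1_integral lF); apply: ge0_le_integral => //.
- by move=> x _; apply: integral_ge0.
- exact: (measurable_fun_fubini_tonelli_G (m1 := mu) k mk k0).
- exact/measurable_EFinP.
move=> x _; rewrite /k/=.
have E t : (pi^-1 * (pois t y x * F x))  = pi^-1 * F x * pois x y t.
  by rewrite /pois (_ : (x - t) ^+ 2 = (t - x) ^+ 2); ring.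
under eq_integral do rewrite E.
have lk : L1 (fun t => pi^-1 * F x * pois x y t) by apply: L1Z; exact: L1_pois.
rewrite (L1_integral lk) lee_fin RintegralZl ?int_pois//; last exact: L1_pois.
by rewrite mulrAC mulVf ?mul1r// gt_eqF// pi_gt0.
Qed.

(** Dividing by [z + i] gives the decay at infinity needed by [cauchy_line]. *)
Definition damp t y : C := outer t y * (Complex t y - Complex 0 (-1))^-1.

Lemma damp_holo b : exists damp', holo 0 b damp damp'.
Proof.
eexists; apply: holo_mul; first exact: outer_holo.
by apply: holo_inv => /=; rewrite lerN10.
Qed.

Lemma sqr_cn_pole t y : cn (Complex t y - Complex 0 (-1)) ^+ 2 = t ^+ 2 + (y + 1) ^+ 2.
Proof. by rewrite sqr_cn/= subr0 opprK. Qed.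

Lemma sqr_cn_poleV t y : 0 < y -> cn (Complex t y - Complex 0 (-1))^-1 ^+ 2 <= wt t.
Proof.
move=> y0; rewrite cnV exprVn sqr_cn_pole /wt lef_pV2 ?posrE ?oneDsq_gt0//.
  by rewrite addrC lerD2l expr2; nra.
by apply: den_gt0; lra.
Qed.

Lemma damp_le (s t y : R) : 0 < s -> s <= y -> cn (damp t y) ^+ 2 <= I0 / (pi * s) * wt t.
Proof.
move=> s0 sy; rewrite cnM exprMn ler_pM ?sqr_ge0//; first exact: sqr_cn_outer_le.
by apply: sqr_cn_poleV; exact: lt_le_trans sy.
Qed.

Lemma damp_le_outer t y : 0 < y -> cn (damp t y) ^+ 2 <= cn (outer t y) ^+ 2.
Proof.
move=> y0; rewrite cnM exprMn ler_piMr ?sqr_ge0//.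
rewrite (le_trans (sqr_cn_poleV t y0))// /wt invf_le1 ?oneDsq_gt0//.
by rewrite lerDl sqr_ge0.
Qed.

Lemma damp_ccont y : 0 < y -> ccont (damp ^~ y).
Proof.
move=> y0; have [d' hd] := damp_holo (y + 1).
by apply: (holo_ccont hd); rewrite y0 ltrDl/=.
Qed.

Lemma measurable_sqr_cn (g : R -> C) : ccont g -> measurable_fun setT (fun t => cn (g t) ^+ 2).
Proof.
move=> cg; under eq_fun do rewrite sqr_cn.
by have [h1 h2] := ccont_meas cg; apply: measurable_funD; apply: measurable_funX.
Qed.

Lemma L1_damp y : 0 < y -> L1 (fun t => cn (damp t y) ^+ 2).
Proof.
move=> y0; apply: (@L1_le _ _ (fun t => I0 / (pi * y) * wt t)).
- exact: measurable_sqr_cn (damp_ccont y0).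
- by move=> t; rewrite ger0_norm ?sqr_ge0// damp_le.
- by apply: L1Z; exact: L1_wt.
Qed.

Definition hnorm y := \int[mu]_t (cn (damp t y) ^+ 2).

Lemma hnorm_le y : 0 < y -> hnorm y <= I0.
Proof.
move=> y0; rewrite -lee_fin -(L1_integral (L1_damp y0)).
apply: le_trans (outer_hardy y0); apply: ge0_le_integral => //.
- by move=> x _; rewrite lee_fin sqr_ge0.
- by apply/measurable_EFinP; exact: L1_measurable (L1_damp y0).
- apply/measurable_EFinP; apply: measurable_sqr_cn.
  by apply: (holo_ccont (outer_holo (y + 1))); rewrite y0 ltrDl/=.
- by move=> x _; rewrite lee_fin damp_le_outer.
Qed.

Lemma cconjM_re (z w : C) : Re (z * cconj w) = Re z * Re w + Im z * Im w.
Proof. by rewrite cReM/= mulrN opprK. Qed.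

Lemma damp_pair_le (s t y1 y2 : R) : 0 < s -> s <= y1 -> s <= y2 ->
  cn (damp t y1 * cconj (damp t y2)) <= I0 / (pi * s) * wt t.
Proof.
move=> s0 s1 s2; rewrite cnM cn_conj.
have h1 := damp_le t s0 s1; have h2 := damp_le t s0 s2.
have := sqr_ge0 (cn (damp t y1) - cn (damp t y2)); rewrite sqrrB => h3.
apply: (@le_trans _ _ ((cn (damp t y1) ^+ 2 + cn (damp t y2) ^+ 2) / 2)).
  rewrite ler_pdivlMr// mulr_natr; rewrite -subr_ge0; apply: le_trans h3 _.
  by rewrite le_eqVlt; apply/orP; left; apply/eqP; ring.
by rewrite ler_pdivrMr//; lra.
Qed.

(** Sliding the two factors in opposite vertical directions is a contour shift: the
    second factor, conjugated and reflected in the line halfway between, is holomorphic. *)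
Lemma damp_polar y y' : 0 < y -> y < y' ->
  \int[mu]_x Re (damp x y' * cconj (damp x y)) = hnorm ((y + y') / 2).
Proof.
move=> y0 yy; set m := (y + y') / 2.
have [d' hd] := damp_holo (2 * m).
(* At [s = 0] this is [|damp t m| ^ 2]; at [s = (y' - y) / 2] it pairs the levels [y'] and [y]. *)
pose W (t s : R) : C := damp t (s + m) * cconj (damp t (m - s)).
pose r := y' / 2.
have hW : exists W', holo (- r) r W W'.
  have h1 := holo_shift m hd; have h2 := holo_reflect m hd.
  have e1 : 0 - m <= - r by rewrite /r /m; lra.
  have e2 : r <= 2 * m - m by rewrite /r /m; lra.
  have e3 : m - 2 * m <= - r by rewrite /r /m; lra.
  have e4 : r <= m - 0 by rewrite /r /m; lra.
  by eexists; exact: holo_mul (holo_sub e1 e2 h1) (holo_sub e3 e4 h2).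
have [W' hW'] := hW.
have y20 : 0 < y / 2 by rewrite divr_gt0.
have bd x s : - r < s < r -> cn (W x s) <= I0 / (pi * (y / 2)) * wt x.
  by move=> /andP[s1 s2]; apply: damp_pair_le => //; move: s1 s2; rewrite /r /m; lra.
have e1 : - r < 0 by rewrite /r; lra.
have e2 : 0 < (y' - y) / 2 by lra.
have e3 : (y' - y) / 2 < r by rewrite /r; lra.
have E := cauchy_line hW' bd e1 e2 e3.
transitivity (\int[mu]_x Re (damp x (0 + m) * cconj (damp x (m - 0)))).
  rewrite E; apply: eq_Rintegral => x _; congr (Re (damp x _ * cconj (damp x _))); rewrite /m; lra.
apply: eq_Rintegral => x _.
by rewrite add0r subr0 cconjM_re sqr_cn !expr2.
Qed.

Lemma damp_dist y y' : 0 < y -> y < y' ->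
  L1 (fun x => cn (damp x y' - damp x y) ^+ 2) /\
  \int[mu]_x (cn (damp x y' - damp x y) ^+ 2) = hnorm y + hnorm y' - 2 * hnorm ((y + y') / 2).
Proof.
move=> y0 yy; have y'0 : 0 < y' by exact: lt_trans yy.
have l1 := L1_damp y0; have l2 := L1_damp y'0.
have lr : L1 (fun x => Re (damp x y' * cconj (damp x y))).
  apply: (@L1_le _ _ (fun t => I0 / (pi * y) * wt t)).
  - have [c1 c2] := ccont_meas (damp_ccont y0); have [c3 c4] := ccont_meas (damp_ccont y'0).
    by under eq_fun do rewrite cconjM_re; apply: measurable_funD; apply: measurable_funM.
  - by move=> x; rewrite (le_trans (Re_le _))// damp_pair_le// ltW.
  - by apply: L1Z; exact: L1_wt.
have E x : cn (damp x y' - damp x y) ^+ 2 =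
    cn (damp x y) ^+ 2 + cn (damp x y') ^+ 2 - 2 * Re (damp x y' * cconj (damp x y)).
  by rewrite cconjM_re !sqr_cn cReD cImD cReN cImN; ring.
have -> : (fun x => cn (damp x y' - damp x y) ^+ 2) =
    (fun x => cn (damp x y) ^+ 2 + cn (damp x y') ^+ 2 - 2 * Re (damp x y' * cconj (damp x y))).
  by apply/funext => x; rewrite E.
split; first by apply: L1B; [exact: L1D|exact: L1Z].
rewrite RintegralB//; [|exact: L1D|exact: L1Z].
by rewrite RintegralD// integralZ// damp_polar.
Qed.

(** By [damp_polar] the squared norms are midpoint-convex, so an increase over one step
    would be repeated over all later steps of the same length, against boundedness. *)
Lemma hnorm_noninc y y' : 0 < y -> y < y' -> hnorm y' <= hnorm y.
Proof.
move=> y0 yy; rewrite leNgt; apply/negP => lt.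
pose d := hnorm y' - hnorm y; pose r := y' - y.
have d0 : 0 < d by rewrite subr_gt0.
have r0 : 0 < r by rewrite subr_gt0.
have pos n : 0 < y + r *+ n by rewrite ltr_wpDr// mulrn_wge0// ltW.
have step n : d <= hnorm (y + r *+ n.+1) - hnorm (y + r *+ n).
  elim: n => [|n IH].
    by rewrite mulr0n addr0 (_ : y + r *+ 1 = y')// mulr1n /r; ring.
  have lt2 : y + r *+ n < y + r *+ n.+2.
    by rewrite ltrD2l !mulrS addrA ltrDr addr_gt0.
  have [_ E] := damp_dist (pos n) lt2.
  have : 0 <= \int[mu]_x (cn (damp x (y + r *+ n.+2) - damp x (y + r *+ n)) ^+ 2).
    by apply: Rintegral_ge0 => x _; exact: sqr_ge0.
  rewrite E.
  have -> : (y + r *+ n + (y + r *+ n.+2)) / 2 = y + r *+ n.+1.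
    by rewrite !mulrS; field.
  by move: IH; lra.
have grow n : hnorm y + d *+ n <= hnorm (y + r *+ n).
  elim: n => [|n IH]; first by rewrite !mulr0n !addr0.
  by rewrite mulrSr addrA; move: IH (step n); lra.
pose n := Num.bound ((I0 - hnorm y) / d).
have hn : (I0 - hnorm y) / d < n%:R.
  by apply: archi_boundP; rewrite divr_ge0 ?subr_ge0 ?hnorm_le// ltW.
rewrite ltr_pdivrMr// mulrC mulr_natr in hn.
by have := grow n; have := hnorm_le (pos n); lra.
Qed.

(** The squared distance between two levels is a second difference of the monotone
    bounded function [hnorm]. *)
Lemma damp_cauchy (e : R) : 0 < e -> exists2 d, 0 < d & forall y y', 0 < y -> y < y' -> y' <= d ->
  \int[mu]_x (cn (damp x y' - damp x y) ^+ 2) <= e.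
Proof.
move=> e0.
pose A := [set hnorm y | y in [set y | 0 < y]].
have hA : has_sup A.
  split; first by exists (hnorm 1); exists 1 => //=.
  by exists I0 => _ [y /= y0 <-]; exact: hnorm_le.
have [_ [d /= d0 <-] hd] := sup_adherent (divr_gt0 e0 (ltr0n R 2)) hA.
exists d => // y y' y0 yy yd.
have ub z : 0 < z -> hnorm z <= sup A.
  by move=> z0; apply: sup_upper_bound => //; exists z.
have [_ ->] := damp_dist y0 yy.
have md : (y + y') / 2 < d by lra.
have m0 : 0 < (y + y') / 2 by lra.
have := hnorm_noninc m0 md; have := ub y y0; have := ub y' (lt_trans y0 yy).
move: hd; lra.
Qed.

Lemma fast_cauchy_levels : exists ys : nat -> R,
  [/\ (forall n, 0 < ys n <= 1), (forall n, ys n.+1 < ys n), ys n @[n --> \oo] --> 0 &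
   forall n, \int[mu]_x (cn (damp x (ys n) - damp x (ys n.+1)) ^+ 2) <= 1 * 8^-1 ^+ n].
Proof.
have e0 n : 0 < 8^-1 ^+ n :> R by rewrite exprn_gt0// invr_gt0.
have ex n : exists d, 0 < d /\ forall y y', 0 < y -> y < y' -> y' <= d ->
    \int[mu]_x (cn (damp x y' - damp x y) ^+ 2) <= 8^-1 ^+ n.
  by have [d d0 hd] := damp_cauchy (e0 n); exists d.
have [d hd] := choice ex.
(* Halving makes the levels tend to 0; the threshold [d n] makes the increments small. *)
pose ys := fix ys n : R := match n with O => Num.min (d 0%N) 1
  | S m => Num.min (ys m / 2) (d n) end.
have pos n : 0 < ys n.
  elim: n => [|n IH] /=; rewrite lt_min.
    by rewrite (hd 0%N).1 ltr01.
  by rewrite divr_gt0// (hd n.+1).1.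
have half n : ys n.+1 <= ys n / 2 by rewrite /= ge_min lexx.
have ysd n : ys n <= d n by case: n => [|n] /=; rewrite ge_min lexx ?orbT.
have geo n : ys n <= geometric 1 2^-1 n.
  elim: n => [|n IH]; first by rewrite /geometric/= expr0 mulr1 ge_min lexx orbT.
  apply: (le_trans (half n)); rewrite /geometric/= exprSr mulrA ler_wpM2r ?invr_ge0//.
have dec n : ys n.+1 < ys n.
  by apply: (le_lt_trans (half n)); rewrite ltr_pdivrMr// ltr_pMr// ltr1n.
exists ys; split => //.
- move=> n; rewrite pos/= (le_trans (geo n))// /geometric/= mul1r exprn_ile1// ?invr_ge0//.
  by rewrite invf_le1// ler1n.
- apply: (@squeeze_cvgr _ _ _ _ (cst 0) (geometric 1 2^-1)).
  + by apply: nearW => n; rewrite (ltW (pos n)) geo.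
  + exact: cvg_cst.
  + by apply: cvg_geometric; rewrite ger0_norm ?invf_lt1 ?ltr1n// invr_ge0.
- by move=> n; rewrite mul1r; apply: (hd n).2.
Qed.

(** Mean-square convergence yields convergence almost everywhere only along a sequence of
    heights; the Poisson formula will later remove this restriction. *)
Lemma damp_boundary_seq : exists (ys : nat -> R) (D lR lI : R -> R),
  [/\ (forall n, 0 < ys n <= 1) /\ ys n @[n --> \oo] --> 0,
   L1 D, measurable_fun setT lR /\ measurable_fun setT lI,
   {ae mu, forall x, forall n, cn (damp x (ys n)) ^+ 2 <= D x} &
   {ae mu, forall x, Re (damp x (ys n)) @[n --> \oo] --> lR x /\
                     Im (damp x (ys n)) @[n --> \oo] --> lI x}].
Proof.
have [ys [pos dec ys0 bd]] := fast_cauchy_levels.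
have p n : 0 < ys n by case/andP: (pos n).
have ld n := (damp_dist (p n.+1) (dec n)).1.
have m n := ccont_meas (damp_ccont (p n)).
have dR x n : (Re (damp x (ys n.+1)) - Re (damp x (ys n))) ^+ 2 <= cn (damp x (ys n) - damp x (ys n.+1)) ^+ 2.
  rewrite sqr_cn cReD cReN -sqrrN opprB lerDl; exact: sqr_ge0.
have dI x n : (Im (damp x (ys n.+1)) - Im (damp x (ys n))) ^+ 2 <= cn (damp x (ys n) - damp x (ys n.+1)) ^+ 2.
  rewrite sqr_cn cImD cImN -[leLHS]sqrrN opprB lerDr; exact: sqr_ge0.
have lR n : L1 (fun x => (Re (damp x (ys n.+1)) - Re (damp x (ys n))) ^+ 2).
  apply: (L1_le _ _ (ld n)).
    by apply: measurable_funX; apply: measurable_funB; [exact: (m n.+1).1|exact: (m n).1].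
  by move=> x; rewrite ger0_norm ?sqr_ge0.
have lI n : L1 (fun x => (Im (damp x (ys n.+1)) - Im (damp x (ys n))) ^+ 2).
  apply: (L1_le _ _ (ld n)).
    by apply: measurable_funX; apply: measurable_funB; [exact: (m n.+1).2|exact: (m n).2].
  by move=> x; rewrite ger0_norm ?sqr_ge0.
have [|n|D1 [l1 [lD1 ml1 b1 c1]]] := @L2_fast_cauchy (fun n x => Re (damp x (ys n))) 1 (fun n => (m n).1) _ lR.
- apply: (L1_le _ _ (L1_damp (p 0%N))); first by apply: measurable_funX; exact: (m 0%N).1.
  by move=> x; rewrite ger0_norm ?sqr_ge0// sqr_cn lerDl sqr_ge0.
- apply: le_trans (bd n); apply: le_Rintegral; [by []|exact: lR|exact: ld|by move=> x _; exact: dR].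
have [|n|D2 [l2 [lD2 ml2 b2 c2]]] := @L2_fast_cauchy (fun n x => Im (damp x (ys n))) 1 (fun n => (m n).2) _ lI.
- apply: (L1_le _ _ (L1_damp (p 0%N))); first by apply: measurable_funX; exact: (m 0%N).2.
  by move=> x; rewrite ger0_norm ?sqr_ge0// sqr_cn lerDr sqr_ge0.
- apply: le_trans (bd n); apply: le_Rintegral; [by []|exact: lI|exact: ld|by move=> x _; exact: dI].
exists ys, (fun x => D1 x + D2 x), l1, l2; split => //.
- exact: L1D.
- apply: ae_mono (ae_and b1 b2) => x [h1 h2] n; rewrite sqr_cn; apply: lerD; [exact: h1|exact: h2].
- exact: ae_and c1 c2.
Qed.

End sqrt_outer.
End completion.

(** * Boundary values *)
Section boundary.
Variable R : realType.
Local Notation mu := (@lebesgue_measure R).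
Local Notation C := R[i].
Local Notation Re := (@complex.Re R).
Local Notation Im := (@complex.Im R).
Implicit Types (t y x s : R).

(** Apply [poisson_repr] on the line of height [ys n] and pass to the limit by dominated
    convergence. *)
Lemma boundary_poisson (W W' : R -> R -> C) (ys : nat -> R) (g H : R -> R) :
  (forall b, holo 0 b W W') ->
  (forall a, 0 < a -> exists K, forall x y, a < y -> cn (W x y) <= K) ->
  (forall n, 0 < ys n) -> ys n @[n --> \oo] --> 0 ->
  measurable_fun setT g -> L1 H ->
  {ae mu, forall x, forall n, wt x * cn (W x (ys n)) <= H x} ->
  {ae mu, forall x, Re (W x (ys n)) @[n --> \oo] --> g x} ->
  Lw g /\ forall t y, 0 < y -> \int[mu]_x (pois t y x * g x) = pi * Re (W t y).
Proof.
move=> hW bW ys0 ysc mg lH dom lim.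
have mW n : measurable_fun setT (fun x => Re (W x (ys n))).
  by have [] := ccont_meas (holo_ccont (hW (ys n + 1)) (y := ys n) ltac:(by rewrite ys0 ltrDl/=)).
have lwg : Lw g.
  split => //.
  have [] := @dominated_cvgR R (fun n x => wt x * Re (W x (ys n))) (fun x => wt x * g x) H.
  - by move=> n; apply: measurable_funM => //; exact: measurable_wt.
  - by apply: measurable_funM => //; exact: measurable_wt.
  - by apply: ae_mono lim => x gx; exact: cvgMl_tmp.
  - by [].
  - apply: ae_mono dom => x Hx n; rewrite normrM (ger0_norm (wt_ge0 x)).
    by rewrite (le_trans _ (Hx n))// ler_wpM2l ?wt_ge0// Re_le.
  by [].
split => // t y y0.
have [] := @dominated_cvgR R (fun n x => pois t y x * Re (W x (ys n))) (fun x => pois t y x * g x)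
    (fun x => y * cmp `|t| y * H x).
- by move=> n; apply: measurable_funM => //; exact: measurable_pois.
- by apply: measurable_funM => //; exact: measurable_pois.
- by apply: ae_mono lim => x gx; exact: cvgMl_tmp.
- exact: L1Z.
- apply: ae_mono dom => x Hx n; rewrite normrM (ger0_norm (pois_ge0 t x y0)).
  have p1 := pois_le x y0 (lexx y) (lexx `|t|).
  apply: (@le_trans _ _ (y * cmp `|t| y * wt x * cn (W x (ys n)))).
    by apply: ler_pM => //; [exact: pois_ge0|exact: Re_le].
  by rewrite -(mulrA (y * _)) ler_wpM2l// mulr_ge0 ?(ltW y0)// ltW// cmp_gt0.
move=> _.
have -> : (fun n => \int[mu]_x (pois t y x * Re (W x (ys n)))) = fun n => pi * Re (W t (ys n + y)).
  apply/funext => n.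
  have yn0 := ys0 n.
  have yn2 : 0 < ys n / 2 by rewrite divr_gt0.
  have [K HK] := bW _ yn2.
  apply: (@poisson_repr _ (ys n / 2) W W' K) => //.
  - by move=> b; apply: holo_sub (hW b) => //; exact: ltW.
  - by rewrite ltr_pdivrMr// ltr_pMr// ltr1n.
move=> cI.
have cW : pi * Re (W t (ys n + y)) @[n --> \oo] --> pi * Re (W t y).
  apply: cvgMl_tmp.
  have yI : 0 < y < y + 1 by rewrite y0 ltrDl/=.
  have [c1 _] := holo_continuous_y t (hW (y + 1)) yI.
  apply: (@cvg_comp _ _ _ (fun n => ys n + y) (fun s => Re (W t s)) _ _ _ _ c1).
  have : ys n + y @[n --> \oo] --> 0 + y by apply: cvgD => //; exact: cvg_cst.
  by rewrite add0r.
exact: (cvg_unique _ cI cW).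
Qed.

(** A continuous determination of the argument converges when the point on the unit
    circle does: after subtracting a nearby value the argument stays in a half-turn,
    where it is an arcsine. *)
Lemma lift_cvg (b : R -> R) (c s : R) : (forall y, 0 < y -> {for y, continuous b}) ->
  c ^+ 2 + s ^+ 2 = 1 ->
  cos (b y) @[y --> (0:R)^'+] --> c -> sin (b y) @[y --> (0:R)^'+] --> s ->
  exists l : R, b y @[y --> (0:R)^'+] --> l.
Proof.
move=> cb cs1 cc ss.
have c1 : c * cos (b y) + s * sin (b y) @[y --> (0:R)^'+] --> (1 : R).
  rewrite -cs1 !expr2; apply: cvgD; exact: cvgMl_tmp.
have near1 : \forall y \near (0:R)^'+, 7 / 8 < c * cos (b y) + s * sin (b y).
  by apply: (cvgr_gt 1) => //; lra.
have nearc : \forall y \near (0:R)^'+, `|c - cos (b y)| < 1 / 8.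
  by move/cvgrPdist_lt : cc; apply; lra.
have nears : \forall y \near (0:R)^'+, `|s - sin (b y)| < 1 / 8.
  by move/cvgrPdist_lt : ss; apply; lra.
have [d /= d0 hd] : \forall y \near (0 : R)^'+, [/\ 7 / 8 < c * cos (b y) + s * sin (b y),
    `|c - cos (b y)| < 1 / 8 & `|s - sin (b y)| < 1 / 8].
  by near=> y; split; near: y.
pose y0 := d / 2.
have y00 : 0 < y0 by rewrite divr_gt0.
(* For small heights the argument stays within a half-turn of its value at [y0], where the
   sine determines it. *)
have D y : 0 < y -> y <= y0 -> 1 / 2 < cos (b y - b y0).
  move=> yp yy.
  have in_d z : 0 < z -> z <= y0 -> ball_ [eta Num.norm] 0 d z.
    by move=> z0 zy; rewrite /= sub0r normrN gtr0_norm// (le_lt_trans zy)// /y0 ltr_pdivrMr// ltr_pMr// ltr1n.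
  have [h1 _ _] := hd _ (in_d y yp yy) yp.
  have [_ h2 h3] := hd _ (in_d y0 y00 (lexx _)) y00.
  rewrite cosB.
  have e1 : `|(c - cos (b y0)) * cos (b y)| <= 1 / 8.
    by rewrite normrM -[leRHS]mulr1 ler_pM// ?(ltW h2)// cos_max.
  have e2 : `|(s - sin (b y0)) * sin (b y)| <= 1 / 8.
    by rewrite normrM -[leRHS]mulr1 ler_pM// ?(ltW h3)// sin_max.
  move: e1 e2; rewrite !ler_norml => /andP[_ e1] /andP[_ e2].
  move: h1 e1 e2; rewrite !mulrBl; lra.
pose g y := b y - b y0.
have cg y : 0 < y -> {for y, continuous g}.
  by move=> yp; apply: cvgB; [exact: cb|exact: cvg_cst].
have cpi : cos (pi / 2 : R) = 0 by exact: cos_pihalf.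
have small y : 0 < y -> y <= y0 -> - (pi / 2) < g y < pi / 2.
  move=> yp yy.
  have cont : {within `[y, y0], continuous g}.
    apply: continuous_in_subspaceT => z; rewrite inE/= in_itv/= => /andP[z1 _].
    by apply: cg; exact: lt_le_trans z1.
  have cont' : {within `[y, y0], continuous (fun z => - g z)}.
    apply: continuous_in_subspaceT => z; rewrite inE/= in_itv/= => /andP[z1 _].
    by apply: cvgN; apply: cg; exact: lt_le_trans z1.
  have g0 : g y0 = 0 by rewrite /g subrr.
  have pi2 : 0 < pi / 2 :> R by rewrite divr_gt0// pi_gt0.
  have noR z : 0 < z -> z <= y0 -> g z <> pi / 2.
    by move=> z0 zy E; have := D z z0 zy; rewrite -/(g z) E cpi; lra.
  have noL z : 0 < z -> z <= y0 -> - g z <> pi / 2.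
    by move=> z0 zy E; have := D z z0 zy; rewrite -/(g z) -cosN E cpi; lra.
  apply/andP; split; rewrite ltNge; apply/negP => hg.
    have bnd : Num.min (- g y) (- g y0) <= pi / 2 <= Num.max (- g y) (- g y0).
      by rewrite ge_min le_max g0 oppr0 (ltW pi2) orbT/= lerNr hg.
    have [z zI E] := @IVT _ (fun z => - g z) y y0 (pi / 2) yy cont' bnd.
    move: zI; rewrite in_itv/= => /andP[z1 z2].
    by apply: (noL z) => //; exact: lt_le_trans z1.
  have bnd : Num.min (g y) (g y0) <= pi / 2 <= Num.max (g y) (g y0).
    by rewrite ge_min le_max g0 (ltW pi2) orbT/= hg.
  have [z zI E] := @IVT _ g y y0 (pi / 2) yy cont bnd.
  move: zI; rewrite in_itv/= => /andP[z1 z2].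
  by apply: (noR z) => //; exact: lt_le_trans z1.
have sg : sin (g y) @[y --> (0:R)^'+] --> s * cos (b y0) - c * sin (b y0).
  rewrite /g; under eq_fun do rewrite sinB.
  by apply: cvgB; apply: cvgMr_tmp.
pose sl := s * cos (b y0) - c * sin (b y0).
have sl1 : -1 < sl < 1.
  have in0 : ball_ [eta Num.norm] 0 d y0.
    by rewrite /= sub0r normrN gtr0_norm// /y0 ltr_pdivrMr// ltr_pMr// ltr1n.
  have [h1 _ _] := hd _ in0 y00.
  have E : sl ^+ 2 = 1 - (c * cos (b y0) + s * sin (b y0)) ^+ 2.
    have := cos2Dsin2 (b y0); rewrite /sl => tr.
    transitivity ((c ^+ 2 + s ^+ 2) * (cos (b y0) ^+ 2 + sin (b y0) ^+ 2)
      - (c * cos (b y0) + s * sin (b y0)) ^+ 2); first by ring.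
    by rewrite tr cs1 mulr1.
  have : sl ^+ 2 < 1 by rewrite E; nra.
  by move=> ?; rewrite -ltr_norml -(ltr_pXn2r (n := 2)) ?nnegrE// real_normK ?num_real// expr1n.
exists (b y0 + asin sl).
have ca : asin (sin (g y)) @[y --> (0:R)^'+] --> asin sl.
  by apply: (@cvg_comp _ _ _ (fun y => sin (g y)) asin _ _ _ sg); exact: continuous_asin.
have : b y0 + asin (sin (g y)) @[y --> (0:R)^'+] --> b y0 + asin sl.
  by apply: cvgD; [exact: cvg_cst|exact: ca].
apply: cvg_trans; apply: near_eq_cvg; near=> y.
have yp : 0 < y by [].
have yy : y <= y0 by near: y; exact: nbhs_right_le.
have /andP[s1 s2] := small y yp yy.
rewrite sinK; first by rewrite /g addrC subrK.
by rewrite in_itv/= -mulNr !ltW// mulNr.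
Unshelve. all: end_near. Qed.

Section outer_boundary.
Variable h : R -> R.
Hypothesis lh : Lw h.
Let F x := expR (2 * h x).
Hypothesis lF : L1 F.

(** The outer function with boundary modulus [F]. *)
Definition outer2 t y : C := outer h t y * outer h t y.

Lemma outer2_holo b : exists W', holo 0 b outer2 W'.
Proof. by eexists; apply: holo_mul; exact: outer_holo lh b. Qed.

Lemma outer_bounded (a : R) : 0 < a -> exists K, forall x y, a < y -> cn (outer h x y) <= K.
Proof.
move=> a0; exists (Num.sqrt (\int[mu]_x F x / (pi * a))) => x y ay.
by apply: cn_outer_le => //; exact: ltW.
Qed.

Lemma cn_outer2 t y : cn (outer2 t y) = cn (outer h t y) ^+ 2.
Proof. by rewrite cnM expr2. Qed.

Lemma outer2_bounded (a : R) : 0 < a -> exists K, forall x y, a < y -> cn (outer2 x y) <= K.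
Proof.
move=> a0; exists (\int[mu]_x F x / (pi * a)) => x y ay.
by rewrite cn_outer2; apply: sqr_cn_outer_le => //; exact: ltW.
Qed.

Lemma outer_boundary_seq : exists (ys : nat -> R) (E sR sI : R -> R),
  [/\ (forall n, 0 < ys n <= 1) /\ ys n @[n --> \oo] --> 0,
   L1 E, measurable_fun setT sR /\ measurable_fun setT sI,
   {ae mu, forall x, forall n, wt x * cn (outer h x (ys n)) ^+ 2 <= E x} &
   {ae mu, forall x, Re (outer h x (ys n)) @[n --> \oo] --> sR x /\
                     Im (outer h x (ys n)) @[n --> \oo] --> sI x}].
Proof.
have [ys [D [lR [lI [[ysb ys0] lD [mR mI] bd lim]]]]] := damp_boundary_seq lh lF.
have yp n : 0 < ys n by case/andP: (ysb n).
(* Undo the division by [z + i]: on the boundary [s = (x + i) * d], and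
   [|z + i| ^ 2 <= 4 (1 + x ^ 2)] for heights at most 1. *)
exists ys, (fun x => 4 * D x), (fun x => lR x * x - lI x), (fun x => lR x + lI x * x).
have oE x y : 0 < y -> outer h x y = damp h x y * (Complex x y - Complex 0 (-1)).
  move=> y0; rewrite /damp divfK//; apply/eqP => /(congr1 Im) /= /eqP.
  by rewrite opprK gt_eqF// addr_gt0.
split => //.
- exact: L1Z.
- split.
    by apply: measurable_funB => //; exact: measurable_funM.
  by apply: measurable_funD => //; exact: measurable_funM.
- apply: ae_mono bd => x bx n.
  rewrite (oE _ _ (yp n)) cnM exprMn sqr_cn_pole.
  have w0 := oneDsq_gt0 x; have /andP[y0 y1] := ysb n.
  have h1 : x ^+ 2 + (ys n + 1) ^+ 2 <= 4 * (1 + x ^+ 2).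
    have : (ys n + 1) ^+ 2 <= 2 ^+ 2 by rewrite lerXn2r// ?nnegrE; lra.
    by have := sqr_ge0 x; lra.
  rewrite mulrCA mulrC; apply: (@le_trans _ _ (4 * cn (damp h x (ys n)) ^+ 2)).
    by rewrite ler_wpM2r ?sqr_ge0// /wt mulrC ler_pdivrMr.
  by rewrite ler_wpM2l.
- apply: ae_mono lim => x [l1 l2].
  have yc : ys n + 1 @[n --> \oo] --> (1 : R).
    have : ys n + 1 @[n --> \oo] --> 0 + (1 : R) by apply: cvgD => //; exact: cvg_cst.
    by rewrite add0r.
  split.
  + rewrite (_ : (fun n => _) = fun n => Re (damp h x (ys n)) * x - Im (damp h x (ys n)) * (ys n + 1)).
      rewrite -[X in _ --> _ - X]mulr1; apply: cvgB; first exact: cvgMr_tmp.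
      exact: cvgM.
    by apply/funext => n; rewrite oE// cReM /= subr0 opprK.
  + rewrite (_ : (fun n => _) = fun n => Re (damp h x (ys n)) * (ys n + 1) + Im (damp h x (ys n)) * x).
      rewrite -[X in _ --> X + _]mulr1; apply: cvgD; last exact: cvgMr_tmp.
      exact: cvgM.
    by apply/funext => n; rewrite oE// cImM /= subr0 opprK.
Qed.

(** The bound on [outer2] dominates [wt * outer] as well, since [|s| <= 1 + |s| ^ 2].
    The imaginary parts are obtained by applying [boundary_poisson] to [- i W]. *)
Lemma outer_boundary : exists (ys : nat -> R) (E sR sI : R -> R),
  [/\ (forall n, 0 < ys n <= 1) /\ ys n @[n --> \oo] --> 0,
   L1 E,
   {ae mu, forall x, forall n, wt x * cn (outer2 x (ys n)) <= E x},
   {ae mu, forall x, Re (outer2 x (ys n)) @[n --> \oo] --> sR x ^+ 2 - sI x ^+ 2 /\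
                     Im (outer2 x (ys n)) @[n --> \oo] --> 2 * (sR x * sI x)} &
   [/\ Lw sR /\ (forall t y, 0 < y -> \int[mu]_x (pois t y x * sR x) = pi * Re (outer h t y)),
     Lw sI /\ (forall t y, 0 < y -> \int[mu]_x (pois t y x * sI x) = pi * Im (outer h t y)),
     (forall t y, 0 < y -> \int[mu]_x (pois t y x * (sR x ^+ 2 - sI x ^+ 2)) = pi * Re (outer2 t y)) &
     (forall t y, 0 < y -> \int[mu]_x (pois t y x * (2 * (sR x * sI x))) = pi * Im (outer2 t y))]].
Proof.
have [ys [E [sR [sI [[ysb ys0] lE [mR mI] bd lim]]]]] := outer_boundary_seq.
have yp n : 0 < ys n by case/andP: (ysb n).
have lim2 : {ae mu, forall x, Re (outer2 x (ys n)) @[n --> \oo] --> sR x ^+ 2 - sI x ^+ 2 /\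
                     Im (outer2 x (ys n)) @[n --> \oo] --> 2 * (sR x * sI x)}.
  apply: ae_mono lim => x [l1 l2]; split.
    rewrite (_ : (fun n => _) = fun n => Re (outer h x (ys n)) * Re (outer h x (ys n)) - Im (outer h x (ys n)) * Im (outer h x (ys n))).
      by rewrite !expr2; apply: cvgB; exact: cvgM.
    by apply/funext => n; rewrite cReM.
  rewrite (_ : (fun n => _) = fun n => 2 * (Re (outer h x (ys n)) * Im (outer h x (ys n)))).
    by apply: cvgMl_tmp; exact: cvgM.
  by apply/funext => n; rewrite cImM; ring.
have bd2 : {ae mu, forall x, forall n, wt x * cn (outer2 x (ys n)) <= E x}.
  by apply: ae_mono bd => x bx n; rewrite cn_outer2.
have bd1 : {ae mu, forall x, forall n, wt x * cn (outer h x (ys n)) <= wt x + E x}.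
  apply: ae_mono bd => x bx n; apply: (@le_trans _ _ (wt x + wt x * cn (outer h x (ys n)) ^+ 2)).
    rewrite -{2}[wt x]mulr1 -mulrDr ler_wpM2l ?wt_ge0//.
    by have := sqr_ge0 (cn (outer h x (ys n)) - 1); have := cn_ge0 (outer h x (ys n)); nra.
  by rewrite lerD2l.
have lE1 : L1 (fun x => wt x + E x) by apply: L1D => //; exact: L1_wt.
have Imi z : Re (- (ci R) * z) = Im z by rewrite mulNr cReN Re_ci opprK.
have cni z : cn (- (ci R) * z) = cn z by rewrite cnM cnN cn_ci mul1r.
have holoi (W W' : R -> R -> C) b : holo 0 b W W' -> holo 0 b (fun t y => - ci R * W t y) (fun t y => 0 * W t y + - ci R * W' t y).
  by move=> hW; exact: holo_mul (holo_cst 0 b (- ci R)) hW.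
pose o' := fun t y => pw' h t y * outer h t y.
have ho b : holo 0 b (outer h) o' := outer_holo lh b.
have ho2 b := holo_mul (ho b) (ho b).
exists ys, E, sR, sI; split => //; split.
- apply: (boundary_poisson ho outer_bounded yp ys0 mR lE1 bd1).
  by apply: ae_mono lim => x [].
- have [] := boundary_poisson (W := fun t y => - ci R * outer h t y) (fun b => holoi _ _ b (ho b)) _ yp ys0 mI lE1.
  + by move=> a /outer_bounded[K HK]; exists K => x y ay; rewrite cni; exact: HK.
  + by apply: ae_mono bd1 => x bx n; rewrite cni.
  + by apply: ae_mono lim => x [_ l2]; under eq_fun do rewrite Imi.
  by move=> l P; split => // t y y0; rewrite P// Imi.
- have [||_ P] := boundary_poisson (W := outer2) (g := fun x => sR x ^+ 2 - sI x ^+ 2) ho2 outer2_bounded yp ys0 _ lE bd2.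
  + by apply: measurable_funB; apply: measurable_funX.
  + by apply: ae_mono lim2 => x [].
  exact: P.
- have [] := boundary_poisson (W := fun t y => - ci R * outer2 t y) (g := fun x => 2 * (sR x * sI x)) (fun b => holoi _ _ b (ho2 b)) _ yp ys0 _ lE.
  + by move=> a /outer2_bounded[K HK]; exists K => x y ay; rewrite cni; exact: HK.
  + by apply: measurable_funM => //; exact: measurable_funM.
  + by apply: ae_mono bd2 => x bx n; rewrite cni.
  + by apply: ae_mono lim2 => x [_ l2]; under eq_fun do rewrite Imi.
  by move=> l P t y y0; rewrite P// Imi.
Qed.

Lemma poisson_cvg_eq g (G : R -> R) t : Lw g -> lebpt g t ->
  (forall y, 0 < y -> \int[mu]_x (pois t y x * g x) = pi * G y) ->
  G y @[y --> (0:R)^'+] --> g t.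
Proof.
move=> lg pt e; apply: cvg_trans (poisson_cvg lg pt); apply: near_eq_cvg; near=> y.
by rewrite e// mulrA mulVf ?mul1r// gt_eqF// pi_gt0.
Unshelve. all: end_near. Qed.

(** By the Poisson formula, [outer] converges along almost every vertical line, and its
    modulus tends to [expR h], which is not zero. Hence its argument [pB] converges. *)
Lemma outer_arg (sR sI : R -> R) : Lw sR -> Lw sI ->
  (forall t y, 0 < y -> \int[mu]_x (pois t y x * sR x) = pi * Re (outer h t y)) ->
  (forall t y, 0 < y -> \int[mu]_x (pois t y x * sI x) = pi * Im (outer h t y)) ->
  {ae mu, forall t, exists b : R,
    [/\ pB h t y @[y --> (0:R)^'+] --> b, sR t = expR (h t) * cos b & sI t = expR (h t) * sin b]}.
Proof.
move=> lR lI PR PI.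
apply: ae_mono (ae_and (lebesgue_poisson lh) (ae_and (lebesgue_poisson lR) (lebesgue_poisson lI))) => t [ph [pR pI]].
have cA : pA h t y @[y --> (0:R)^'+] --> h t by exact: poisson_cvg.
have cR := poisson_cvg_eq lR pR (PR t).
have cI := poisson_cvg_eq lI pI (PI t).
have cE : expR (- pA h t y) @[y --> (0:R)^'+] --> expR (- h t).
  apply: (@cvg_comp _ _ _ (fun y => - pA h t y) expR _ _ _ _ (@continuous_expR R (- h t))).
  exact: cvgN.
have e1 : expR (- h t) * expR (h t) = 1 by rewrite -expRD addrC subrr expR0.
have cc : cos (pB h t y) @[y --> (0:R)^'+] --> expR (- h t) * sR t.
  rewrite (_ : (fun y => cos (pB h t y)) = fun y => expR (- pA h t y) * Re (outer h t y)).
    exact: cvgM.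
  by apply/funext => y; rewrite /= mulrA -expRD addrC subrr expR0 mul1r.
have cs : sin (pB h t y) @[y --> (0:R)^'+] --> expR (- h t) * sI t.
  rewrite (_ : (fun y => sin (pB h t y)) = fun y => expR (- pA h t y) * Im (outer h t y)).
    exact: cvgM.
  by apply/funext => y; rewrite /= mulrA -expRD addrC subrr expR0 mul1r.
have one : (expR (- h t) * sR t) ^+ 2 + (expR (- h t) * sI t) ^+ 2 = 1.
  have c1 : cos (pB h t y) ^+ 2 + sin (pB h t y) ^+ 2 @[y --> (0:R)^'+] -->
      (expR (- h t) * sR t) ^+ 2 + (expR (- h t) * sI t) ^+ 2.
    by rewrite !expr2; under eq_fun do rewrite !expr2; apply: cvgD; exact: cvgM.
  have c2 : cos (pB h t y) ^+ 2 + sin (pB h t y) ^+ 2 @[y --> (0:R)^'+] --> (1 : R).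
    by under eq_fun do rewrite cos2Dsin2; exact: cvg_cst.
  exact: (cvg_unique _ c1 c2).
have cont y : 0 < y -> {for y, continuous (pB h t)}.
  move=> y0; have [_ d] := pw_y lh t y0; exact: is_derive_cont d.
have [b cb] := lift_cvg cont one cc cs.
exists b; split => //.
- have cc' : cos (pB h t y) @[y --> (0:R)^'+] --> cos b.
    by apply: (@cvg_comp _ _ _ (fun y => pB h t y) cos _ _ _ cb); exact: continuous_cos.
  have <- : expR (- h t) * sR t = cos b by exact: (cvg_unique _ cc cc').
  by rewrite mulrA (mulrC (expR (h t))) e1 mul1r.
- have cs' : sin (pB h t y) @[y --> (0:R)^'+] --> sin b.
    by apply: (@cvg_comp _ _ _ (fun y => pB h t y) sin _ _ _ cb); exact: continuous_sin.
  have <- : expR (- h t) * sI t = sin b by exact: (cvg_unique _ cs cs').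
  by rewrite mulrA (mulrC (expR (h t))) e1 mul1r.
Qed.

(** The truncated integrals of [2 * h] and [2 pi] times [pB h] have the same limit, namely
    [pi] times the argument of the square of the boundary function of [outer]. *)
Lemma hilbert_transform_boundary (sR sI : R -> R) : Lw sR -> Lw sI ->
  (forall t y, 0 < y -> \int[mu]_x (pois t y x * sR x) = pi * Re (outer h t y)) ->
  (forall t y, 0 < y -> \int[mu]_x (pois t y x * sI x) = pi * Im (outer h t y)) ->
  {ae mu, forall t, let H := hilbert_transform (fun x => 2 * h x) t in
    F t * cos H = sR t ^+ 2 - sI t ^+ 2 /\ F t * sin H = 2 * (sR t * sI t)}.
Proof.
move=> lR lI PR PI.
have lu : Lw (fun x => 2 * h x).
  have [m1 l1] := lh; split; first exact: measurable_funM.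
  rewrite (_ : (fun x => _) = fun x => 2 * (wt x * h x)); first exact: L1Z.
  by apply/funext => x; ring.
apply: ae_mono (ae_and (lebesgue_poisson lu) (outer_arg lR lI PR PI)) => t [pu [b [cb eR eI]]].
have ct : truncp (fun x => 2 * h x) y t @[y --> (0:R)^'+] --> pi * (2 * b).
  have c1 := conjp_truncp lu pu.
  have c2 : conjp (fun x => 2 * h x) y t @[y --> (0:R)^'+] --> pi * (2 * b).
    have : pi * (2 * pB h t y) @[y --> (0:R)^'+] --> pi * (2 * b).
      by apply: cvgMl_tmp; exact: cvgMl_tmp.
    apply: cvg_trans; apply: near_eq_cvg; near=> y.
    rewrite /pB mulrCA (mulrA pi) mulfV ?mul1r ?gt_eqF ?pi_gt0//.
    rewrite /conjp -integralZ; last exact: L1_qker.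
    by apply: eq_Rintegral => x _; ring.
  rewrite (_ : (fun y => truncp _ y t) = fun y => conjp (fun x => 2 * h x) y t -
      (conjp (fun x => 2 * h x) y t - truncp (fun x => 2 * h x) y t)); last first.
    by apply/funext => y; rewrite subKr.
  by rewrite -[X in _ --> X]subr0; apply: cvgB.
have HE : hilbert_transform (fun x => 2 * h x) t = 2 * b.
  rewrite /hilbert_transform.
  have -> : (fun e : R => \int[mu]_(x in [set x : R | e < `|x - t|])
      (((t - x)^-1 + x / (1 + x ^+ 2)) * (2 * h x))) = fun e => truncp (fun x => 2 * h x) e t.
    by apply/funext => e; rewrite (truncpE (fun x => 2 * h x)).
  have -> : lim (truncp (fun x => 2 * h x) e t @[e --> (0:R)^'+]) = pi * (2 * b).
    exact: cvg_lim ct.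
  by rewrite mulKf// gt_eqF// pi_gt0.
rewrite HE /= /F eR eI.
have -> : expR (2 * h t) = expR (h t) ^+ 2 by rewrite expRM_natl.
have -> : 2 * b = b + b by ring.
by rewrite cosD sinD; split; ring.
Unshelve. all: end_near. Qed.

(** ** Vanishing moments *)

(** The factor [i r / (z + i r)] is bounded by 1, decays at infinity in the upper half-plane,
    and tends to 1 as [r] tends to infinity. *)
Definition qdamp (r x y : R) : C := Complex 0 r * (Complex x y - Complex 0 (- r))^-1.

Lemma qdamp_holo (r b : R) : 1 <= r -> exists q', holo (- 1) b (qdamp r) q'.
Proof.
move=> r1; eexists; apply: holo_mul; first exact: holo_cst.
by apply: holo_inv => /=; rewrite lerN2 r1.
Qed.

Lemma sqr_cn_qdamp (r x y : R) : 1 <= r -> 0 <= y ->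
  cn (qdamp r x y) ^+ 2 = r ^+ 2 / (x ^+ 2 + (y + r) ^+ 2).
Proof.
move=> r1 y0; rewrite cnM cnV exprMn exprVn !sqr_cn /= expr0n add0r.
by rewrite subr0 opprK.
Qed.

Lemma qdamp_le1 (r x y : R) : 1 <= r -> 0 <= y -> cn (qdamp r x y) <= 1.
Proof.
move=> r1 y0; rewrite -(ler_pXn2r (n := 2)) ?nnegrE ?cn_ge0// sqr_cn_qdamp// expr1n.
have d0 : 0 < x ^+ 2 + (y + r) ^+ 2 by apply: den_gt0; lra.
by rewrite ler_pdivrMr// mul1r; have := sqr_ge0 x; nra.
Qed.

Lemma qdamp_sqr_le (r x y : R) : 1 <= r -> 0 <= y -> cn (qdamp r x y) ^+ 2 <= r ^+ 2 * wt x.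
Proof.
move=> r1 y0; rewrite sqr_cn_qdamp// ler_pM2l ?exprn_gt0//; last by lra.
have d0 : 0 < x ^+ 2 + (y + r) ^+ 2 by apply: den_gt0; lra.
by rewrite /wt lef_pV2 ?posrE ?oneDsq_gt0//; have := sqr_ge0 x; nra.
Qed.

Lemma qdamp_cvg1 (x : R) : Re (qdamp n.+1%:R x 0) @[n --> \oo] --> (1 : R) /\
  Im (qdamp n.+1%:R x 0) @[n --> \oo] --> (0 : R).
Proof.
have c0 := @cvg_harmonic R.
have c1 : x * n.+1%:R^-1 @[n --> \oo] --> (0 : R).
  by rewrite -(mulr0 x); apply: cvgMl_tmp.
have c2 : (x * n.+1%:R^-1) ^+ 2 @[n --> \oo] --> (0 : R).
  by under eq_fun do rewrite expr2; rewrite -(mulr0 0); exact: cvgM.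
have c3 : (1 + (x * n.+1%:R^-1) ^+ 2)^-1 @[n --> \oo] --> (1 : R).
  rewrite -[X in _ --> X]invr1; apply: cvgV => //.
  by rewrite -[X in _ --> X]addr0; apply: cvgD => //; exact: cvg_cst.
have E n : qdamp n.+1%:R x 0 = Complex ((1 + (x * n.+1%:R^-1) ^+ 2)^-1)
    ((x * n.+1%:R^-1) * (1 + (x * n.+1%:R^-1) ^+ 2)^-1).
  have n0 : (n.+1%:R : R) != 0 by rewrite pnatr_eq0.
  have d0 : x ^+ 2 + n.+1%:R ^+ 2 != 0 by rewrite gt_eqF// den_gt0// ltr0n.
  rewrite /qdamp; move: (n.+1%:R : R) n0 d0 => m n0 d0.
  have -> : 1 + (x / m) ^+ 2 = (x ^+ 2 + m ^+ 2) / m ^+ 2 by field.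
  by apply: ceqP; rewrite ?cReM ?cImM cReV cImV /= subr0 opprK add0r; field; rewrite n0 d0.
split.
- by under eq_fun do rewrite E.
- under eq_fun do rewrite E /=.
  by rewrite -(mul0r 1); exact: cvgM.
Qed.

Lemma cvg_complexM (u v : nat -> C) (a b c d : R) :
  Re (u n) @[n --> \oo] --> a -> Im (u n) @[n --> \oo] --> b ->
  Re (v n) @[n --> \oo] --> c -> Im (v n) @[n --> \oo] --> d ->
  Re (u n * v n) @[n --> \oo] --> a * c - b * d /\ Im (u n * v n) @[n --> \oo] --> a * d + b * c.
Proof.
move=> ua ub vc vd; split.
- by under eq_fun do rewrite cReM; apply: cvgB; exact: cvgM.
- by under eq_fun do rewrite cImM; apply: cvgD; exact: cvgM.
Qed.

Lemma cvg_complexX (u : nat -> C) m : Re (u n) @[n --> \oo] --> (1 : R) ->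
  Im (u n) @[n --> \oo] --> (0 : R) ->
  Re (u n ^+ m) @[n --> \oo] --> (1 : R) /\ Im (u n ^+ m) @[n --> \oo] --> (0 : R).
Proof.
move=> u1 u0; elim: m => [|m [IH1 IH2]].
  by split; under eq_fun do rewrite expr0; exact: cvg_cst.
have [h1 h2] := cvg_complexM u1 u0 IH1 IH2.
split.
- by under eq_fun do rewrite exprS; move: h1; rewrite mulr1 mulr0 subr0.
- by under eq_fun do rewrite exprS; move: h2; rewrite mulr0 mul0r addr0.
Qed.

Lemma holo_pow a b (W W' : R -> R -> C) m : holo a b W W' -> exists V, holo a b (fun t y => W t y ^+ m) V.
Proof.
move=> hW; elim: m => [|m [V IH]].
  exists (fun _ _ => 0); apply: holo_ext (holo_cst a b 1) _ _ => // t y; by rewrite expr0.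
eexists; apply: (@holo_ext _ _ _ _ _ _ _ (holo_mul hW IH)) => // t y; by rewrite exprS.
Qed.

(** The integral of [M * outer2] over the line of height [y] does not depend on [y], and
    it is bounded by a multiple of [1 / y], so it is 0; let [y] tend to 0. *)
Lemma outer2_orth_decaying (ys : nat -> R) (E pR pI : R -> R) (M : R -> R -> C) (K : R) :
  (forall n, 0 < ys n <= 1) -> ys n @[n --> \oo] --> 0 -> L1 E ->
  measurable_fun setT pR -> measurable_fun setT pI ->
  {ae mu, forall x, forall n, wt x * cn (outer2 x (ys n)) <= E x} ->
  {ae mu, forall x, Re (outer2 x (ys n)) @[n --> \oo] --> pR x /\
                    Im (outer2 x (ys n)) @[n --> \oo] --> pI x} ->
  (forall b, exists M', holo (- 1) b M M') ->
  (forall x y, 0 <= y -> cn (M x y) <= K * wt x) ->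
  \int[mu]_x (Re (M x 0) * pR x - Im (M x 0) * pI x) = 0.
Proof.
move=> ysb ys0 lE mR mI bd lim hM bM.
have yp n : 0 < ys n by case/andP: (ysb n).
pose W t y := M t y * outer2 t y.
have hW b : exists W', holo 0 b W W'.
  have [M' h1] := hM b; have [V h2] := outer2_holo b.
  have h1' : holo 0 b M M' by apply: holo_sub h1.
  by eexists; exact: holo_mul h1' h2.
have K0 : 0 <= K.
  have := bM 0 0 (lexx _); have := cn_ge0 (M 0 0) => /le_trans/[apply].
  by rewrite pmulr_lge0 ?wt_gt0.
pose I0 := \int[mu]_x F x.
have I00 : 0 <= I0 by apply: Rintegral_ge0 => x _; exact: expR_ge0.
have bW (s : R) x y : 0 < s -> s <= y -> cn (W x y) <= K * (I0 / (pi * s)) * wt x.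
  move=> s0 sy; rewrite cnM cn_outer2 mulrAC ler_pM ?cn_ge0 ?sqr_ge0//.
    by apply: bM; rewrite (le_trans (ltW s0)).
  exact: sqr_cn_outer_le.
have mWy y : 0 < y -> measurable_fun setT (fun x => Re (W x y)).
  move=> y0; have [W' hW'] := hW (y + 1).
  by have [] := ccont_meas (holo_ccont hW' (y := y) ltac:(by rewrite y0 ltrDl/=)).
have lWy y : 0 < y -> L1 (fun x => Re (W x y)).
  move=> y0; apply: (@L1_le _ _ (fun x => K * (I0 / (pi * y)) * wt x)); first exact: mWy.
    by move=> x; rewrite (le_trans (Re_le _))// bW.
  by apply: L1Z; exact: L1_wt.
have cst y y' : 0 < y -> y < y' -> \int[mu]_x Re (W x y) = \int[mu]_x Re (W x y').
  move=> y0 yy; have [W' hW'] := hW (y' + 1).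
  have y20 : 0 < y / 2 by rewrite divr_gt0.
  have hW2 : holo (y / 2) (y' + 1) W W' by apply: holo_sub hW' => //; exact: ltW.
  apply: (cauchy_line hW2 (K := K * (I0 / (pi * (y / 2))))) => //.
  - by move=> x v /andP[/ltW v1 _]; exact: bW.
  - by rewrite ltr_pdivrMr// ltr_pMr// ltr1n.
  - by rewrite ltrDl.
have zero y : 0 < y -> \int[mu]_x Re (W x y) = 0.
  move=> y0.
  have bnd v : y < v -> `|\int[mu]_x Re (W x y)| <= K * I0 / v.
    move=> yv; have v0 : 0 < v by exact: lt_trans yv.
    rewrite (cst _ _ y0 yv); apply: (le_trans (le_normr_Rintegral _ _)) => //; first exact: lWy.
    have -> : K * I0 / v = \int[mu]_x (K * (I0 / (pi * v)) * wt x).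
      rewrite integralZ; last exact: L1_wt.
      have -> : \int[mu]_x wt x = pi by rewrite -(int_pois 0 ltr01); apply: eq_Rintegral => x _; exact: wt_pois.
      have p0 : (pi : R) != 0 by rewrite gt_eqF// pi_gt0.
      have v1 : v != 0 by rewrite gt_eqF.
      have E0 (p : R) : p != 0 -> K * I0 / v = K * (I0 / (p * v)) * p.
        by move=> p1; field; rewrite v1 p1.
      exact: E0.
    apply: le_Rintegral => //; [exact: L1_norm (lWy _ v0)|by apply: L1Z; exact: L1_wt|].
    by move=> x _; rewrite (le_trans (Re_le _))// bW.
  apply/eqP; rewrite -normr_eq0 eq_le normr_ge0 andbT leNgt; apply/negP => Ip.
  have c0 : 0 <= K * I0 by rewrite mulr_ge0.
  have v1 : y < K * I0 / `|\int[mu]_x Re (W x y)| + y + 1.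
    rewrite -addrA; apply: ltr_wpDl; first by rewrite divr_ge0.
    by rewrite ltrDl.
  have := bnd _ v1; rewrite ler_pdivlMr; last by rewrite (lt_trans y0).
  rewrite !mulrDr mulrC divfK ?gt_eqF// mulr1 -addrA gerDl leNgt.
  by rewrite addr_gt0// mulr_gt0.
have [] := @dominated_cvgR R (fun n x => Re (W x (ys n))) (fun x => Re (M x 0) * pR x - Im (M x 0) * pI x)
   (fun x => K * E x).
- by move=> n; exact: mWy.
- have [M' h1] := hM 1.
  have [m1 m2] := ccont_meas (holo_ccont h1 (y := 0) ltac:(by rewrite ltrN10 ltr01)).
  by apply: measurable_funB; apply: measurable_funM.
- apply: ae_mono lim => x [l1 l2].
  have [M' h1] := hM 1.
  have [c1 c2] := holo_continuous_y x h1 (y := 0) ltac:(by rewrite ltrN10 ltr01).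
  have d1 : Re (M x (ys n)) @[n --> \oo] --> Re (M x 0).
    by apply: (@cvg_comp _ _ _ ys (fun s => Re (M x s)) _ _ _ ys0 c1).
  have d2 : Im (M x (ys n)) @[n --> \oo] --> Im (M x 0).
    by apply: (@cvg_comp _ _ _ ys (fun s => Im (M x s)) _ _ _ ys0 c2).
  exact: (cvg_complexM d1 d2 l1 l2).1.
- exact: L1Z.
- apply: ae_mono bd => x bx n; apply: (le_trans (Re_le _)); rewrite cnM.
  apply: (@le_trans _ _ (K * wt x * cn (outer2 x (ys n)))).
    by rewrite ler_wpM2r ?cn_ge0// bM// ltW.
  by rewrite -mulrA ler_wpM2l.
move=> _.
have -> : (fun n => \int[mu]_x Re (W x (ys n))) = fun=> 0.
  by apply/funext => n; exact: zero.
move=> c; have c0 : (0 : R) @[_ --> \oo] --> (0 : R) by exact: cvg_cst.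
by have := cvg_unique _ c c0; apply.
Qed.

(** Multiply [N] by [qdamp r ^ (m + 2)]: the power [m] compensates the growth of [N], and the
    power 2 gives the decay [wt]. Then let [r] tend to infinity. *)
Lemma outer2_orth (ys : nat -> R) (E pR pI : R -> R) (N : R -> R -> C) (m : nat) :
  (forall n, 0 < ys n <= 1) -> ys n @[n --> \oo] --> 0 -> L1 E ->
  measurable_fun setT pR -> measurable_fun setT pI ->
  {ae mu, forall x, forall n, wt x * cn (outer2 x (ys n)) <= E x} ->
  {ae mu, forall x, Re (outer2 x (ys n)) @[n --> \oo] --> pR x /\
                    Im (outer2 x (ys n)) @[n --> \oo] --> pI x} ->
  (forall b, exists N', holo (- 1) b N N') ->
  (forall r, 1 <= r -> exists K, forall x y, 0 <= y -> cn (N x y * qdamp r x y ^+ m) <= K) ->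
  {ae mu, forall x, `|pR x| + `|pI x| <= 2 * F x} ->
  L1 (fun x => cn (N x 0) * F x) ->
  \int[mu]_x (Re (N x 0) * pR x - Im (N x 0) * pI x) = 0.
Proof.
move=> ysb ys0 lE mR mI bd lim hN bN pF lN.
pose M n x y := N x y * qdamp n.+1%:R x y ^+ (m + 2).
have r1 n : 1 <= n.+1%:R :> R by rewrite ler1n.
have z n : \int[mu]_x (Re (M n x 0) * pR x - Im (M n x 0) * pI x) = 0.
  have [K HK] := bN _ (r1 n).
  apply: (@outer2_orth_decaying ys E pR pI (M n) (K * n.+1%:R ^+ 2) ysb ys0 lE mR mI bd lim).
  - move=> b; have [N' hN'] := hN b; have [q' hq] := qdamp_holo b (r1 n).
    have [V hV] := holo_pow (m + 2) hq.
    by eexists; exact: holo_mul hN' hV.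
  - move=> x y y0; rewrite /M exprD mulrA cnM [cn (_ ^+ 2)]cnX -mulrA.
    by apply: ler_pM; rewrite ?cn_ge0 ?sqr_ge0 ?HK// qdamp_sqr_le.
have measN : measurable_fun setT (fun x => Re (N x 0)) /\ measurable_fun setT (fun x => Im (N x 0)).
  have [N' hN'] := hN 1.
  by apply: ccont_meas (holo_ccont hN' _); rewrite ltrN10 ltr01.
have measM n : measurable_fun setT (fun x => Re (M n x 0)) /\ measurable_fun setT (fun x => Im (M n x 0)).
  have [N' hN'] := hN 1; have [q' hq] := qdamp_holo 1 (r1 n).
  have [V hV] := holo_pow (m + 2) hq.
  by apply: ccont_meas (holo_ccont (holo_mul hN' hV) _); rewrite ltrN10 ltr01.
have [] := @dominated_cvgR R (fun n x => Re (M n x 0) * pR x - Im (M n x 0) * pI x)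
   (fun x => Re (N x 0) * pR x - Im (N x 0) * pI x) (fun x => 2 * (cn (N x 0) * F x)).
- by move=> n; have [m1 m2] := measM n; apply: measurable_funB; apply: measurable_funM.
- by have [m1 m2] := measN; apply: measurable_funB; apply: measurable_funM.
- apply: aeW => x; have [q1 q2] := qdamp_cvg1 x.
  have [q3 q4] := cvg_complexX (m + 2) q1 q2.
  have cc (a : R) : a @[_ --> \oo] --> a by exact: cvg_cst.
  have [h1 h2] := cvg_complexM (u := fun=> N x 0) (cc (Re (N x 0))) (cc (Im (N x 0))) q3 q4.
  rewrite mulr1 mulr0 subr0 in h1; rewrite mulr0 mulr1 add0r in h2.
  by apply: cvgB; apply: cvgMr_tmp.
- exact: L1Z.
- apply: ae_mono pF => x pFx n; apply: (le_trans (ler_normB _ _)); rewrite !normrM.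
  have MN : cn (M n x 0) <= cn (N x 0).
    by rewrite cnM cnX ler_piMr ?cn_ge0// exprn_ile1 ?cn_ge0// qdamp_le1.
  apply: (@le_trans _ _ (cn (N x 0) * `|pR x| + cn (N x 0) * `|pI x|)).
    by apply: lerD; rewrite ler_wpM2r// (le_trans _ MN)// ?Re_le ?Im_le.
  by rewrite -mulrDr mulrCA ler_wpM2l ?cn_ge0.
move=> _; have -> : (fun n => \int[mu]_x (Re (M n x 0) * pR x - Im (M n x 0) * pI x)) = fun=> 0.
  by apply/funext => n; exact: z.
move=> c; have c0 : (0 : R) @[_ --> \oo] --> (0 : R) by exact: cvg_cst.
by have := cvg_unique _ c c0; apply.
Qed.

End outer_boundary.
End boundary.

(** * Measurability of the Hilbert transform *)
Section hilbert_measurable.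
Variable R : realType.
Local Notation mu := (@lebesgue_measure R).
Implicit Types (t x e : R) (u : R -> R).

(** Real integrals are differences of the integrals of the positive and negative parts, to
    which Tonelli's theorem applies without any integrability. *)
Lemma measurable_Rintegral_param (k : measurableTypeR R * measurableTypeR R -> R) :
  measurable_fun setT k ->
  measurable_fun setT (fun t => \int[mu]_x k (t, x)).
Proof.
move=> mk; have mK : measurable_fun setT (EFin \o k) by exact/measurable_EFinP.
rewrite (_ : (fun t => _) = fine \o (fun t => (fubini_F mu (EFin \o k)^\+ t - fubini_F mu (EFin \o k)^\- t)%E)).
  apply: measurableT_comp; first exact: fine_measurable.
  apply: emeasurable_funB; apply: measurable_fun_fubini_tonelli_F => //.
  - exact: measurable_funepos.
  - exact: measurable_funeneg.
apply/funext => t /=; rewrite /Rintegral integralE /fubini_F; congr (fine (_ - _)).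
- by apply: eq_integral => x _; rewrite ?funeposE ?funenegE.
- by apply: eq_integral => x _; rewrite ?funeposE ?funenegE.
Qed.

Lemma measurable_truncp u e : measurable_fun setT u -> measurable_fun setT (truncp u e).
Proof.
move=> mu_; apply: (@measurable_Rintegral_param (fun z => tker z.1 e z.2 * u z.2)).
apply: measurable_funM; first exact: measurable_tker_comp.
by apply: (measurableT_comp mu_).
Qed.

(** Truncation is at distances strictly larger than [e]; so the truncated kernel is right
    continuous in [e] at every [x]. *)
Lemma truncp_right_cvg u e t : Lw u -> 0 < e -> truncp u s t @[s --> e^'+] --> truncp u e t.
Proof.
move=> lu e0; apply/cvg_at_rightP => s [es se].
have [] := @dominated_cvgR R (fun n x => tker t (s n) x * u x) (fun x => tker t e x * u x)
  (fun x => `|tker t e x * u x|).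
- by move=> n; apply: measurable_funM; [exact: measurable_tker|case: lu].
- by apply: measurable_funM; [exact: measurable_tker|case: lu].
- apply: aeW => x; apply: cvgMr_tmp; apply: cvgMr_tmp.
  rewrite /far; case: ltP => h; last first.
    rewrite (_ : (fun n => _) = fun=> 0); first exact: cvg_cst.
    by apply/funext => n; rewrite ltNge (le_trans h (ltW (es n))).
  apply: cvg_near_cst; near=> n.
  have -> : s n < `|x - t| by near: n; move/cvgr_lt : se; exact.
  by [].
- by apply: L1_norm; exact: L1_tker.
- apply: aeW => x n; rewrite !normrM ler_wpM2r// ler_wpM2r//.
  rewrite /far; case: ltP => h1; first by rewrite (lt_trans (es n) h1).
  by rewrite normr0.
by [].
Unshelve. all: end_near. Qed.

Lemma countable_bigcapT_measurable (I : countType) (A : I -> set R) :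
  (forall i, measurable (A i)) -> measurable (\bigcap_i A i).
Proof.
move=> mA; rewrite -[X in measurable X]setCK setC_bigcap; apply: measurableC.
by apply: countable_bigcupT_measurable => // i; exact: measurableC.
Qed.

(** Right continuity reduces the Cauchy criterion at 0 to rational arguments, hence to
    countably many measurable conditions. Off the set of convergence the limit is a
    constant default value. *)
Lemma measurable_lim_at_right (T : R -> R -> R) :
  (forall e, 0 < e -> measurable_fun setT (T e)) ->
  (forall e t, 0 < e -> T s t @[s --> e^'+] --> T e t) ->
  measurable_fun setT (fun t => lim (T e t @[e --> 0^'+])).
Proof.
move=> mT rT.
(* The Cauchy condition with precision [1 / (k + 1)] for [p] and [q] in [(0, 1 / (m + 1))];
   it is void for other rationals. *)
pose D (k m : nat) (p q : rat) : set R :=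
  if (0 < p) && (0 < q) && (ratr p < m.+1%:R^-1 :> R) && (ratr q < m.+1%:R^-1 :> R)
  then [set t | `|T (ratr p) t - T (ratr q) t| <= k.+1%:R^-1] else setT.
pose Cv : set R := \bigcap_k \bigcup_m \bigcap_p \bigcap_q D k m p q.
have mD k m p q : measurable (D k m p q).
  rewrite /D; case: ifP => [/andP[/andP[/andP[p0 q0] _] _]|_]; last exact: measurableT.
  rewrite -[X in measurable X]setTI; apply: (@measurable_fun_le _ _ _ setT (fun t => `|T (ratr p) t - T (ratr q) t|) (cst k.+1%:R^-1)) => //.
  by apply: measurableT_comp => //; apply: measurable_funB; apply: mT; rewrite ltr0q.
have mC : measurable Cv.
  apply: bigcapT_measurable => k; apply: bigcupT_measurable => m.
  by apply: countable_bigcapT_measurable => // p; exact: countable_bigcapT_measurable.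
have CvP t : Cv t <-> cvg (T e t @[e --> (0:R)^'+]).
  split.
    move=> Ct; apply: cauchy_cvg; apply: cauchy_exP => e /= e0.
    have [k ke] : exists k : nat, k.+1%:R^-1 < e.
      by have [k _ hk] := near_infty_natSinv_lt (PosNum e0); exists k; apply: hk => /=.
    have [m _ hm] := Ct k I.
    have m0 : 0 < m.+1%:R^-1 :> R by rewrite invr_gt0.
    have [q] := rat_in_itvoo m0; rewrite in_itv/= => /andP[q0 qm].
    exists (T (ratr q) t); near=> s.
    have s0 : 0 < s by [].
    have sm : s < m.+1%:R^-1 by near: s; exact: nbhs_right_lt.
    apply: le_lt_trans ke.
    have cn := rT s t s0.
    have cd : `|T (ratr q) t - T v t| @[v --> s^'+] --> `|T (ratr q) t - T s t|.
      by apply: cvg_norm; apply: cvgB => //; exact: cvg_cst.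
    rewrite leNgt; apply/negP => lt.
    have : \forall v \near s^'+, k.+1%:R^-1 < `|T (ratr q) t - T v t|.
      by move/cvgr_gt : cd; apply.
    move=> [d /= d0 hd].
    have sd : s < Num.min (s + d) m.+1%:R^-1 by rewrite lt_min sm ltrDl d0.
    have [p] := rat_in_itvoo sd; rewrite in_itv/= lt_min => /andP[sp /andP[pd pm]].
    have := hd (ratr p); rewrite /= ltr0_norm ?subr_lt0// opprB ltrBlDl => /(_ pd sp).
    apply/negP; rewrite -leNgt.
    have := hm q I p I; rewrite /D -!(@ltr0q R) q0 (lt_trans s0 sp) qm pm /=.
    exact.
  move=> cl k _; set l := lim (T e t @[e --> (0:R)^'+]) in cl.
  have k0 : 0 < k.+1%:R^-1 / 2 :> R by rewrite divr_gt0// invr_gt0.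
  move/cvgrPdist_lt : cl => /(_ _ k0)[d /= d0 hd].
  have [m md] : exists m : nat, m.+1%:R^-1 < d.
    by have [m _ hm] := near_infty_natSinv_lt (PosNum d0); exists m; apply: hm => /=.
  exists m => // p _ q _; rewrite /D; case: ifP => // /andP[/andP[/andP[p0 q0] pm] qm] /=.
  have hr (r : rat) : 0 < r -> ratr r < m.+1%:R^-1 :> R -> `|l - T (ratr r) t| < k.+1%:R^-1 / 2.
    move=> r0 rm; have r0' : 0 < ratr r :> R by rewrite ltr0q.
    by apply: hd => //=; rewrite sub0r normrN gtr0_norm// (lt_trans rm).
  have h1 := hr p p0 pm; have h2 := hr q q0 qm.
  rewrite (_ : _ - _ = (l - T (ratr q) t) - (l - T (ratr p) t)); last by ring.
  by rewrite (le_trans (ler_normB _ _))// (splitr k.+1%:R^-1) lerD// ltW.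
pose g n t : R := if t \in Cv then T n.+1%:R^-1 t else point.
have mg n : measurable_fun setT (g n).
  apply: measurable_fun_ifT => //; last by apply: mT; rewrite invr_gt0.
  apply: (measurable_fun_bool true); rewrite setTI.
  by rewrite (_ : _ @^-1` _ = Cv)//; apply/seteqP; split => t /= => [/set_mem|/mem_set].
apply: (measurable_fun_cvg mg) => t _; rewrite /g; have [|] := boolP (t \in Cv).
  rewrite inE => /CvP cl.
  move/cvg_at_rightP : cl; apply; split; last exact: cvg_harmonic.
  by move=> n; rewrite invr_gt0.
by rewrite notin_setE => /CvP/dvgP ->; exact: cvg_cst.
Unshelve. all: end_near. Qed.

Lemma measurable_hilbert_transform u : Lw u -> measurable_fun setT (hilbert_transform u).
Proof.
move=> lu; apply: measurable_funM => //.
rewrite (_ : (fun t => _) = fun t => lim (truncp u e t @[e --> 0^'+])).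
  apply: (@measurable_lim_at_right (truncp u)) => [e _|e t]; last exact: truncp_right_cvg.
  by apply: measurable_truncp; case: lu.
apply/funext => t.
by rewrite (_ : (fun e : R => _) = truncp u ^~ t)//; apply/funext => e; rewrite truncpE.
Qed.

End hilbert_measurable.

(** * The Stieltjes class *)
Section main.
Variable R : realType.
Local Notation mu := (@lebesgue_measure R).
Local Notation C := R[i].
Local Notation Re := (@complex.Re R).
Local Notation Im := (@complex.Im R).
Implicit Types (t x y e : R).

Lemma ae_eq_Rintegral (f g : R -> R) : measurable_fun setT f -> measurable_fun setT g ->
  {ae mu, forall x, f x = g x} -> \int[mu]_x f x = \int[mu]_x g x.
Proof.
move=> mf mg fg; rewrite /Rintegral; congr fine; apply: ae_eq_integral => //.
- exact/measurable_EFinP.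
- exact/measurable_EFinP.
- by apply: ae_mono fg => x -> _.
Qed.

Section perturbation.
Variable h : R -> R.
Hypothesis lh : Lw h.
Let F x := expR (2 * h x).
Hypothesis lF : L1 F.
Let H := hilbert_transform (fun x => 2 * h x).
Let FcosH x := F x * cos (H x).
Let FsinH x := F x * sin (H x).

Lemma Lw_double : Lw (fun x => 2 * h x).
Proof.
have [m1 l1] := lh; split; first exact: measurable_funM.
rewrite (_ : (fun x => _) = fun x => 2 * (wt x * h x)); first exact: L1Z.
by apply/funext => x; ring.
Qed.

Lemma measurable_cosH : measurable_fun setT (fun x => cos (H x)).
Proof.
apply: measurableT_comp; last exact: measurable_hilbert_transform Lw_double.
by apply: continuous_measurable_fun; exact: continuous_cos.
Qed.

Lemma measurable_sinH : measurable_fun setT (fun x => sin (H x)).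
Proof.
apply: measurableT_comp; last exact: measurable_hilbert_transform Lw_double.
by apply: continuous_measurable_fun; exact: continuous_sin.
Qed.

Let mFc : measurable_fun setT FcosH.
Proof. by apply: measurable_funM; [exact: L1_measurable|exact: measurable_cosH]. Qed.

Let mFs : measurable_fun setT FsinH.
Proof. by apply: measurable_funM; [exact: L1_measurable|exact: measurable_sinH]. Qed.

(** Restates [outer2_orth] and the Poisson formula at the point [i] in terms of the Hilbert
    transform. Both integrals against [wt] cannot vanish, because [outer2] has no zeros. *)
Lemma boundary_orthogonality :
  (forall (N : R -> R -> C) (m : nat), (forall b, exists N', holo (- 1) b N N') ->
    (forall r, 1 <= r -> exists K, forall x y, 0 <= y -> cn (N x y * qdamp r x y ^+ m) <= K) ->
    L1 (fun x => cn (N x 0) * F x) ->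
    \int[mu]_x (Re (N x 0) * FcosH x - Im (N x 0) * FsinH x) = 0) /\
  ~ (\int[mu]_x (wt x * FcosH x) = 0 /\ \int[mu]_x (wt x * FsinH x) = 0).
Proof.
have [ys [E [sR [sI [[ysb ys0] lE bd lim [[lR PR] [lI PI] P1 P2]]]]]] := outer_boundary lh lF.
have [mR _] := lR; have [mI _] := lI.
have ae := hilbert_transform_boundary lh lR lI PR PI.
have m1 : measurable_fun setT (fun x => sR x ^+ 2 - sI x ^+ 2).
  by apply: measurable_funB; apply: measurable_funX.
have m2 : measurable_fun setT (fun x => 2 * (sR x * sI x)).
  by apply: measurable_funM => //; exact: measurable_funM.
have mw := @measurable_wt R.
split=> [N m hN bN lN|[z1 z2]].
- have [N' h1] := hN 1.
  have [n1 n2] := ccont_meas (holo_ccont h1 (y := 0) ltac:(by rewrite ltrN10 ltr01)).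
  rewrite -[RHS](outer2_orth lh lF ysb ys0 lE m1 m2 bd lim hN bN _ lN).
    apply: ae_eq_Rintegral.
    + by apply: measurable_funB; apply: measurable_funM.
    + by apply: measurable_funB; apply: measurable_funM.
    + by apply: ae_mono ae => x /= [<- <-].
  apply: ae_mono ae => x /= [<- <-]; rewrite !normrM (ger0_norm (expR_ge0 _)) -mulrDr mulrC.
  rewrite ler_wpM2r ?expR_ge0// (_ : 2 = 1 + 1)//.
  by apply: lerD; [exact: cos_max|exact: sin_max].
- have eW (p q : R -> R) : measurable_fun setT p -> measurable_fun setT q ->
    {ae mu, forall x, p x = q x} -> \int[mu]_x (wt x * p x) = \int[mu]_x (pois 0 1 x * q x).
    move=> mp mq pq; transitivity (\int[mu]_x (wt x * q x)).
      apply: ae_eq_Rintegral; [exact: measurable_funM|exact: measurable_funM|].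
      by apply: ae_mono pq => x ->.
    by apply: eq_Rintegral => x _; rewrite wt_pois.
  have pi0 : (pi : R) != 0 by rewrite gt_eqF// pi_gt0.
  have r0 : Re (outer2 h 0 1) = 0.
    apply/eqP; rewrite -(mulrI_eq0 _ (lregP pi0)) -P1// -(eW _ _ mFc m1) ?z1//.
    by apply: ae_mono ae => x /= [].
  have i0 : Im (outer2 h 0 1) = 0.
    apply/eqP; rewrite -(mulrI_eq0 _ (lregP pi0)) -P2// -(eW _ _ mFs m2) ?z2//.
    by apply: ae_mono ae => x /= [].
  have := cn_outer2 h 0 1; rewrite sqr_cn_outer cnE r0 i0 !expr0n addr0 sqrtr0.
  by move/eqP; rewrite lt_eqF// expR_gt0.
Qed.

(** Pair with [z ^ n] and with [- i z ^ n]. *)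
Lemma moments_vanish n : L1 (fun x => x ^+ n * F x) ->
  \int[mu]_x (x ^+ n * FcosH x) = 0 /\ \int[mu]_x (x ^+ n * FsinH x) = 0.
Proof.
move=> ln; have [orth _] := boundary_orthogonality.
have realX x : (Complex x 0 : C) ^+ n = Complex (x ^+ n) 0.
  elim: n {ln} => [|k IH]; first by rewrite !expr0.
  by rewrite !exprS IH; apply: ceqP; rewrite ?cReM ?cImM /=; ring.
have hX b : exists N', holo (- 1) b (fun x y => (Complex x y : C) ^+ n) N'.
  by apply: holo_pow; exact: holo_id.
have zq r x y : 1 <= r -> 0 <= y -> cn ((Complex x y : C) ^+ n * qdamp r x y ^+ n) <= r ^+ n.
  move=> r1 y0; rewrite cnM !cnX -exprMn; have r0 : 0 <= r by exact: le_trans r1.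
  rewrite lerXn2r ?nnegrE ?mulr_ge0 ?cn_ge0//.
  rewrite -(ler_pXn2r (n := 2)) ?nnegrE ?mulr_ge0 ?cn_ge0// exprMn sqr_cn_qdamp// sqr_cn /=.
  have d0 : 0 < x ^+ 2 + (y + r) ^+ 2 by apply: den_gt0; lra.
  rewrite mulrCA ler_piMr ?sqr_ge0// ler_pdivrMr// mul1r lerD2l lerXn2r ?nnegrE ?addr_ge0//; lra.
have lX (z : R -> C) : (forall x, cn (z x) = cn ((Complex x 0 : C) ^+ n)) ->
    L1 (fun x => cn (z x) * F x).
  move=> ez; rewrite (_ : (fun x => _) = fun x => `|x ^+ n * F x|); first exact: L1_norm.
  apply/funext => x; rewrite ez realX cnE /= expr0n addr0 sqrtr_sqr normrM.
  by rewrite [`|F x|]ger0_norm// expR_ge0.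
split.
- rewrite -[RHS](orth (fun x y => (Complex x y : C) ^+ n) n hX); last exact: lX.
  + by apply: eq_Rintegral => x _; rewrite realX /= mul0r subr0.
  + by move=> r r1; exists (r ^+ n) => x y y0; exact: zq.
- rewrite -[RHS](orth (fun x y => - ci R * (Complex x y : C) ^+ n) n).
  + apply: eq_Rintegral => x _; rewrite mulNr cReN cImN Re_ci Im_ci realX /=; ring.
  + move=> b; have [N' hN'] := hX b; eexists; exact: holo_mul (holo_cst _ _ _) hN'.
  + by move=> r r1; exists (r ^+ n) => x y y0; rewrite -mulrA cnM cnN cn_ci mul1r zq.
  + by apply: lX => x; rewrite cnM cnN cn_ci mul1r.
Qed.

(** Pairing with [1 / (z + i)] and [i / (z + i)] gives the relations [o1] and [o2], by which
    the integral against [wt] of either function is determined by the other function. *)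
Lemma perturbation_nontrivial :
  ~ {ae mu, forall x, FcosH x = 0} /\ ~ {ae mu, forall x, FsinH x = 0}.
Proof.
have [orth nz] := boundary_orthogonality.
have mw := @measurable_wt R.
have md : measurable_fun setT (fun x : R => Num.sqrt (wt x)).
  apply: measurableT_comp => //; apply: continuous_measurable_fun; exact: sqrt_continuous.
pose P x y : C := (Complex x y - Complex 0 (- 1))^-1.
have hP b : exists N', holo (- 1) b P N'.
  by eexists; apply: holo_inv; rewrite /= lexx.
have cP x y : 0 <= y -> cn (P x y) ^+ 2 <= 1.
  move=> y0; rewrite cnV exprVn sqr_cn_pole invf_le1; last by apply: den_gt0; lra.
  by have := sqr_ge0 x; nra.
have cP1 x y : 0 <= y -> cn (P x y) <= 1.
  by move=> y0; have := cP x y y0; rewrite expr_le1 ?cn_ge0.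
have cP0 x : cn (P x 0) = Num.sqrt (wt x).
  apply/esym/eqP; rewrite -(@eqrXn2 _ 2) ?sqrtr_ge0 ?cn_ge0// sqr_sqrtr ?wt_ge0//.
  by rewrite cnV exprVn sqr_cn_pole add0r expr1n addrC.
have lP (z : R -> C) : (forall x, cn (z x) = cn (P x 0)) -> L1 (fun x => cn (z x) * F x).
  move=> ez; apply: (@L1_le _ _ F) => //.
  - apply: measurable_funM; last exact: L1_measurable.
    by rewrite (_ : (fun x => _) = fun x => Num.sqrt (wt x))//; apply/funext => x; rewrite ez cP0.
  - move=> x; rewrite normrM (ger0_norm (expR_ge0 _)) (ger0_norm (cn_ge0 _)) ez.
    by rewrite ler_piMl ?expR_ge0// cP1.
have RP x : Re (P x 0) = x * wt x.
  by rewrite cReV /= subr0 opprK add0r expr1n /wt addrC.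
have IP x : Im (P x 0) = - wt x.
  by rewrite cImV /= subr0 opprK add0r expr1n /wt addrC mulN1r.
have o1 : \int[mu]_x (x * wt x * FcosH x + wt x * FsinH x) = 0.
  rewrite -[RHS](orth P 0 hP).
  - by apply: eq_Rintegral => x _; rewrite RP IP; ring.
  - by move=> r r1; exists 1 => x y y0; rewrite expr0 mulr1 cP1.
  - exact: lP.
have o2 : \int[mu]_x (wt x * FcosH x - x * wt x * FsinH x) = 0.
  rewrite -[RHS](orth (fun x y => ci R * P x y) 0).
  - by apply: eq_Rintegral => x _; rewrite Re_ci Im_ci RP IP; ring.
  - move=> b; have [N' hN'] := hP b; eexists; exact: holo_mul (holo_cst _ _ _) hN'.
  - by move=> r r1; exists 1 => x y y0; rewrite expr0 mulr1 cnM cn_ci mul1r cP1.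
  - by apply: lP => x; rewrite cnM cn_ci mul1r.
have mx : measurable_fun setT (fun x : R => x * wt x) by exact: measurable_funM.
have i0 : \int[mu]_x (0 : R) = 0 by rewrite /Rintegral integral0.
split=> z; apply: nz; split.
- rewrite -[RHS]i0; apply: ae_eq_Rintegral => //; first exact: measurable_funM.
  by apply: ae_mono z => x ->; rewrite mulr0.
- rewrite -o1; apply: ae_eq_Rintegral; first exact: measurable_funM.
    by apply: measurable_funD; apply: measurable_funM.
  by apply: ae_mono z => x ->; rewrite mulr0 add0r.
- rewrite -o2; apply: ae_eq_Rintegral; first exact: measurable_funM.
    by apply: measurable_funB; apply: measurable_funM.
  by apply: ae_mono z => x ->; rewrite mulr0 subr0.
- rewrite -[RHS]i0; apply: ae_eq_Rintegral => //; first exact: measurable_funM.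
  by apply: ae_mono z => x ->; rewrite mulr0.
Qed.

End perturbation.

(** Since [ln f <= f], the negative part of the logarithmic integral always converges; so
    its finiteness is absolute convergence. As [lne 0] is infinite, it also forces [f > 0]
    almost everywhere. *)
Lemma finite_log_integral_Lw (f : R -> R) : is_density f -> finite_log_integral f ->
  {ae mu, forall x, 0 < f x} /\ Lw (fun x => ln (f x)).
Proof.
move=> [mf f0 f1] fl.
pose G x : \bar R := (- lne (f x)%:E * (wt x)%:E)%E.
have mlne : measurable_fun setT (fun x => lne (f x)%:E).
  rewrite (_ : (fun x => _) = fun x => if 0 < f x then (ln (f x))%:E else -oo%E).
    apply: measurable_fun_ifT => //; first exact: measurable_fun_ltr.
    by apply/measurable_EFinP; exact: measurableT_comp (@measurable_ln R) mf.
  apply/funext => x; case: ifPn => [p|]; first by rewrite lne_EFin.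
  by rewrite -leNgt => n; rewrite le0_lneNy// lee_fin.
have mG : measurable_fun setT G.
  apply: emeasurable_funM; last by apply/measurable_EFinP; exact: measurable_wt.
  exact: measurableT_comp.
have GN : (\int[mu]_x G^\- x <= 1)%E.
  rewrite -f1; apply: ge0_le_integral => //.
  - exact: measurable_funeneg.
  - exact/measurable_EFinP.
  - move=> x _; rewrite funenegE /G mulNe oppeK ge_max lee_fin f0 andbT.
    have [p|n] := ltP 0 (f x).
      rewrite lne_EFin// -EFinM lee_fin.
      have w1 : wt x <= 1 by rewrite invf_le1 ?oneDsq_gt0// lerDl sqr_ge0.
      have := ln_sublinear p; have := wt_ge0 x; nra.
    by rewrite le0_lneNy ?lee_fin// gt0_mulNye ?lte_fin ?wt_gt0// leNye.
have GN0 : (0 <= \int[mu]_x G^\- x)%E by exact: integral_ge0.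
have GNf : (\int[mu]_x G^\- x)%E \is a fin_num.
  by rewrite ge0_fin_numE// (le_lt_trans GN)// ltry.
have GP : (\int[mu]_x G^\+ x < +oo)%E.
  move: fl; rewrite /finite_log_integral integralE lteBlDr// => /lt_le_trans; apply; exact: leey.
have iG : mu.-integrable setT G.
  apply/integrableP; split => //.
  have -> : (\int[mu]_x `|G x| = \int[mu]_x (G^\+ x + G^\- x))%E.
    by apply: eq_integral => x _; rewrite -[RHS]/((G^\+ \+ G^\-)%E x) -fune_abse.
  rewrite ge0_integralD//; [|exact: measurable_funepos|exact: measurable_funeneg].
  by rewrite lte_add_pinfty// (le_lt_trans GN)// ltry.
have wn0 x : (0 < (wt x)%:E)%E by rewrite lte_fin wt_gt0.
split.
  apply: ae_mono (integrable_ae measurableT iG) => x /(_ I).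
  have [//|n] := ltP 0 (f x).
  by rewrite /G le0_lneNy ?lee_fin//= gt0_mulye.
have ml : measurable_fun setT (fun x => ln (f x)) by exact: measurableT_comp (@measurable_ln R) mf.
split => //; apply: le_integrable iG => //.
  by apply/measurable_EFinP; apply: measurable_funM => //; exact: measurable_wt.
move=> x _ /=; rewrite /G; have [p|n] := ltP 0 (f x).
  by rewrite lne_EFin// -EFinN -EFinM lee_fin /= mulNr normrN mulrC.
by rewrite ln0// mulr0 normr0 abse_ge0.
Qed.

End main.

Theorem theorem1 (R : realType) (f : R -> R)
    (f_density : is_density f) (f_moments : finite_moments f)
    (f_log : finite_log_integral f) :
  is_stieltjes_class f (fun t => cos (hilbert_transform (fun x => ln (f x)) t))
  /\
  is_stieltjes_class f (fun t => sin (hilbert_transform (fun x => ln (f x)) t)).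
Proof.
have [fpos lu] := finite_log_integral_Lw f_density f_log.
have [mf f0 f1] := f_density.
(* Off a null set [f = expR (2 * h)]; the right-hand side is 1 where [f] vanishes. *)
pose h (x : R) := 2^-1 * ln (f x).
have uh x : 2 * h x = ln (f x) by rewrite /h mulrA mulfV ?mul1r// pnatr_eq0.
have ue : (fun x => ln (f x)) = (fun x => 2 * h x) by apply/funext => x; rewrite uh.
have lh : Lw h.
  have [m1 l1] := lu; split; first exact: measurable_funM.
  rewrite (_ : (fun x => _) = fun x => 2^-1 * (wt x * ln (f x))); first exact: L1Z.
  by apply/funext => x; rewrite /h; ring.
have fF : {ae @lebesgue_measure R, forall x, f x = expR (2 * h x)}.
  by apply: ae_mono fpos => x p; rewrite uh lnK.
have mF : measurable_fun setT (fun x => expR (2 * h x)).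
  apply: measurableT_comp => //; apply: measurable_funM => //; by case: lh.
have lf : L1 f.
  by have [] := L1_ge0 mf f0 f1.
have lXf n : L1 (fun x => x ^+ n * f x).
  case: n => [|n]; last exact: f_moments.
  by rewrite (_ : (fun x => _) = f)//; apply/funext => x; rewrite expr0 mul1r.
have L1F (g : R -> R) : measurable_fun setT g -> L1 (fun x => g x * f x) ->
    L1 (fun x => g x * expR (2 * h x)).
  move=> mg lg; apply: (@dominated_cvgR R (fun _ x => g x * f x) _ (fun x => `|g x * f x|) _ _ _ (L1_norm lg) _).1.
  - by move=> _; exact: measurable_funM.
  - exact: measurable_funM.
  - by apply: ae_mono fF => x ->; exact: cvg_cst.
  - by apply: aeW => x _.
have mX n : measurable_fun setT (fun x : R => x ^+ n) by exact: measurable_funX.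
have lF : L1 (fun x => expR (2 * h x)).
  have := L1F _ (mX 0%N) (lXf 0%N); rewrite (_ : (fun x => _) = fun x => expR (2 * h x))//.
  by apply/funext => x; rewrite expr0 mul1r.
have [nc ns] := perturbation_nontrivial lh lF.
rewrite ue.
have cls (k : R -> R) : measurable_fun setT k -> (forall x, `|k x| <= 1) ->
    (forall n, \int[@lebesgue_measure R]_x (x ^+ n * (expR (2 * h x) * k x)) = 0) ->
    ~ {ae @lebesgue_measure R, forall x, expR (2 * h x) * k x = 0} ->
    is_stieltjes_class f k.
  move=> mk k1 mom nz; split => //.
  - move=> n.
    have lk : L1 (fun x => x ^+ n * f x * k x).
      apply: (@L1_le _ _ (fun x => `|x ^+ n * f x|)); last exact: L1_norm.
        by apply: measurable_funM => //; exact: measurable_funM.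
      by move=> x; rewrite normrM ler_piMr.
    rewrite L1_integral//; transitivity ((0 : R)%:E) => //; congr EFin.
    rewrite -[RHS](mom n); apply: ae_eq_Rintegral.
    + exact: L1_measurable.
    + by apply: measurable_funM => //; exact: measurable_funM.
    + by apply: ae_mono fF => x ->; rewrite mulrA.
  - move=> z; apply: nz.
    by apply: ae_mono (ae_and fF z) => x [<-].
split; apply: cls.
- exact: measurable_cosH.
- by move=> x; exact: cos_max.
- by move=> n; have [] := moments_vanish lh lF (L1F _ (mX n) (lXf n)).
- exact: nc.
- exact: measurable_sinH.
- by move=> x; exact: sin_max.
- by move=> n; have [] := moments_vanish lh lF (L1F _ (mX n) (lXf n)).
- exact: ns.
Qed.
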